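(* Consider $K\ge2$-armed bandits with horizon $T\ge K$, and run Algorithm 1 (described in the context) with the Shannon-entropy regularizer $\phi^t(p)=-C_{\log}\sum_{i\in[K]}\log p_i+\sum_{i\in[K]}\gamma^t_i\,p_i\log(p_i/e)$ and parameters $C_{\log}=162\log K$, $\alpha=1$, $\theta=\sqrt{1/\log T}$. Then against every environment, $\mathrm{Reg}^T=\mathcal{O}(\sqrt{KT}\log T)$. Simultaneously, whenever the environment satisfies the self-bounding condition with gap vector $\Delta$ and constant $C$, and $D$ is any real number with $\mathbb{E}\big[\sum_{t=1}^T\max_{i\in U}\mathbb{E}^t[\ell^t_i-\ell^t_{i^\star}]\big]\le D$, we have $$\mathrm{Reg}^T=\mathcal{O}\Big(\mathbb{G}(\log T)^2+\sqrt{C\,\mathbb{G}(\log T)^2}+K^2(\log T)^{3/2}+D\Big).$$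
   Context: Multi-armed bandit protocol: arms $[K]=\{1,\dots,K\}$, rounds $t=1,\dots,T$. In each round the learner picks $i^t\in[K]$ while the environment (possibly adaptively, with knowledge of the learner's algorithm) picks $\ell^t\in[0,1]^K$; the learner suffers and observes only $\ell^t_{i^t}$. The pseudo-regret is $\mathrm{Reg}^T=\mathbb{E}\big[\sum_{t=1}^T\ell^t_{i^t}-\sum_{t=1}^T\ell^t_{i^\star}\big]$ where $i^\star\in\arg\min_{i\in[K]}\mathbb{E}[\sum_{t=1}^T\ell^t_i]$ and the expectation is over the randomness of learner and environment; $\mathbb{E}^t[\cdot]$ denotes expectation conditional on the history before round $t$. $\Omega_K$ is the probability simplex in $\mathbb{R}^K$. Algorithm 1 (FTRL) with parameters $\theta>0$, $\alpha\in[0,1]$, $C_{\log}>0$: for $t=1,\dots,T$, set learning rates $\gamma^t_i=\theta\sqrt{1+\sum_{\tau=1}^{t-1}(\max\{p^\tau_i,1/T\})^{1-2\alpha}}$, compute $p^t=\arg\min_{p\in\Omega_K}\{\langle p,\sum_{\tau<t}\hat\ell^\tau\rangle+\phi^t(p)\}$, draw $i^t\sim p^t$, observe $\ell^t_{i^t}$, and set $\hat\ell^t_i=\mathbb{1}\{i^t=i\}\ell^t_i/p^t_i$ for all $i$. Self-bounding (stochastic) condition: there exist $\Delta\in[0,1]^K$ and $C\ge0$ such that $\mathrm{Reg}^T\ge\mathbb{E}\big[\sum_{t=1}^T\sum_{i\in[K]}\Pr[i^t=i]\Delta_i\big]-C$. Then $U=\{i:\Delta_i=0\}$, $V=[K]\setminus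 U$, $\Delta_{\min}=\min_{i\in V}\Delta_i$, and $\mathbb{G}=\frac{|U|}{\Delta_{\min}}+\sum_{i\in V}\frac{1}{\Delta_i}$. $\mathcal{O}(\cdot)$ hides absolute constants. *)

(* Defs.v *)
From HB Require Import structures.
From mathcomp Require Import all_boot all_order all_algebra.
From mathcomp Require Import all_classical all_reals all_analysis.
From Stdlib Require Import ClassicalEpsilon.

Set Implicit Arguments.
Unset Strict Implicit.
Unset Printing Implicit Defensive.

Import Order.TTheory GRing.Theory Num.Theory.
Local Open Scope classical_set_scope.
Local Open Scope ring_scope.

(* Conventions: arms are 'I_K, rounds are 0-based t = 0, ..., T-1 (round t
   here is round t+1 of the paper). A loss vector is a function 'I_K -> R. *)

Section FTRL.
Variables (R : realType) (K T : nat).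

(* Interior of the probability simplex Omega_K. The Shannon/log-barrier
   objective is +oo on the boundary, so the argmin over Omega_K is the argmin
   over its interior. *)
Definition simplex_int (p : 'I_K -> R) : Prop :=
  (forall i, 0 < p i) /\ \sum_(i < K) p i = 1.

Definition shannon_reg (Clog : R) (gam : 'I_K -> R) (p : 'I_K -> R) : R :=
  - Clog * \sum_(i < K) ln (p i) + \sum_(i < K) gam i * p i * ln (p i / expR 1).

Definition ftrl_obj (Clog : R) (gam Lhat : 'I_K -> R) (p : 'I_K -> R) : R :=
  \sum_(i < K) p i * Lhat i + shannon_reg Clog gam p.

Definition ftrl_argmin (Clog : R) (gam Lhat : 'I_K -> R) : 'I_K -> R :=
  epsilon (inhabits (fun _ => 0))
    (fun p => simplex_int p /\
       forall q, simplex_int q -> ftrl_obj Clog gam Lhat p <= ftrl_obj Clog gam Lhat q).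

(* gamma^t_i = theta * sqrt(1 + S_i), S_i = sum_{tau<t} max(p^tau_i, 1/T)^(1-2 alpha) *)
Definition lrate (theta : R) (S : 'I_K -> R) : 'I_K -> R :=
  fun i => theta * Num.sqrt (1 + S i).

(* Algorithm state: (cumulative loss estimates Lhat, sums S). One round with
   observation (i^t, l^t_{i^t}) updates both. *)
Definition alg_step (theta alpha Clog : R)
    (st : ('I_K -> R) * ('I_K -> R)) (obs : 'I_K * R) : ('I_K -> R) * ('I_K -> R) :=
  let p := ftrl_argmin Clog (lrate theta st.2) st.1 in
  ((fun j => st.1 j + (if j == obs.1 then obs.2 / p j else 0)),
   (fun j => st.2 j + (Num.max (p j) (T%:R)^-1) `^ (1 - 2 * alpha))).

Definition alg_state (theta alpha Clog : R) (h : seq ('I_K * R)) :=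
  foldl (alg_step theta alpha Clog) ((fun _ => 0), (fun _ => 0)) h.

Definition alg_p (theta alpha Clog : R) (h : seq ('I_K * R)) : 'I_K -> R :=
  let st := alg_state theta alpha Clog h in
  ftrl_argmin Clog (lrate theta st.2) st.1.

(* Observation history generated by an (adaptive) loss tree
   loss : round -> past actions -> loss vector, along the action sequence s. *)
Fixpoint hist_aux (loss : nat -> seq 'I_K -> 'I_K -> R) (pre s : seq 'I_K)
    : seq ('I_K * R) :=
  match s with
  | [::] => [::]
  | a :: s' => (a, loss (size pre) pre a) :: hist_aux loss (rcons pre a) s'
  end.

Definition hist (loss : nat -> seq 'I_K -> 'I_K -> R) (s : seq 'I_K) :=
  hist_aux loss [::] s.

End FTRL.

Section Interaction.
(* Environment: all its randomness is omega drawn from a probability space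
   (Omega, P) (independent of the learner's internal randomness); the loss
   vector of round t is env omega t (i^1..i^{t-1}), i.e. it may depend adaptively
   on the learner's past actions (and, through omega, on anything else the
   environment randomizes over). *)
Variables (R : realType) (K T : nat) (d : measure_display) (Omega : measurableType d)
  (P : probability Omega R) (theta alpha Clog : R)
  (env : Omega -> nat -> seq 'I_K -> 'I_K -> R).

Definition play_p (w : Omega) (s : seq 'I_K) (t : nat) : 'I_K -> R :=
  alg_p T theta alpha Clog (hist (env w) (take t s)).

Definition seq_weight (w : Omega) (s : T.-tuple 'I_K) : R :=
  \prod_(t < T) play_p w s t (tnth s t).

Definition Ealg (F : Omega -> T.-tuple 'I_K -> R) : R :=
  Rintegral P setT (fun w => \sum_(s : T.-tuple 'I_K) seq_weight w s * F w s).

Definition loss_alg : R :=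
  Ealg (fun w s => \sum_(t < T) env w t (take t s) (tnth s t)).

Definition loss_arm (i : 'I_K) : R :=
  Ealg (fun w s => \sum_(t < T) env w t (take t s) i).

(* pseudo-regret w.r.t. the comparator istar (to be taken in the argmin) *)
Definition pseudo_regret (istar : 'I_K) : R := loss_alg - loss_arm istar.

Definition gap_term (Delta : 'I_K -> R) : R :=
  Ealg (fun w s => \sum_(t < T) \sum_(i < K) play_p w s t i * Delta i).

Definition self_bounding (istar : 'I_K) (Delta : 'I_K -> R) (C : R) : Prop :=
  pseudo_regret istar >= gap_term Delta - C.

(* The history sigma-algebra before round t along the action prefix a
   (|a| = t): generated by the past loss vectors l^1..l^{t-1} (the past
   actions being fixed to a). *)
Definition hist_sets (t : nat) (a : seq 'I_K) : set (set Omega) :=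
  [set A | exists (j : nat) (i : 'I_K) (B : set R),
      (j < t)%N /\ measurable B /\ A = (fun w => env w j (take j a) i) @^-1` B].

Definition hist_sigma (t : nat) (a : seq 'I_K) : set (set Omega) :=
  <<s hist_sets t a >>.

End Interaction.

Definition is_cond_exp (R : realType) (d : measure_display) (Omega : measurableType d)
    (P : probability Omega R) (G : set (set Omega)) (X g : Omega -> R) : Prop :=
  [/\ (forall B : set R, measurable B -> G (g @^-1` B)),
      P.-integrable setT (EFin \o g) &
      forall A, G A -> (\int[P]_(x in A) (g x)%:E = \int[P]_(x in A) (X x)%:E)%E].

(* max_{i in U} x_i, with U = {i | Delta_i = 0}; 0 by convention if U is empty *)
Definition maxU (R : realType) (K : nat) (Delta : 'I_K -> R) (x : 'I_K -> R) : R :=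
  if [pick i | Delta i == 0] is Some j
  then \big[Num.max/x j]_(i | Delta i == 0) x i else 0.

(* Delta_min = min_{i in V} Delta_i (Delta in [0,1]^K, V nonempty) *)
Definition Delta_min (R : realType) (K : nat) (Delta : 'I_K -> R) : R :=
  \big[Num.min/1]_(i | Delta i != 0) Delta i.

Definition bigG (R : realType) (K : nat) (Delta : 'I_K -> R) : R :=
  #|[set i | Delta i == 0]|%:R / Delta_min Delta + \sum_(i | Delta i != 0) 1 / Delta i.

(* Main.v *)
Require Import Defs.
From HB Require Import structures.
From mathcomp Require Import all_boot all_order all_algebra.
From mathcomp Require Import all_classical all_reals all_analysis.
From mathcomp Require Import measurable_realfun.
From mathcomp Require Import ring lra.
From Stdlib Require ClassicalEpsilon.
Import Order.TTheory GRing.Theory Num.Theory.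
Import numFieldNormedType.Exports.
Local Open Scope classical_set_scope.
Local Open Scope ring_scope.

(* Compare FTRL on the simplex with the same FTRL run on the face
   of a set [U] of arms, driven by the same loss estimates.  If [Phi] and
   [Phi_U] are the two optimal values, the regret of the iterate [p] against
   the face iterate [q] telescopes in [Phi - Phi_U], up to a stability and a
   penalty term.  Both terms are integrals of directional derivatives of
   [Phi - Phi_U] along a segment of losses, resp. of learning rates.  Since
   [p <= q] on [U], the penalty of the arms of [U] is nonpositive.  An explicit
   formula for finite differences of the minimizers (with secants of the
   regularizer in place of its Hessian) shows that the stability of an arm [i]
   of [U], relative to the face, is controlled by the arms outside [U], plus a
   term supported on [p_i < sum_(j notin U) p_j].  Every remaining term has the
   form [y / gamma_i], and AM-GM against the telescoping sum of
   [ln (gamma_i^2)] leaves [ln T (|U| / bU + sum 1 / b_j)] plus [b]-weighted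
   expected pulls of the arms outside [U].  With [U = {i*}] and constant [b]
   this is the adversarial bound.  With [U = {Delta = 0}] and [b_j]
   proportional to [Delta_j], the pulls are absorbed by self-bounding, while
   the regret of [q] itself, supported on [U], is at most [D] by pulling the
   history-measurable [q] out of the conditional expectation. *)

Set Implicit Arguments.
Unset Strict Implicit.
Unset Printing Implicit Defensive.

(** * Slopes of the logarithm and of the regularizer *)

(** Comparison with a single optimal arm would charge [1 / gamma_j] for every other arm, including
    the other arms of gap zero, whose pulls self-bounding does not control. The face iterate shares
    the movement of those arms, so only the excess caused by arms outside [U] is paid. Optimal
    values are infima of functions affine in losses and rates, so minimizers are supergradients of
    them; the implicitly defined iterates are never differentiated. The log-barrier gives
    multiplicative stability: the estimate [z] of the drawn arm has [z * p i <= 1], so [2 <= B]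
    limits the effect of a loss on each probability to a factor 2, and [8 <= B] does the same for a
    rate update. With [alpha = 1] the sum [1 + S] grows by [1 / m], [m = max (p, 1/T)], so
    [1 / ((1 + S) * m)] after the update is at most the increment of [ln (1 + S)]; the floor [1/T]
    keeps the total of order [ln T]. The choice [theta = 1 / sqrt (ln T)] balances the stability
    factor [1 / theta] with the penalty factor [theta * ln T]; AM-GM squares the common value
    [sqrt (ln T)], whence [(ln T)^2]. *)

Section LogSlope.
Context {R : realType}.
Implicit Types x y z : R.

Lemma ln_le_subr1 x : 0 < x -> ln x <= x - 1.
Proof.
move=> x0; have := @le_ln1Dx R (x - 1).
by rewrite (_ : 1 + (x - 1) = x); [apply; lra|ring].
Qed.

Lemma ln_lt_subr1 x : 0 < x -> x != 1 -> ln x < x - 1.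
Proof.
move=> x0 x1; have := @expR_gt1Dx R (ln x).
rewrite ln_eq0// x1 lnK ?posrE// => /(_ isT); lra.
Qed.

Lemma ln_sub_le x y : 0 < x -> 0 < y -> ln y - ln x <= (y - x) / x.
Proof.
move=> x0 y0; rewrite -ln_div ?posrE//.
apply: (le_trans (ln_le_subr1 _)); first by rewrite divr_gt0.
by rewrite mulrBl divff ?gt_eqF.
Qed.

Lemma ln_concave x y z : 0 < x -> x < y -> y < z ->
  (ln z - ln y) * (y - x) <= (ln y - ln x) * (z - y).
Proof.
move=> x0 xy yz; have y0 : 0 < y by lra.
have z0 : 0 < z by lra.
apply: (@le_trans _ _ ((z - y) / y * (y - x))).
  by rewrite ler_wpM2r ?ln_sub_le//; lra.
rewrite [leLHS](_ : _ = (y - x) / y * (z - y)); last by ring.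
rewrite ler_wpM2r//; first lra.
have := ln_sub_le y0 x0; rewrite -(opprB y x) mulNr; lra.
Qed.

(** Divided difference of [ln]. The diagonal value is the derivative, so that monotonicity in each
    argument persists when the two points coincide. *)
Definition lnslope x y : R :=
  if x == y then x^-1 else (ln y - ln x) / (y - x).

Lemma lnslopeC x y : lnslope x y = lnslope y x.
Proof.
rewrite /lnslope (eq_sym y); case: eqVneq => [->//|xy].
by rewrite -(opprB (ln x)) -(opprB x) invrN mulrNN.
Qed.

Lemma lnslopeE x y : ln y - ln x = lnslope x y * (y - x).
Proof.
rewrite /lnslope; case: eqVneq => [->|xy]; first by rewrite !subrr mulr0.
by rewrite divfK// subr_eq0 eq_sym.
Qed.

(** Concavity of [ln]: chords from a fixed endpoint flatten as the other endpoint moves right. The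
    cases are the positions of [x] relative to [y] and [z]. *)
Lemma lnslope_antir x y z : 0 < x -> 0 < y -> y <= z ->
  lnslope x z <= lnslope x y.
Proof.
move=> x0 y0; rewrite le_eqVlt => /orP[/eqP->//|yz].
have z0 : 0 < z by lra.
rewrite /lnslope.
case: (ltgtP x z) => xz; case: (ltgtP x y) => xy; try lra.
- rewrite ler_pdivrMr ?subr_gt0// mulrAC ler_pdivlMr ?subr_gt0//.
  have := ln_concave x0 xy yz; nra.
- rewrite -(opprB (ln x) (ln y)) -(opprB x y) invrN mulrNN.
  rewrite ler_pdivrMr ?subr_gt0// mulrAC ler_pdivlMr ?subr_gt0//.
  have := ln_concave y0 xy xz; nra.
- by rewrite ler_pdivrMr ?subr_gt0// mulrC ln_sub_le.
- rewrite -(opprB (ln x) (ln z)) -(opprB x z) invrN mulrNN.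
  rewrite -(opprB (ln x) (ln y)) -(opprB x y) invrN mulrNN.
  rewrite ler_pdivrMr ?subr_gt0// mulrAC ler_pdivlMr ?subr_gt0//.
  have := ln_concave y0 yz xz; nra.
- rewrite -(opprB (ln x) (ln y)) -(opprB x y) invrN mulrNN.
  rewrite ler_pdivlMr ?subr_gt0// mulrC.
  have := ln_sub_le x0 y0; rewrite -(opprB x y) mulNr; lra.
Qed.

Lemma lnslope_anti x x' y y' : 0 < x -> 0 < x' -> x <= y -> x' <= y' ->
  lnslope y y' <= lnslope x x'.
Proof.
move=> x0 x'0 xy x'y'; apply: (@le_trans _ _ (lnslope y x')).
  by apply: lnslope_antir => //; lra.
by rewrite lnslopeC (lnslopeC x); apply: lnslope_antir.
Qed.

Lemma lnslope_ge x x' m : 0 < x -> 0 < x' -> x <= m -> x' <= m ->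
  m^-1 <= lnslope x x'.
Proof.
move=> x0 x'0 xm x'm; rewrite -[leLHS](_ : lnslope m m = _).
  exact: lnslope_anti.
by rewrite /lnslope eqxx.
Qed.

Lemma lnslope_gt0 x x' : 0 < x -> 0 < x' -> 0 < lnslope x x'.
Proof.
move=> x0 x'0; apply: (@lt_le_trans _ _ (x + x')^-1).
  by rewrite invr_gt0 addr_gt0.
by apply: lnslope_ge => //; lra.
Qed.

End LogSlope.

Section Multiplier.
Context {R : realType}.
Variable B : R.
Hypothesis B0 : 0 < B.
Implicit Types x y g : R.

(** Derivative of one coordinate [- B * ln x + g * x * ln (x / e)] of the regularizer. *)
Definition dpsi g x : R := g * ln x - B / x.

(* Secant version of the inverse Hessian [1 / psi'' = 1 / (B / x^2 + g / x)] of the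
   regularizer: finite differences of minimizers obey the same formulas as their
   derivatives (see [asecE]). *)
Definition asec g x x' : R := (B / (x * x') + g * lnslope x x')^-1.

Lemma asec_inv_gt0 g x x' : 0 <= g -> 0 < x -> 0 < x' ->
  0 < B / (x * x') + g * lnslope x x'.
Proof.
move=> g0 x0 x'0; apply: ltr_wpDr.
  by rewrite mulr_ge0// ltW// lnslope_gt0.
by rewrite divr_gt0// mulr_gt0.
Qed.

Lemma asec_gt0 g x x' : 0 <= g -> 0 < x -> 0 < x' -> 0 < asec g x x'.
Proof. by move=> *; rewrite invr_gt0 asec_inv_gt0. Qed.

Lemma asecE g x x' : 0 <= g -> 0 < x -> 0 < x' ->
  x' - x = asec g x x' * (dpsi g x' - dpsi g x).
Proof.
move=> g0 x0 x'0.
suff -> : dpsi g x' - dpsi g x = (B / (x * x') + g * lnslope x x') * (x' - x).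
  by rewrite mulrA mulVf ?mul1r// gt_eqF// asec_inv_gt0.
rewrite mulrDl -[g * _ * _]mulrA -lnslopeE /dpsi; field.
by rewrite !gt_eqF.
Qed.

Lemma asec_le g x x' y y' : 0 <= g -> 0 < x -> 0 < x' -> x <= y -> x' <= y' ->
  asec g x x' <= asec g y y'.
Proof.
move=> g0 x0 x'0 xy x'y'; have y0 : 0 < y by lra.
have y'0 : 0 < y' by lra.
rewrite lef_pV2 ?posrE ?asec_inv_gt0// lerD//.
  by rewrite ler_pM2l// lef_pV2 ?posrE ?mulr_gt0// ler_pM// ltW.
by rewrite ler_wpM2l// lnslope_anti.
Qed.

Lemma asec_le_B g x x' : 0 <= g -> 0 < x -> 0 < x' -> asec g x x' <= x * x' / B.
Proof.
move=> g0 x0 x'0; rewrite -[leRHS]invf_div lef_pV2 ?posrE ?asec_inv_gt0//.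
  by rewrite lerDl mulr_ge0// ltW// lnslope_gt0.
by rewrite divr_gt0// mulr_gt0.
Qed.

Lemma asec_le_max g x x' m : 0 <= g -> 0 < x -> 0 < x' -> x <= m -> x' <= m ->
  asec g x x' <= m / (B / m + g).
Proof.
move=> g0 x0 x'0 xm x'm; have m0 : 0 < m by lra.
apply: (le_trans (asec_le g0 x0 x'0 xm x'm)).
rewrite le_eqVlt; apply/orP; left; apply/eqP.
rewrite /asec /lnslope eqxx; field.
have gm := mulr_ge0 g0 (ltW m0).
by rewrite !gt_eqF// ltr_pwDl.
Qed.

Lemma dpsi_lt g x y : 0 <= g -> 0 < x -> x < y -> dpsi g x < dpsi g y.
Proof.
move=> g0 x0 xy; have y0 : 0 < y by lra.
have := asecE g0 x0 y0; have := asec_gt0 g0 x0 y0; nra.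
Qed.

Lemma dpsi_ltE g x y : 0 <= g -> 0 < x -> 0 < y -> (dpsi g x < dpsi g y) = (x < y).
Proof.
move=> g0 x0 y0; case: (ltgtP x y) => [xy|xy|->]; last by rewrite ltxx.
- exact: dpsi_lt.
- by apply/negbTE; rewrite -leNgt ltW// dpsi_lt.
Qed.

Lemma dpsi_leE g x y : 0 <= g -> 0 < x -> 0 < y -> (dpsi g x <= dpsi g y) = (x <= y).
Proof. by move=> g0 x0 y0; rewrite !leNgt dpsi_ltE. Qed.

Lemma dpsi_continuous g x : 0 < x -> {for x, continuous (dpsi g)}.
Proof.
move=> x0; apply: cvgB.
  by apply: cvgM; [exact: cvg_cst|exact: continuous_ln].
by apply: cvgM; [exact: cvg_cst|apply: inv_continuous; rewrite gt_eqF].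
Qed.

Lemma dpsi_onto g y : 0 < g -> exists2 x, 0 < x & dpsi g x = y.
Proof.
(* At [a] the barrier term equals [|y| + B] and [ln a <= 0]; at [b] the entropy term equals
   [|y| + B] while the barrier term is at most [B]. So [dpsi g] brackets [y] between them. *)
move=> g0; set a := B / (`|y| + B); set b := expR ((`|y| + B) / g).
have yB : 0 < `|y| + B by rewrite ltr_wpDl.
have a0 : 0 < a by rewrite divr_gt0.
have a1 : a <= 1 by rewrite ler_pdivrMr// mul1r lerDr.
have b1 : 1 <= b by rewrite -expR0 ler_expR ltW// divr_gt0.
have fa : dpsi g a <= y.
  rewrite /dpsi /a invf_div mulrCA divff ?gt_eqF// mulr1.
  have : g * ln a <= 0 by rewrite mulr_ge0_le0 ?ln_le0// ltW.
  have := ler_norm (- y); have := B0; rewrite normrN /a; lra.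
have fb : y <= dpsi g b.
  rewrite /dpsi /b expRK mulrCA divff ?gt_eqF// mulr1 -/b.
  have : B / b <= B.
    by rewrite ler_pdivrMr ?expR_gt0// ler_peMr// ltW.
  have := ler_norm y; have := B0; lra.
have ab : a <= b by lra.
have [||x] := @IVT R (dpsi g) a b y ab.
- apply: continuous_in_subspaceT => x; rewrite inE/= in_itv/= => /andP[ax _].
  by apply: dpsi_continuous; lra.
- by rewrite ge_min le_max fa fb orbT.
rewrite in_itv/= => /andP[ax _] xy; exists x => //; lra.
Qed.

Definition ginv g y : R := xget 0 [set x | 0 < x /\ dpsi g x = y].

Lemma ginvP g y : 0 < g -> 0 < ginv g y /\ dpsi g (ginv g y) = y.
Proof.
move=> g0; have [x x0 xy] := dpsi_onto y g0.
by rewrite /ginv; case: xgetP => [z _ []//|/(_ x)]; case; split.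
Qed.

Lemma ginv_gt0 g y : 0 < g -> 0 < ginv g y.
Proof. by move=> /(ginvP y)[]. Qed.

Lemma ginvK g y : 0 < g -> dpsi g (ginv g y) = y.
Proof. by move=> /(ginvP y)[]. Qed.

Lemma dpsiK g x : 0 < g -> 0 < x -> ginv g (dpsi g x) = x.
Proof.
move=> g0 x0; have [z0 zE] := ginvP (dpsi g x) g0.
have le1 := dpsi_leE (ltW g0) z0 x0; have le2 := dpsi_leE (ltW g0) x0 z0.
by apply/eqP; rewrite eq_le -le1 -le2 zE lexx.
Qed.

Lemma ginv_leE g y z : 0 < g -> (ginv g y <= ginv g z) = (y <= z).
Proof. by move=> g0; rewrite -(@dpsi_leE g) ?ginvK ?ginv_gt0// ltW. Qed.

Lemma ginv_ltE g y z : 0 < g -> (ginv g y < ginv g z) = (y < z).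
Proof. by move=> g0; rewrite -(@dpsi_ltE g) ?ginvK ?ginv_gt0// ltW. Qed.

(** The secant identity makes [ginv] locally Lipschitz: up to [y + 1] its values stay below [M], and
    there [asec] is at most [M * M / B]. *)
Lemma ginv_continuous g : 0 < g -> continuous (ginv g).
Proof.
move=> g0 y; pose M := ginv g (y + 1); have M0 : 0 < M by exact: ginv_gt0.
have C0 : 0 < M * M / B by rewrite divr_gt0// mulr_gt0.
apply/(@cvgrPdist_lt _ R^o) => e e0; near=> z.
have z1 : z <= y + 1.
  have : `|y - z| < 1 by near: z; exact: (@cvgr_dist_lt _ R^o).
  by rewrite ltr_norml; lra.
have [y0 z0] := (ginv_gt0 y g0, ginv_gt0 z g0).
rewrite (asecE (ltW g0) z0 y0) !ginvK// normrM.
have a0 := asec_gt0 (ltW g0) z0 y0.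
rewrite gtr0_norm//.
apply: (@le_lt_trans _ _ (M * M / B * `|y - z|)).
  rewrite ler_wpM2r//; apply: (le_trans (asec_le_B (ltW g0) z0 y0)).
  by rewrite ler_pM2r ?invr_gt0// ler_pM// ?ginv_leE// ?ltW//; lra.
rewrite mulrC -ltr_pdivlMr//; near: z.
by apply: (@cvgr_dist_lt _ R^o); [exact: cvg_id|rewrite divr_gt0].
Unshelve. all: by end_near.
Qed.

End Multiplier.

(** * The FTRL minimizer on a face of the simplex *)

Section Entropy.
Context {R : realType}.
Implicit Types x y : R.

(** This is [- x * ln (x / e)]. The shift by [e] makes it nonnegative and increasing on the whole of
    []0, 1]], unlike [- x * ln x]; the sign argument for the penalty rests on this monotonicity. *)
Definition hent x : R := x * (1 - ln x).

Lemma hent_le x y : 0 < x -> x <= y -> y <= 1 -> hent x <= hent y.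
Proof.
move=> x0 xy y1; have y0 : 0 < y by lra.
have := ln_sub_le x0 y0; have := ln_le0 y1.
rewrite /hent => h1; rewrite ler_pdivlMr// => h2; nra.
Qed.

Lemma hent_ge0 x : 0 <= x -> x <= 1 -> 0 <= hent x.
Proof. by move=> x0 x1; rewrite mulr_ge0// subr_ge0 (le_trans (ln_le0 x1)). Qed.

Lemma hent_le1 x : 0 < x -> x <= 1 -> hent x <= 1.
Proof. by move=> x0 x1; apply: (le_trans (hent_le x0 x1 (lexx _))); rewrite /hent ln1 subr0 mulr1. Qed.

End Entropy.

Section FTRLSolution.
Context {R : realType} {I : finType}.
Variable B : R.
Hypothesis B0 : 0 < B.
Implicit Types (U W : {set I}) (g L x y : I -> R).

Definition mass U g L (l : R) : R := \sum_(i in U) ginv B (g i) (l - L i).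

(* The Lagrange multiplier of the constraint [\sum_(i in U) x i = 1]. *)
Definition lam U g L : R := xget 0 [set l | mass U g L l = 1].

Definition sol U g L (i : I) : R :=
  if i \in U then ginv B (g i) (lam U g L - L i) else 0.

Definition obj U g L x : R :=
  \sum_(i in U) (x i * L i - B * ln (x i) - g i * hent (x i)).

Lemma mass_continuous U g L : (forall i, 0 < g i) -> continuous (mass U g L).
Proof.
move=> g0; apply: continuous_big => [|i _ l]; first exact: (@add_continuous R^o).
apply: (@continuous_comp _ _ _ (fun l => l - L i) (ginv B (g i))).
  by apply: (@cvgB R R^o); [exact: cvg_id|exact: cvg_cst].
exact: ginv_continuous.
Qed.

Lemma mass_lt U g L i0 l l' : (forall i, 0 < g i) -> i0 \in U -> l < l' ->
  mass U g L l < mass U g L l'.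
Proof.
move=> g0 i0U ll'; rewrite /mass (bigD1 i0)//= [ltRHS](bigD1 i0)//=.
rewrite ltr_leD// ?ginv_ltE ?ltrD2r//.
by apply: ler_sum => i _; rewrite ginv_leE// lerD2r ltW.
Qed.

Lemma lamP U g L i0 : (forall i, 0 < g i) -> i0 \in U -> mass U g L (lam U g L) = 1.
Proof.
move=> g0 i0U.
have card0 : 0 < #|U|%:R :> R by rewrite ltr0n; apply/card_gt0P; exists i0.
(* Bracketing of the multiplier: at [lo] every coordinate is at most [1 / #|U|], so the mass is at
   most 1; at [hi] the coordinate [i0] alone has mass 1. *)
set u := (#|U|%:R)^-1 : R; have u0 : 0 < u by rewrite invr_gt0.
set hi := L i0 + dpsi B (g i0) 1.
set lo := \big[Num.min/hi]_(i in U) (L i + dpsi B (g i) u).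
have mlo : mass U g L lo <= 1.
  rewrite -[leRHS](@divff _ #|U|%:R) ?gt_eqF// -/u mulr_natl -sumr_const.
  apply: ler_sum => i iU; rewrite -[leRHS](dpsiK B0 (g0 i) u0) ginv_leE//.
  rewrite lerBlDl; exact: bigmin_le_cond.
have mhi : 1 <= mass U g L hi.
  have hiE : hi - L i0 = dpsi B (g i0) 1 by rewrite /hi addrC addKr.
  rewrite /mass (bigD1 i0)//= hiE dpsiK// lerDl.
  by apply: sumr_ge0 => i _; rewrite ltW// ginv_gt0.
have lohi : lo <= hi by exact: bigmin_le_id.
have [||l _ lE] := @IVT R (mass U g L) lo hi 1 lohi.
- by apply: continuous_subspaceT; exact: mass_continuous.
- by rewrite ge_min le_max mlo mhi orbT.
by rewrite /lam; case: xgetP => [//|/(_ l)].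
Qed.

Lemma sol_out U g L i : i \notin U -> sol U g L i = 0.
Proof. by rewrite /sol => /negbTE->. Qed.

Section Spec.
Variables (U : {set I}) (g L : I -> R) (i0 : I).
Hypotheses (g0 : forall i, 0 < g i) (i0U : i0 \in U).

Lemma sol_gt0 i : i \in U -> 0 < sol U g L i.
Proof. by rewrite /sol => ->; exact: ginv_gt0. Qed.

Lemma sol_ge0 i : 0 <= sol U g L i.
Proof. by rewrite /sol; case: ifP => // _; rewrite ltW// ginv_gt0. Qed.

Lemma sol_sum : \sum_(i in U) sol U g L i = 1.
Proof. by rewrite -(lamP L g0 i0U); apply: eq_bigr => i iU; rewrite /sol iU. Qed.

Lemma sol_sumT : \sum_i sol U g L i = 1.
Proof.
rewrite -sol_sum [RHS]big_mkcond/=; apply: eq_bigr => i _.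
by case: ifPn => // /sol_out.
Qed.

Lemma sol_le1 i : sol U g L i <= 1.
Proof.
rewrite -sol_sumT (bigD1 i)//= lerDl; apply: sumr_ge0 => j _; exact: sol_ge0.
Qed.

Lemma sol_kkt i : i \in U -> L i + dpsi B (g i) (sol U g L i) = lam U g L.
Proof. by rewrite /sol => ->; rewrite ginvK// addrC subrK. Qed.

End Spec.

Lemma obj_coord_convex (g x y : R) : 0 <= g -> 0 < x -> 0 < y ->
  - B * ln x - g * hent x + dpsi B g x * (y - x) <= - B * ln y - g * hent y.
Proof.
move=> g0 x0 y0.
have h1 : B * (ln y - ln x) <= B * ((y - x) / x).
  by rewrite ler_pM2l// ln_sub_le.
have h2 : y * (ln x - ln y) <= x - y.
  by rewrite mulrC -ler_pdivlMr// ln_sub_le.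
have := ler_wpM2l g0 h2; rewrite /dpsi /hent; nra.
Qed.

Lemma obj_coord_strict (g x y : R) : 0 <= g -> 0 < x -> 0 < y -> x != y ->
  - B * ln x - g * hent x + dpsi B g x * (y - x) < - B * ln y - g * hent y.
Proof.
move=> g0 x0 y0 xy.
have h1 : B * (ln y - ln x) < B * ((y - x) / x).
  rewrite ltr_pM2l// -ln_div ?posrE// mulrBl divff ?gt_eqF//.
  apply: ln_lt_subr1; first by rewrite divr_gt0.
  by apply: contra xy => /eqP h; rewrite eq_sym -[y](divfK (lt0r_neq0 x0)) h mul1r.
have h2 : y * (ln x - ln y) <= x - y.
  by rewrite mulrC -ler_pdivlMr// ln_sub_le.
have := ler_wpM2l g0 h2; rewrite /dpsi /hent; nra.
Qed.

Section Minimality.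
Variables (U : {set I}) (g L : I -> R) (i0 : I).
Hypotheses (g0 : forall i, 0 < g i) (i0U : i0 \in U).
Let p := sol U g L.

Lemma obj_sub_linear x : \sum_(i in U) x i = 1 ->
  \sum_(i in U) (L i + dpsi B (g i) (p i)) * (x i - p i) = 0.
Proof.
move=> x1; transitivity (\sum_(i in U) lam U g L * (x i - p i)).
  by apply: eq_bigr => i iU; rewrite sol_kkt.
by rewrite -mulr_sumr sumrB x1 (sol_sum L g0 i0U) subrr mulr0.
Qed.

Lemma sol_min x : (forall i, i \in U -> 0 < x i) -> \sum_(i in U) x i = 1 ->
  obj U g L p <= obj U g L x.
Proof.
move=> x0 x1; rewrite -[leLHS]addr0 -(obj_sub_linear x1) -big_split/=.
apply: ler_sum => i iU.
have := obj_coord_convex (ltW (g0 i)) (sol_gt0 L g0 iU) (x0 i iU).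
rewrite -/p; nra.
Qed.

(** The algorithm picks its minimizer by an epsilon operator; strict convexity is what identifies
    that choice with [sol]. *)
Lemma sol_uniq x : (forall i, i \in U -> 0 < x i) -> \sum_(i in U) x i = 1 ->
  obj U g L x <= obj U g L p -> forall i, i \in U -> x i = p i.
Proof.
move=> x0 x1 xp i iU; apply/eqP/negPn/negP => xpi.
move: xp; apply/negP; rewrite -ltNge -[ltLHS]addr0 -(obj_sub_linear x1).
rewrite -big_split/= (bigD1 i)//= [ltRHS](bigD1 i)//= ltr_leD//.
  have := obj_coord_strict (ltW (g0 i)) (sol_gt0 L g0 iU) (x0 i iU).
  by rewrite eq_sym -/p => /(_ xpi); nra.
apply: ler_sum => j /andP[jU _].
have := obj_coord_convex (ltW (g0 j)) (sol_gt0 L g0 jU) (x0 j jU).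
rewrite -/p; nra.
Qed.

End Minimality.

(** At equal multiplier the larger face carries more mass, so its multiplier is smaller, and each
    coordinate increases with the multiplier. *)
Lemma sol_subset U W g L i0 : (forall i, 0 < g i) -> i0 \in U -> U \subset W ->
  forall i, i \in U -> sol W g L i <= sol U g L i.
Proof.
move=> g0 i0U /fintype.subsetP UW.
have ll : lam W g L <= lam U g L.
  rewrite leNgt; apply/negP => /(mass_lt L g0 i0U).
  rewrite (lamP L g0 i0U) -(lamP L g0 (UW _ i0U)) ltNge => /negP; apply.
  rewrite /mass [leRHS]big_mkcond [leLHS]big_mkcond/=; apply: ler_sum => i _.
  case: ifPn => iU; first by rewrite UW.
  by case: ifP => // _; rewrite ltW// ginv_gt0.
by move=> i iU; rewrite /sol iU UW// ginv_leE// lerD2r.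
Qed.

End FTRLSolution.

Section Argmin.
Context {R : realType} {K : nat}.
Variable B : R.
Hypothesis B0 : 0 < B.

Lemma ftrl_objE (g L x : 'I_K -> R) : (forall i, 0 < x i) ->
  ftrl_obj B g L x = obj B [set: 'I_K]%SET g L x.
Proof.
move=> x0; rewrite /ftrl_obj /shannon_reg /obj.
rewrite mulr_sumr -!big_split/=; apply: eq_big => [i|i _]; first by rewrite finset.in_setT.
rewrite lnM ?posrE ?invr_gt0 ?expR_gt0// lnV ?posrE ?expR_gt0// expRK /hent; ring.
Qed.

Lemma ftrl_argminE (g L : 'I_K -> R) : (0 < K)%N -> (forall i, 0 < g i) ->
  ftrl_argmin B g L = sol B [set: 'I_K]%SET g L.
Proof.
move=> K0 g0; set s := sol _ _ _ _; pose i0 := Ordinal K0.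
have iT i : i \in [set: 'I_K]%SET by rewrite finset.in_setT.
have sumT (x : 'I_K -> R) : \sum_(i in [set: 'I_K]%SET) x i = \sum_(i < K) x i.
  by apply: eq_bigl => i; rewrite finset.in_setT.
have s_int : simplex_int s.
  split; first by move=> i; exact: sol_gt0.
  by rewrite -sumT (sol_sum B0 L g0 (iT i0)).
have s_min q : simplex_int q -> ftrl_obj B g L s <= ftrl_obj B g L q.
  move=> [q0 q1]; rewrite !ftrl_objE//; last by case: s_int.
  by apply: (sol_min B0 L g0 (iT i0)) => //; rewrite sumT.
have [[p0 p1] pm] := @ClassicalEpsilon.epsilon_spec _ (inhabits (fun _ => 0)) (fun p : 'I_K -> R =>
  simplex_int p /\ forall q, simplex_int q -> ftrl_obj B g L p <= ftrl_obj B g L q)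
  (ex_intro _ s (conj s_int s_min)).
apply/funext => i; apply: (sol_uniq B0 g0 (iT i0)) => //.
- by move=> j _; exact: p0.
- by rewrite sumT.
- by have := pm _ s_int; rewrite !ftrl_objE//; case: s_int.
Qed.

End Argmin.

(** * The potential gap between the simplex and a face *)

Section PathBound.
Context {R : realType}.

Lemma le_of_le_add_div (D e C : R) :
  (forall N : nat, D <= e + C / N.+1%:R) -> D <= e.
Proof.
move=> h; rewrite leNgt; apply/negP => eD.
have C0 : 0 < C by have := h 0%N; rewrite divr1; lra.
have De : 0 < D - e by rewrite subr_gt0.
have /archi_boundP := ltW (divr_gt0 C0 De).
set n := Num.bound _ => hn.
have := h n; rewrite -lerBlDl ler_pdivlMr ?ltr0n//.
move: hn; rewrite ltr_pdivrMr// => hn; rewrite -natr1; nra.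
Qed.

(* Two functions with supergradients [m] and [n] (concave functions along a
   segment): a pointwise comparison of the supergradients integrates to a
   comparison of increments, without any differentiability. *)
Lemma supergradient_comparison (F G m n : R -> R) (e : R) :
  (forall s s', 0 <= s <= 1 -> 0 <= s' <= 1 -> F s' - F s <= m s * (s' - s)) ->
  (forall s s', 0 <= s <= 1 -> 0 <= s' <= 1 -> G s' - G s <= n s * (s' - s)) ->
  (forall s, 0 <= s <= 1 -> n s - m s <= e) ->
  (G 1 - G 0) - (F 1 - F 0) <= e.
Proof.
move=> hF hG hmn; apply: (@le_of_le_add_div _ _ (m 0 - m 1)) => N.
have N0 : 0 < N.+1%:R :> R by rewrite ltr0n.
pose t (k : nat) : R := k%:R / N.+1%:R.
have t01 k : (k <= N.+1)%N -> 0 <= t k <= 1.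
  move=> kN; rewrite divr_ge0 ?ler0n//= ler_pdivrMr// mul1r ler_nat//.
set v := N.+1%:R^-1 : R; have v0 : 0 < v by rewrite invr_gt0.
have tS k : t k.+1 - t k = v.
  by rewrite /t -mulrBl -natrB// subSnn mul1r.
(* [G] is bounded at the left endpoint of the cell and [F] at the right one. The resulting mismatch
   [m (t k) - m (t k.+1)] telescopes, so it contributes only [(m 0 - m 1) / N.+1]. *)
have step k : (k < N.+1)%N ->
  (G (t k.+1) - G (t k)) - (F (t k.+1) - F (t k)) <=
  (e + (m (t k) - m (t k.+1))) * v.
  move=> kN; have := hG _ _ (t01 _ (ltnW kN)) (t01 _ kN).
  have := hF _ _ (t01 _ kN) (t01 _ (ltnW kN)).
  have := ler_wpM2r (ltW v0) (hmn _ (t01 _ (ltnW kN))).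
  rewrite -(opprB (t k.+1)) tS -/v; lra.
have tel (H : R -> R) : H 1 - H 0 = \sum_(0 <= k < N.+1) (H (t k.+1) - H (t k)).
  by rewrite telescope_sumr// /t mul0r divff// gt_eqF.
rewrite (tel G) (tel F) -sumrB big_nat.
apply: (@le_trans _ _ (\sum_(0 <= k < N.+1) (e + (m (t k) - m (t k.+1))) * v)).
  by rewrite [leRHS]big_nat; apply: ler_sum => k /andP[_ kN]; exact: step.
rewrite -mulr_suml big_split/= sumr_const_nat subn0.
rewrite mulrDl -mulr_natr mulfK ?gt_eqF// lerD2l -[m 0 - m 1]opprB (tel m) -sumrN.
by under [in leRHS]eq_bigr do rewrite opprB.
Qed.

End PathBound.

Section Potential.
Context {R : realType} {I : finType}.
Variable B : R.
Hypothesis B0 : 0 < B.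
Implicit Types (U : {set I}) (g L d : I -> R).

Local Notation full := [set: I]%SET.

Definition Phi U g L : R := obj B U g L (sol B U g L).

Definition gap U g L : R := Phi full g L - Phi U g L.

Definition add_loss L (i : I) (z : R) : I -> R :=
  fun j => L j + (if j == i then z else 0).

(** The old minimizer is a feasible competitor in the new problem. Thus it yields a supergradient of
    the optimal value, jointly in losses (coefficient [sol]) and rates (coefficient
    [- hent sol]). *)
Lemma Phi_le U g g' L L' i0 : (forall i, 0 < g i) -> (forall i, 0 < g' i) ->
  i0 \in U ->
  Phi U g' L' - Phi U g L <=
  \sum_(i in U) (sol B U g L i * (L' i - L i) - (g' i - g i) * hent (sol B U g L i)).
Proof.
move=> g0 g'0 i0U; have := sol_min B0 L' g'0 i0U
  (fun i iU => sol_gt0 B0 L g0 iU) (sol_sum B0 L g0 i0U).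
rewrite -/(Phi U g' L') => h; rewrite lerBlDr; apply: (le_trans h).
rewrite /Phi /obj -big_split/= le_eqVlt; apply/orP; left; apply/eqP.
by apply: eq_bigr => i _; ring.
Qed.

Section GammaPath.
Variables (U : {set I}) (g L d : I -> R) (i0 : I).
Hypotheses (g0 : forall i, 0 < g i) (d0 : forall i, 0 <= d i) (i0U : i0 \in U).

Let gs (s : R) := fun i => g i + s * d i.

Let gs_gt0 s : 0 <= s -> forall i, 0 < gs s i.
Proof. by move=> s0 i; rewrite ltr_wpDr// mulr_ge0. Qed.

(* The entropy terms of the arms in [U] have a favourable sign, since the
   minimizer over the whole simplex is dominated on [U] by the minimizer
   over the face [U]. *)
Lemma gap_rate_increase (e : R) :
  (forall s, 0 <= s <= 1 ->
    \sum_(i | i \notin U) d i * hent (sol B full (gs s) L i) <= e) ->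
  gap U g L <= gap U (fun i => g i + d i) L + e.
Proof.
move=> he; have iT : i0 \in full by rewrite finset.in_setT.
have gsE1 : (fun i => g i + d i) = gs 1 by apply/funext => i; rewrite /gs mul1r.
have gsE0 : g = gs 0 by apply/funext => i; rewrite /gs mul0r addr0.
have hW (W : {set I}) (j0 : I) : j0 \in W -> forall s s', 0 <= s <= 1 -> 0 <= s' <= 1 ->
    Phi W (gs s') L - Phi W (gs s) L <=
    (- \sum_(i in W) d i * hent (sol B W (gs s) L i)) * (s' - s).
  move=> jW s s' /andP[s0 _] /andP[s'0 _].
  apply: (le_trans (Phi_le L L (gs_gt0 s0) (gs_gt0 s'0) jW)).
  rewrite mulNr mulr_suml -sumrN; apply: ler_sum => i _.
  by rewrite subrr /gs; lra.
have := @supergradient_comparison R (fun s => Phi full (gs s) L)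
  (fun s => Phi U (gs s) L) _ _ e (hW _ _ iT) (hW _ _ i0U).
rewrite -gsE0 -gsE1 /gap => h; suff : forall s, 0 <= s <= 1 ->
  - (\sum_(i in U) d i * hent (sol B U (gs s) L i)) -
  - (\sum_(i in full) d i * hent (sol B full (gs s) L i)) <= e by move/h; lra.
move=> s s01; apply: le_trans (he s s01); rewrite opprK.
have s0 := gs_gt0 (proj1 (andP s01)).
rewrite [X in _ + X](_ : _ = \sum_i d i * hent (sol B full (gs s) L i)); last first.
  by apply: eq_bigl => i; rewrite finset.in_setT.
rewrite [X in _ + X](bigID (mem U))/= addrA gerDr addrC subr_le0.
apply: ler_sum => i iU; rewrite ler_wpM2l// hent_le//.
- by apply: sol_gt0 => //; rewrite finset.in_setT.
- by apply: (sol_subset B0 L s0 i0U) => //; exact: finset.subsetT.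
- exact: (sol_le1 B0 L s0 i0U).
Qed.

(** Larger rates lower the multiplier, since [ln <= 0] on probabilities. From [x] to [2 * x] the
    barrier part of [dpsi] rises by [B / (2 * x)], which by assumption covers the change
    [d i * - ln (2 * x)] of the entropy part, so the coordinate cannot pass [2 * x]. *)
Lemma sol_rate_increase i : i \in U ->
  d i * - ln (2 * sol B U g L i) <= B / (2 * sol B U g L i) ->
  sol B U (fun i => g i + d i) L i <= 2 * sol B U g L i.
Proof.
move=> iU hd; set g' := fun i => g i + d i.
have g'0 j : 0 < g' j by rewrite ltr_wpDr.
have ll : lam B U g' L <= lam B U g L.
  rewrite leNgt; apply/negP => ll.
  have : \sum_(j in U) sol B U g L j < \sum_(j in U) sol B U g' L j.
    apply: ltr_sum; first by apply/hasP; exists i0; rewrite ?mem_index_enum.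
    move=> j jU; rewrite -(dpsi_ltE B0 (ltW (g'0 j))) ?sol_gt0//.
    have := sol_kkt B0 L g'0 jU; have := sol_kkt B0 L g0 jU.
    have := ln_le0 (sol_le1 B0 L g0 i0U j); have := d0 j.
    move: ll; rewrite /dpsi /g'; nra.
  by rewrite !(sol_sum B0 L _ i0U)// ltxx.
have p0 := sol_gt0 B0 L g0 iU.
rewrite -(dpsi_leE B0 (ltW (g'0 i))) ?sol_gt0//; last by rewrite mulr_gt0.
have := sol_kkt B0 L g'0 iU; have := sol_kkt B0 L g0 iU.
move: ll p0 hd; set x := sol _ _ _ _ _; set x' := sol _ _ _ _ _.
rewrite /dpsi => ll x0 hd k k'.
have BE : B / x = 2 * (B / (2 * x)) by field; rewrite gt_eqF.
have : ln x <= ln (2 * x) by rewrite ler_ln ?posrE ?mulr_gt0//; lra.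
move=> /(ler_wpM2l (ltW (g0 i))).
rewrite /g' in k' *; move: k k' hd ll; rewrite /dpsi BE.
rewrite !mulrDl; lra.
Qed.

End GammaPath.

Section LossPath.
Variables (g : I -> R) (i0 : I).
Hypotheses (g0 : forall i, 0 < g i).

Section Shift.
Variables (U : {set I}) (L : I -> R) (i : I) (z : R).
Hypotheses (iU : i \in U) (z0 : 0 <= z).

Let x := sol B U g L.
Let x' := sol B U g (add_loss L i z).
Let a j := asec B (g j) (x j) (x' j).
Let A := \sum_(j in U) a j.

Lemma shift_asec_gt0 j : j \in U -> 0 < a j.
Proof. by move=> jU; rewrite asec_gt0 ?sol_gt0// ltW. Qed.

Lemma shift_sum_gt0 : 0 < A.
Proof.
rewrite /A (bigD1 i)//= ltr_pwDl ?shift_asec_gt0//.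
by apply: sumr_ge0 => j /andP[jU _]; rewrite ltW// shift_asec_gt0.
Qed.

(** Secants linearize the optimality conditions exactly, and conservation of mass forces the
    multiplier to move by [z * a i / A]. This is the derivative formula with [asec] for the inverse
    Hessian, valid for a shift of any size. *)
Lemma shift_step j : j \in U ->
  x' j - x j = a j * (z * a i / A - (if j == i then z else 0)).
Proof.
pose dl := lam B U g (add_loss L i z) - lam B U g L.
have h k : k \in U -> x' k - x k = a k * (dl - (if k == i then z else 0)).
  move=> kU; rewrite (asecE B0 (ltW (g0 k)) (sol_gt0 B0 L g0 kU)
    (sol_gt0 B0 (add_loss L i z) g0 kU)) -/x -/x' -/(a k); congr (_ * _).
  have := sol_kkt B0 L g0 kU; have := sol_kkt B0 (add_loss L i z) g0 kU.
  by rewrite /dl /add_loss -/x -/x'; lra.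
have : \sum_(k in U) (x' k - x k) = 0.
  by rewrite sumrB !(sol_sum B0 _ g0 iU) subrr.
rewrite (eq_bigr _ h).
under eq_bigr do rewrite mulrBr.
rewrite sumrB -mulr_suml -/A [X in _ - X](bigD1 i)//= eqxx.
rewrite [X in _ - (_ + X)]big1 ?addr0; last first.
  by move=> k /andP[_ /negbTE->]; rewrite mulr0.
move=> /eqP; rewrite subr_eq0 => /eqP dlE jU; rewrite h//; congr (_ * (_ - _)).
apply: (mulfI (lt0r_neq0 shift_sum_gt0)); rewrite dlE.
by rewrite [RHS]mulrC divfK ?lt0r_neq0 ?shift_sum_gt0// mulrC.
Qed.

Lemma shift_self : x i - x' i = z * (a i * (A - a i) / A).
Proof.
rewrite -opprB shift_step// eqxx; field.
by rewrite lt0r_neq0 ?shift_sum_gt0.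
Qed.

Lemma shift_other j : j \in U -> j != i -> x' j - x j = z * (a i * a j / A).
Proof.
move=> jU /negbTE ji; rewrite shift_step// ji subr0; field.
by rewrite lt0r_neq0 ?shift_sum_gt0.
Qed.

Lemma asec_le_sum j : j \in U -> a j <= A.
Proof.
move=> jU; rewrite /A (bigD1 j)//= lerDl.
by apply: sumr_ge0 => k /andP[kU _]; rewrite ltW// shift_asec_gt0.
Qed.

Lemma shift_self_ge0 : x' i <= x i.
Proof.
rewrite -subr_ge0 shift_self mulr_ge0// divr_ge0 ?(ltW shift_sum_gt0)//.
by rewrite mulr_ge0 ?subr_ge0 ?asec_le_sum// ltW// shift_asec_gt0.
Qed.

Lemma shift_self_le : x i - x' i <= z * a i.
Proof.
rewrite shift_self ler_wpM2l// ler_pdivrMr ?shift_sum_gt0//.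
have a0 := ltW (shift_asec_gt0 iU).
by rewrite ler_wpM2l// gerBl.
Qed.

Lemma shift_other_ge0 j : j \in U -> j != i -> x j <= x' j.
Proof.
move=> jU ji; rewrite -subr_ge0 shift_other// mulr_ge0// divr_ge0 ?(ltW shift_sum_gt0)//.
by rewrite ltW// mulr_gt0// shift_asec_gt0.
Qed.

End Shift.

End LossPath.

End Potential.

(** * Stability of one played arm *)

(** By [shift_self], an arm of secant [a] facing a total [S] of other secants moves in proportion to
    [a * S / (a + S)], which increases in both. Passing to the larger face values [b] and [S'] thus
    only helps, and the excess is due to the outside total [V] alone. *)
Lemma harmonic_excess {R : realType} (a b S S' V : R) :
  0 < a -> 0 <= S -> 0 <= V -> a <= b -> S <= S' ->
  a * (S + V) / (a + S + V) - b * S' / (b + S') <=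
  a ^+ 2 * V / ((a + S) * (a + S + V)).
Proof.
move=> a0 S0 V0 ab SS'; have b0 : 0 < b by lra.
have aS : 0 < a + S by lra.
have bS : 0 < b + S' by lra.
have aSV : 0 < a + S + V by lra.
have h : a * S / (a + S) <= b * S' / (b + S').
  rewrite ler_pdivrMr// mulrAC ler_pdivlMr//.
  have h1 : 0 <= a * b * (S' - S) by rewrite !mulr_ge0 ?subr_ge0// ltW.
  have h2 : 0 <= S * S' * (b - a) by rewrite !mulr_ge0 ?subr_ge0//; lra.
  lra.
have : a * (S + V) / (a + S + V) - a * S / (a + S) =
    a ^+ 2 * V / ((a + S) * (a + S + V)).
  by field; rewrite !lt0r_neq0.
lra.
Qed.

Section Stability.
Context {R : realType} {I : finType}.
Variable B : R.
Hypothesis B2 : 2 <= B.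

Let B0 : 0 < B. Proof. have := B2; lra. Qed.

Local Notation full := [set: I]%SET.

Variables (U : {set I}) (g L : I -> R) (i0 : I).
Hypotheses (g0 : forall i, 0 < g i) (i0U : i0 \in U).

Let iT i : i \in full. Proof. by rewrite finset.in_setT. Qed.

Let p := sol B full g L.
Let q := sol B U g L.

Let p0 i : 0 < p i. Proof. exact: sol_gt0. Qed.

(** Normalized so that [x i * rho x i] is the inverse second derivative of the regularizer, the
    diagonal value of [asec]. [share] is the fraction of this quantity that an arm holds within the
    face. *)
Definition rho (x : I -> R) i : R := (B / x i + g i)^-1.

Lemma rho_gt0 i : 0 < rho p i.
Proof. by rewrite invr_gt0 addr_gt0// divr_gt0. Qed.

Definition share (x : I -> R) i : R :=
  x i * rho x i / \sum_(j in U) x j * rho x j.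

Let W0 : 0 < \sum_(j in U) p j * rho p j.
Proof.
rewrite (bigD1 i0)//= ltr_pwDl ?mulr_gt0 ?rho_gt0//.
by apply: sumr_ge0 => j _; rewrite ltW// mulr_gt0 ?rho_gt0.
Qed.

Lemma share_ge0 i : 0 <= share p i.
Proof. by rewrite ltW// divr_gt0// mulr_gt0// rho_gt0. Qed.

Lemma share_sum : \sum_(i in U) share p i = 1.
Proof. by rewrite -mulr_suml divff// lt0r_neq0. Qed.

Lemma share_le1 i : i \in U -> share p i <= 1.
Proof.
move=> iU; rewrite -share_sum (bigD1 i)//= lerDl.
by apply: sumr_ge0 => j _; exact: share_ge0.
Qed.

(** Inside [U] the excess has the form [(a / A) * a * V / (A + V)]. If arm [i] has at least the mass
    of all outside arms, [V] is at most [4 * x i] times the sum of the outside [rho], and three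
    factors 4 give 64. Otherwise [V / (A + V) <= 1] is used, which gives the conditional term. *)
Definition stab (x : I -> R) i : R :=
  if i \in U then 64 * share x i ^+ 2 * \sum_(j | j \notin U) rho x j +
    (if x i < \sum_(j | j \notin U) x j then 4 * share x i * rho x i else 0)
  else rho x i.

Section OneArm.
Variables (i : I) (z z' : R).
Hypotheses (z'0 : 0 <= z') (zz' : z' <= z) (zp : z * p i <= 1).

Let p' := sol B full g (add_loss L i z').
Let q' := sol B U g (add_loss L i z').
Let a j := asec B (g j) (p j) (p' j).
Let A := \sum_(j in U) a j.
Let AV := \sum_(j | j \notin U) a j.

Let p'0 j : 0 < p' j. Proof. exact: sol_gt0. Qed.
Let a0 j : 0 < a j. Proof. by rewrite asec_gt0// ltW. Qed.
Let AA : \sum_(j in full) a j = A + AV.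
Proof.
by rewrite (bigID (mem U))/=; congr (_ + _); apply: eq_bigl => j;
  rewrite finset.in_setT.
Qed.
Let AV0 : 0 <= AV. Proof. by apply: sumr_ge0 => j _; rewrite ltW. Qed.
Let z'p : z' * p i <= 1.
Proof. by apply: le_trans zp; rewrite ler_pM2r. Qed.
Let A0 : 0 < A.
Proof.
rewrite /A (bigD1 i0)//= ltr_pwDl// sumr_ge0// => j _; exact: ltW.
Qed.

(** The iterates on the face dominate those on the simplex before and after the shift, so
    monotonicity of [asec] supplies the hypotheses of [harmonic_excess]. *)
Lemma excess_in : i \in U ->
  (p i - p' i) - (q i - q' i) <= z' * (a i ^+ 2 * AV / (A * (A + AV))).
Proof.
move=> iU; pose b j := asec B (g j) (q j) (q' j).
have ab j : j \in U -> a j <= b j.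
  move=> jU; apply: (asec_le B0) => //; first exact: ltW.
    by apply: (sol_subset B0 L g0 i0U) => //; exact: finset.subsetT.
  by apply: (sol_subset B0 _ g0 i0U) => //; exact: finset.subsetT.
rewrite /p /p' /q /q' (shift_self B0 g0 L z' (iT i)) (shift_self B0 g0 L z' iU).
rewrite -/p -/p' -/q -/q'.
rewrite (eq_bigr a)// AA (eq_bigr b)// -/(a i) -/(b i).
rewrite -mulrBr ler_wpM2l//.
set A' := \sum_(j in U) b j.
have AE : A = a i + \sum_(j in U | j != i) a j by rewrite /A (bigD1 i).
have A'E : A' = b i + \sum_(j in U | j != i) b j by rewrite /A' (bigD1 i).
have S0 : 0 <= \sum_(j in U | j != i) a j by apply: sumr_ge0 => j _; rewrite ltW.
have SS : \sum_(j in U | j != i) a j <= \sum_(j in U | j != i) b j.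
  by apply: ler_sum => j /andP[jU _]; exact: ab.
have := harmonic_excess (a0 i) S0 AV0 (ab _ iU) SS.
have E1 : A + AV - a i = \sum_(j in U | j != i) a j + AV by rewrite AE; ring.
have E2 : A' - b i = \sum_(j in U | j != i) b j by rewrite A'E; ring.
by rewrite E1 E2 -AE -A'E.
Qed.

Lemma excess_out : i \notin U -> (p i - p' i) - (q i - q' i) <= z' * a i.
Proof.
move=> iU; rewrite /q /q' !sol_out// subrr subr0.
exact: (shift_self_le B0 g0 L (iT i) z'0).
Qed.

Let p'ip : p' i <= p i.
Proof. exact: (shift_self_ge0 B0 g0 L (iT i) z'0). Qed.

(** The barrier bounds the secant by [p i * p' i / B], and [z' * p i <= 1] leaves a drop of at most
    [p' i / B]. *)
Lemma self_half : p i <= 2 * p' i.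
Proof.
have h1 := shift_self_le B0 g0 L (iT i) z'0.
have h2 := asec_le_B B0 (ltW (g0 i)) (p0 i) (p'0 i).
have h3 : z' * a i <= p' i / B.
  apply: (le_trans (ler_wpM2l z'0 h2)).
  rewrite !mulrA ler_pM2r ?invr_gt0// -[leRHS]mul1r ler_pM2r//.
have h4 : p' i / B <= p' i by rewrite ler_pdivrMr// ler_peMr ?ltW//; have := B2; lra.
move: h1; rewrite -/p -/p' -/(a i); lra.
Qed.

Lemma other_ge j : j != i -> p j <= p' j.
Proof. exact: (shift_other_ge0 B0 g0 L (iT i) z'0 (iT j)). Qed.

(** The increase is [z' * a i * a j] over the total secant, and [a i * a j] is at most the square of
    that total. Hence the squared increase is at most [z' ^+ 2 * a i * a j], and the barrier bound
    on both secants turns this into [(p' j / B) ^+ 2], with [2 <= B]. *)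
Lemma other_double j : p' j <= 2 * p j.
Proof.
have [->|ji] := eqVneq j i; first by have := p'ip; have := p0 i; lra.
have A1 : a i + a j <= A + AV.
  rewrite -AA (bigD1 i)//= lerD2l (bigD1 j) ?iT//= lerDl.
  by apply: sumr_ge0 => k _; rewrite ltW.
have d0 : 0 <= p' j - p j by rewrite subr_ge0 other_ge.
have dE := shift_other B0 g0 L z' (iT i) (iT j) ji.
have d2 : (p' j - p j) ^+ 2 <= z' ^+ 2 * (a i * a j).
  rewrite dE exprMn ler_wpM2l ?sqr_ge0// -/p -/p' -/(a i) -/(a j).
  rewrite (eq_bigr a)// AA expr_div_n ler_pdivrMr ?exprn_gt0//; last first.
    by rewrite ltr_wpDr.
  rewrite expr2 ler_pM2l ?mulr_gt0//.
  have := a0 i; have := a0 j; nra.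
have h1 := asec_le_B B0 (ltW (g0 i)) (p0 i) (p'0 i).
have h2 := asec_le_B B0 (ltW (g0 j)) (p0 j) (p'0 j).
have h3 : z' ^+ 2 * (a i * a j) <= (p' j / B) ^+ 2.
  apply: (@le_trans _ _ (z' ^+ 2 * ((p i * p' i / B) * (p j * p' j / B)))).
    by rewrite ler_wpM2l ?sqr_ge0// ler_pM// ltW.
  apply: (@le_trans _ _ ((z' * p i) ^+ 2 * (p' j / B) ^+ 2)).
    rewrite [leLHS](_ : _ = (z' ^+ 2 * B^-1 ^+ 2) * (p i * p' i * (p j * p' j))); last by ring.
    rewrite [leRHS](_ : _ = (z' ^+ 2 * B^-1 ^+ 2) * (p i * p i * (p' j * p' j))); last by ring.
    have hA : p i * p' i <= p i * p i by rewrite ler_pM2l.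
    have hB : p j * p' j <= p' j * p' j by rewrite ler_pM2r// -subr_ge0.
    apply: ler_wpM2l; first by rewrite mulr_ge0 ?sqr_ge0.
    by apply: ler_pM => //; rewrite mulr_ge0 ?ltW.
  rewrite -[leRHS]mul1r ler_wpM2r ?sqr_ge0// expr_le1//.
  by rewrite mulr_ge0// ltW.
have h4 : p' j / B <= p' j / 2.
  by rewrite ler_pM2l// lef_pV2 ?posrE.
have : p' j - p j <= p' j / B.
  have pB : 0 <= p' j / B by rewrite divr_ge0 ?ltW.
  by rewrite -(@ler_pXn2r _ 2)// ?nnegrE//; exact: le_trans d2 h3.
lra.
Qed.

Lemma asec_self_le : a i <= p i * rho p i.
Proof. by apply: (asec_le_max B0) => //; exact: ltW. Qed.

(** Doubling or halving [x] changes [x / (B / x + g)] by a factor at most 4, so this bound and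
    [asec_ge] compare secants along the move with their values at the start. *)
Lemma asec_other_le j : a j <= 4 * (p j * rho p j).
Proof.
have h := asec_le_max B0 (ltW (g0 j)) (p0 j) (p'0 j) _ (other_double j).
have pp : p j <= 2 * p j by have := p0 j; lra.
apply: (le_trans (h pp)); rewrite /rho.
have D0 : 0 < B / p j + g j by rewrite addr_gt0// divr_gt0.
have D1 : 0 < B / (2 * p j) + g j by rewrite addr_gt0// divr_gt0// mulr_gt0.
rewrite !mulrA ler_pdivlMr// mulrAC ler_pdivrMr//.
have -> : B / p j = 2 * (B / (2 * p j)) by field; rewrite lt0r_neq0.
move: D1; have := p0 j; have := g0 j; set b := B / _ => gj pj D1.
have : 0 <= p j * g j by rewrite mulr_ge0 ?ltW.
lra.
Qed.

Let asec_diag j x : 0 < x -> asec B (g j) x x = x / (B / x + g j).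
Proof.
move=> x0; rewrite /asec /lnslope eqxx; field.
by rewrite !lt0r_neq0// ltr_wpDr// mulr_ge0 ?ltW.
Qed.

Lemma asec_ge j : p j * rho p j / 4 <= a j.
Proof.
have D0 : 0 < B / p j + g j by rewrite addr_gt0// divr_gt0.
have pr : 0 < p j * rho p j by rewrite mulr_gt0 ?rho_gt0.
have [->|ji] := eqVneq j i; last first.
  apply: (@le_trans _ _ (p j * rho p j)); first by lra.
  by rewrite /rho -asec_diag//; apply: (asec_le B0) => //; [exact: ltW|exact: other_ge].
have h2 : 0 < p i / 2 by rewrite divr_gt0.
apply: (@le_trans _ _ (asec B (g i) (p i / 2) (p i / 2))); last first.
  apply: (asec_le B0) => //; first exact: ltW.
    have := p0 i; lra.
  have := self_half; lra.
rewrite asec_diag// /rho.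
have -> : B / (p i / 2) = 2 * (B / p i) by field; rewrite lt0r_neq0.
have b0 : 0 < B / p i by rewrite divr_gt0.
move: b0 (g0 i) (p0 i); set b := B / p i => b0 gi pi.
have Di : 0 < b + g i by lra.
have D2 : 0 < 2 * b + g i by lra.
rewrite [leLHS]mulrAC ler_pdivrMr// mulrAC ler_pdivlMr//.
have : 0 <= p i * g i by rewrite mulr_ge0 ?ltW.
lra.
Qed.


(** Here [z] is the full loss estimate and [z'] a point on the segment towards it. The excess is
    bounded by [z' * p i] times the claimed quantity, and the outer [p i * z] completes the product
    [(z * p i) * (z' * p i) <= 1]. *)
Lemma one_arm_stability :
  p i * (z * ((p i - p' i) - (q i - q' i))) <= stab p i.
Proof.
have z0 : 0 <= z by exact: le_trans zz'.
have r0 := rho_gt0 i.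
have pi0 := p0 i.
have zzp : 0 <= (z * p i) * (z' * p i) <= 1.
  have h1 : 0 <= z * p i by rewrite mulr_ge0// ltW.
  have h2 : 0 <= z' * p i by rewrite mulr_ge0// ltW.
  by rewrite mulr_ge0//= mulr_ile1.
have scale X E : 0 <= X -> E <= z' * (p i * X) ->
    p i * (z * E) <= X.
  move=> X0 EX; apply: (@le_trans _ _ (p i * (z * (z' * (p i * X))))).
    by rewrite ler_pM2l// ler_wpM2l.
  rewrite [leLHS](_ : _ = (z * p i) * (z' * p i) * X); last by ring.
  by rewrite -[leRHS]mul1r ler_wpM2r//; case/andP: zzp.
rewrite /stab; case: ifPn => iU; last first.
  apply: scale; first exact: ltW.
  apply: (le_trans (excess_out iU)); rewrite ler_wpM2l//.
  exact: asec_self_le.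
have y0 := share_ge0 i.
have V0 : 0 <= \sum_(j | j \notin U) rho p j.
  by apply: sumr_ge0 => j _; rewrite ltW// rho_gt0.
have T0 : 0 <= 64 * share p i ^+ 2 * \sum_(j | j \notin U) rho p j.
  by rewrite mulr_ge0// mulr_ge0// sqr_ge0.
have AW : (\sum_(j in U) p j * rho p j) / 4 <= A.
  by rewrite mulr_suml; apply: ler_sum => j _; exact: asec_ge.
have aA : a i / A <= 4 * share p i.
  rewrite ler_pdivrMr//; apply: (le_trans asec_self_le).
  apply: (@le_trans _ _ (4 * share p i * ((\sum_(j in U) p j * rho p j) / 4))).
    rewrite /share le_eqVlt; apply/orP; left; apply/eqP; field.
    by rewrite lt0r_neq0.
  by rewrite ler_wpM2l// mulr_ge0.
have aA0 : 0 <= a i / A by rewrite divr_ge0 ?ltW.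
have AAV : 0 < A + AV by rewrite ltr_pwDl.
have fE : a i ^+ 2 * AV / (A * (A + AV)) = (a i / A) * (a i * (AV / (A + AV))).
  by field; rewrite !lt0r_neq0.
have f1 : AV / (A + AV) <= 1 by rewrite ler_pdivrMr// mul1r lerDr ltW.
have f2 : a i * (AV / (A + AV)) <= a i / A * AV.
  rewrite mulrA [leRHS]mulrAC; apply: ler_wpM2l; first by rewrite mulr_ge0// ltW.
  by rewrite lef_pV2 ?posrE// lerDl.
have T1 : 0 <= (if p i < \sum_(j | j \notin U) p j then 4 * share p i * rho p i else 0).
  by case: ifP => // _; apply: mulr_ge0; [exact: mulr_ge0|exact: ltW].
apply: scale; first exact: addr_ge0.
apply: (le_trans (excess_in iU)); rewrite ler_wpM2l// fE.
case: ifPn => [_|]; last rewrite -leNgt => pV.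
  rewrite mulrDr -[leLHS]add0r lerD//; first by rewrite mulr_ge0// ltW.
  apply: (@le_trans _ _ (4 * share p i * (p i * rho p i))).
    apply: ler_pM => //.
      by rewrite mulr_ge0 ?divr_ge0// ltW.
    by apply: le_trans asec_self_le; rewrite -[leRHS]mulr1 ler_wpM2l// ltW.
  by rewrite [leRHS](_ : _ = 4 * share p i * (p i * rho p i))//; ring.
rewrite addr0.
have hV : AV <= 4 * (p i * \sum_(j | j \notin U) rho p j).
  rewrite mulrA mulr_sumr; apply: ler_sum => j jU.
  apply: (le_trans (asec_other_le j)).
  rewrite -mulrA ler_pM2l// ler_pM2r ?rho_gt0//.
  apply: le_trans pV; rewrite (bigD1 j)//= lerDl.
  by apply: sumr_ge0 => k _; rewrite ltW.
apply: (@le_trans _ _ (4 * share p i * (4 * share p i * (4 * (p i * \sum_(j | j \notin U) rho p j))))).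
  apply: ler_pM => //.
    by rewrite mulr_ge0 ?divr_ge0// ltW.
  by apply: (le_trans f2); apply: ler_pM.
by rewrite le_eqVlt; apply/orP; left; apply/eqP; ring.
Qed.

End OneArm.

(** Along the segment only the loss of arm [i] moves, so the slope of [gap] is [z] times the
    difference of the two current [i]-th coordinates. [one_arm_stability] limits its drift from the
    initial value [z * (p i - q i)] to [stab p i / p i]. *)
Lemma gap_loss_step i z : 0 <= z -> z * p i <= 1 ->
  p i * (z * (p i - q i)) <= p i * (gap B U g (add_loss L i z) - gap B U g L) + stab p i.
Proof.
move=> z0 zp; pose Ls s := add_loss L i (s * z).
have Ls0 : Ls 0 = L.
  by apply/funext => j; rewrite /Ls /add_loss mul0r; case: ifP; rewrite addr0.
have Ls1 : Ls 1 = add_loss L i z by rewrite /Ls mul1r.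
have hW (W : {set I}) (j0 : I) : j0 \in W -> forall s s', 0 <= s <= 1 -> 0 <= s' <= 1 ->
    Phi B W g (Ls s') - Phi B W g (Ls s) <=
    (z * sol B W g (Ls s) i) * (s' - s).
  move=> jW s s' /andP[s0 _] /andP[s'0 _].
  apply: (le_trans (Phi_le B0 (Ls s) (Ls s') g0 g0 jW)).
  have e0 j : Ls s' j - Ls s j = if j == i then (s' - s) * z else 0.
    by rewrite /Ls /add_loss; case: ifP => _; ring.
  under eq_bigr do rewrite e0 subrr mul0r subr0.
  have [iW|iW] := boolP (i \in W).
    rewrite (bigD1 i)//= eqxx big1 ?addr0; first by lra.
    by move=> j /andP[_ /negbTE->]; rewrite mulr0.
  rewrite big1; first by rewrite sol_out// mulr0 mul0r.
  move=> j jW'; case: eqVneq => [ji|_]; last by rewrite mulr0.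
  by move: iW; rewrite -ji jW'.
have := @supergradient_comparison R (fun s => Phi B full g (Ls s))
  (fun s => Phi B U g (Ls s)) _ _ (stab p i / p i - z * (p i - q i))
  (hW _ _ (iT i0)) (hW _ _ i0U).
rewrite Ls0 Ls1 /gap => h.
suff /h : forall s, 0 <= s <= 1 ->
  z * sol B U g (Ls s) i - z * sol B full g (Ls s) i <= stab p i / p i - z * (p i - q i).
  move=> /(ler_wpM2l (ltW (p0 i))).
  have : p i * (stab p i / p i) = stab p i by rewrite mulrC divfK ?lt0r_neq0.
  set X := stab p i / p i; lra.
move=> s /andP[s0 s1].
have sz : s * z <= z by rewrite ler_piMl.
have := one_arm_stability (mulr_ge0 s0 z0) sz zp.
rewrite -ler_pdivlMl// [_ / p i]mulrC /Ls; lra.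
Qed.

(** Shares sum to one and [share ^+ 2 <= share], so the first terms add up to 64 copies of the
    outside sum of [rho]; the outside arms bring the 65th. *)
Lemma stab_sum :
  \sum_i stab p i <= 65 * \sum_(j | j \notin U) rho p j +
   4 * \sum_(j in U) (if p j < \sum_(k | k \notin U) p k then share p j * rho p j else 0).
Proof.
rewrite (bigID (mem U))/=.
rewrite [X in _ + X](eq_bigr (rho p)); last by move=> j /negbTE jU; rewrite /stab jU.
rewrite (eq_bigr (fun j => 64 * share p j ^+ 2 * \sum_(k | k \notin U) rho p k +
  (if p j < \sum_(k | k \notin U) p k then 4 * share p j * rho p j else 0))); last first.
  by move=> j jU; rewrite /stab jU.
rewrite big_split/= -mulr_suml.
have V0 : 0 <= \sum_(j | j \notin U) rho p j.
  by apply: sumr_ge0 => j _; rewrite ltW// rho_gt0.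
have h1 : \sum_(j in U) 64 * share p j ^+ 2 <= 64.
  rewrite -mulr_sumr -[leRHS]mulr1 ler_pM2l// -share_sum.
  apply: ler_sum => j jU; rewrite expr2 -[leRHS]mulr1.
  by rewrite ler_wpM2l ?share_ge0// share_le1.
have -> : \sum_(j in U) (if p j < \sum_(k | k \notin U) p k
      then 4 * share p j * rho p j else 0) =
    4 * \sum_(j in U) (if p j < \sum_(k | k \notin U) p k then share p j * rho p j else 0).
  rewrite mulr_sumr; apply: eq_bigr => j _; case: ifP => _; last by rewrite mulr0.
  by rewrite mulrA.
have := ler_wpM2r V0 h1; lra.
Qed.

End Stability.

(** * One round of the algorithm *)

Section OneStep.
Context {R : realType} {K T : nat}.
Variables (B theta : R).
Hypotheses (B8 : 8 <= B) (theta0 : 0 < theta) (theta2 : theta <= 2).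
Hypothesis T0 : (0 < T)%N.

Let B0 : 0 < B. Proof. by apply: lt_le_trans B8. Qed.
Let B2 : 2 <= B. Proof. by apply: le_trans B8; rewrite ler_nat. Qed.

Local Notation full := [set: 'I_K]%SET.
Local Notation n := (T%:R : R).
Local Notation rate := (lrate theta).

Let n0 : 0 < n. Proof. by rewrite ltr0n. Qed.
Let n1 : 1 <= n. Proof. by rewrite ler1n. Qed.

Lemma lrate_gt0 (S : 'I_K -> R) : (forall j, 0 <= S j) -> forall i, 0 < rate S i.
Proof. by move=> S0 i; rewrite mulr_gt0// sqrtr_gt0 ltr_pwDl. Qed.

Section Round.
Variables (L S : 'I_K -> R) (U : {set 'I_K}) (i0 : 'I_K).
Hypotheses (S0 : forall j, 0 <= S j) (i0U : i0 \in U).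

Let p := sol B full (rate S) L.
Let q := sol B U (rate S) L.
Let m j := Num.max (p j) n^-1.
Let S' j := S j + (m j)^-1.
(** Up to the factor [theta], the reciprocal of the rate after the update; the updated sum is what
    makes the logarithmic telescoping of [r2_le] work. *)
Let r j := (Num.sqrt (1 + S' j))^-1.

Let rate0 : forall i, 0 < rate S i. Proof. exact: lrate_gt0. Qed.
Let iT i : i \in full. Proof. by rewrite finset.in_setT. Qed.
Let p0 i : 0 < p i. Proof. exact: sol_gt0. Qed.
Let p1 i : p i <= 1. Proof. exact: (sol_le1 B0 L rate0 (iT i0)). Qed.
Let m0 j : 0 < m j. Proof. by rewrite lt_max p0. Qed.
Let pm j : p j <= m j. Proof. by rewrite le_max lexx. Qed.
Let nm j : n^-1 <= m j. Proof. by rewrite le_max lexx orbT. Qed.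
Let m1 j : m j <= 1. Proof. by rewrite ge_max p1 invf_le1. Qed.
Let mp j : m j <= p j + n^-1.
Proof. by rewrite ge_max lerDl lerDr invr_ge0 ltW//= ltW. Qed.
Let S'0 j : 0 <= S' j. Proof. by rewrite addr_ge0// invr_ge0 ltW. Qed.
Let sq0 j : 0 < Num.sqrt (1 + S' j). Proof. by rewrite sqrtr_gt0 ltr_pwDl. Qed.
Let r0 j : 0 < r j. Proof. by rewrite invr_gt0. Qed.

Let sqrt_split j : Num.sqrt (1 + S' j) <= Num.sqrt (1 + S j) + Num.sqrt (m j)^-1.
Proof.
have a0 : 0 <= 1 + S j by rewrite addr_ge0.
have b0 : 0 <= (m j)^-1 by rewrite invr_ge0 ltW.
rewrite -(@ler_pXn2r _ 2)// ?nnegrE ?addr_ge0 ?sqrtr_ge0//.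
rewrite sqr_sqrtr ?addr_ge0// sqrrD !sqr_sqrtr// /S' addrA lerD2r lerDl.
by rewrite mulrn_wge0// mulr_ge0 ?sqrtr_ge0.
Qed.

(** The iterate uses the rate before the update, but the square root grows by at most
    [1 / sqrt (m j) <= 1 / p j], and the barrier term [B / p j] of [rho] pays for that because
    [theta <= B]. *)
Lemma rho_le_rate j : rho B (rate S) p j <= r j / theta.
Proof.
rewrite [leRHS](_ : _ = (theta * Num.sqrt (1 + S' j))^-1); last first.
  by rewrite invfM mulrC.
rewrite /rho lef_pV2 ?posrE ?mulr_gt0//; last by rewrite addr_gt0// divr_gt0.
apply: (@le_trans _ _ (theta * (Num.sqrt (1 + S j) + Num.sqrt (m j)^-1))).
  by rewrite ler_pM2l.
rewrite mulrDr addrC lerD2r.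
have h : Num.sqrt (m j)^-1 <= (p j)^-1.
  apply: (@le_trans _ _ (m j)^-1); last by rewrite lef_pV2 ?posrE.
  have h1 : 1 <= (m j)^-1 by rewrite -invr1 lef_pV2 ?posrE.
  rewrite -[leRHS]ger0_norm ?invr_ge0 ?(ltW (m0 j))// -sqrtr_sqr ler_wsqrtr//.
  by rewrite expr2 ler_pMl// invr_gt0.
apply: ler_pM => //; [exact: ltW|].
by have := B8; have := theta2; lra.
Qed.

Let d j := theta * (Num.sqrt (1 + S' j) - Num.sqrt (1 + S j)).

Let d0 j : 0 <= d j.
Proof.
by rewrite mulr_ge0 ?(ltW theta0)// subr_ge0 ler_wsqrtr// lerD2l lerDl invr_ge0 ltW.
Qed.

Let rateE j : rate S' j = rate S j + d j.
Proof. by rewrite /lrate /d; ring. Qed.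

(** Difference of squares: with [a], [b] the old and new square roots, [b * (b - a) <= b ^+ 2 - a ^+
    2 = (m j)^-1]. *)
Let d_le j : d j * m j <= theta * r j.
Proof.
rewrite /d /r -mulrA ler_wpM2l ?(ltW theta0)//.
rewrite -[leRHS]mul1r ler_pdivlMr//.
set b := Num.sqrt (1 + S' j); set a := Num.sqrt (1 + S j).
have bE : b ^+ 2 = 1 + S' j by rewrite sqr_sqrtr// addr_ge0.
have aE : a ^+ 2 = 1 + S j by rewrite sqr_sqrtr// addr_ge0.
have a0 : 0 <= a by rewrite sqrtr_ge0.
have ab : a <= b by rewrite ler_wsqrtr// lerD2l lerDl invr_ge0 ltW.
have h : (b ^+ 2 - a ^+ 2) * m j = 1.
  rewrite bE aE /S' (_ : _ - _ = (m j)^-1); last by ring.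
  by rewrite mulVf// gt_eqF.
have : 0 <= a * (b - a) * m j by rewrite !mulr_ge0 ?subr_ge0// ltW.
nra.
Qed.

Let d_sqrt j : d j <= theta / Num.sqrt (m j).
Proof.
rewrite /d ler_wpM2l ?(ltW theta0)// lerBlDl -sqrtrV ?(ltW (m0 j))//.
Qed.

(** Monotonicity of [hent] moves [x] up to [min (1, 4 * m j)], where the floor [1/T] inside [m] caps
    the logarithm at [ln T], however small the probability is. The 4 is that of [path_double]. *)
Lemma hent_le_log x j : 0 < x -> x <= 1 -> x <= 4 * m j ->
  hent x <= 4 * m j * (1 + ln n).
Proof.
move=> x0 x1 xm; set y := Num.min 1 (4 * m j).
have my : m j <= y by rewrite le_min m1 ler_peMl ?(ltW (m0 j))// ler1n.
have y0 : 0 < y by apply: lt_le_trans my.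
have y1 : y <= 1 by rewrite ge_min lexx.
have xy : x <= y by rewrite le_min x1.
apply: (le_trans (hent_le x0 xy y1)).
rewrite /hent; apply: ler_pM; first exact: ltW.
- by rewrite subr_ge0 (le_trans (ln_le0 y1)).
- by rewrite /y ge_min lexx orbT.
rewrite lerD2l lerNl -lnV ?posrE// ler_ln ?posrE ?invr_gt0//.
exact: le_trans my.
Qed.

Section Played.
Variables (i : 'I_K) (z : R).
Hypotheses (z0 : 0 <= z) (zp : z * p i <= 1).

Let L' := add_loss L i z.
Let x := sol B full (rate S) L'.

Let x0 j : 0 < x j. Proof. exact: sol_gt0. Qed.
Let xp j : x j <= 2 * p j.
Proof. exact: (other_double B2 rate0 (iT i) z0 (lexx z) zp). Qed.

(** One factor 2 comes from the loss update, the other from the rate update. For the latter, with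
    [u = 2 * x j], both [d j / theta] and [- ln u] are at most [2 / sqrt u], so [4 * theta <= B] is
    required: this is the origin of [8 <= B] with [theta <= 2]. *)
Lemma path_double s j : 0 <= s <= 1 ->
  sol B full (fun k => rate S k + s * d k) L' j <= 4 * p j.
Proof.
move=> /andP[s0 s1]; have sd k : 0 <= s * d k by rewrite mulr_ge0.
apply: (@le_trans _ _ (2 * x j)); last by have := xp j; lra.
apply: (sol_rate_increase B0 rate0 sd (iT j) (iT j)) => //.
rewrite -/x; set u := 2 * x j.
have u0 : 0 < u by rewrite mulr_gt0.
have [u1|u1] := leP 1 u.
  apply: (@le_trans _ _ 0); last by rewrite divr_ge0// ltW.
  by rewrite mulr_ge0_le0// oppr_le0 ln_ge0.
have su0 : 0 < Num.sqrt u by rewrite sqrtr_gt0.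
have lnu : - ln u <= 2 / Num.sqrt u.
  have h := ln_le_subr1 (_ : 0 < (Num.sqrt u)^-1).
  rewrite -[X in ln X](sqr_sqrtr (ltW u0)) expr2 lnM ?posrE//.
  by move: h; rewrite invr_gt0 lnV ?posrE// => /(_ su0); lra.
have dj : s * d j <= theta * (2 / Num.sqrt u).
  apply: (@le_trans _ _ (d j)); first by rewrite ler_piMl.
  apply: (le_trans (d_sqrt j)); rewrite ler_pM2l//.
  rewrite -[leRHS]invf_div lef_pV2 ?posrE ?sqrtr_gt0 ?divr_gt0// ler_pdivrMr//.
  rewrite -[leRHS]ger0_norm ?mulr_ge0 ?sqrtr_ge0// -sqrtr_sqr ler_wsqrtr//.
  rewrite exprMn sqr_sqrtr ?(ltW (m0 j))//.
  by have := xp j; have := pm j; rewrite /u; lra.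
apply: (@le_trans _ _ (theta * (2 / Num.sqrt u) * (2 / Num.sqrt u))).
  by rewrite ler_pM// oppr_ge0 ln_le0// ltW.
rewrite [leLHS](_ : _ = 4 * theta / u); last first.
  rewrite -[X in _ = _ / X](sqr_sqrtr (ltW u0)); field.
  by rewrite lt0r_neq0.
rewrite ler_pM2r ?invr_gt0//.
by have := B8; have := theta2; lra.
Qed.

Lemma gap_round_step :
  p i * (z * (p i - q i)) <=
  p i * (gap B U (rate S') L' - gap B U (rate S) L) + stab B U (rate S) p i
  + p i * (4 * theta * (1 + ln n) * \sum_(j | j \notin U) r j).
Proof.
have ln0 : 0 <= 1 + ln n by rewrite addr_ge0// ln_ge0.
have h1 := gap_loss_step B2 rate0 i0U z0 zp.
have h2 : gap B U (rate S) L' <= gap B U (rate S') L' +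
    4 * theta * (1 + ln n) * \sum_(j | j \notin U) r j.
  rewrite (_ : rate S' = fun j => rate S j + d j); last by apply/funext.
  apply: (gap_rate_increase B0 rate0 d0 i0U) => s s01.
  have s0 : 0 <= s by case/andP: s01.
  have g0 k : 0 < rate S k + s * d k by rewrite ltr_pwDl// mulr_ge0.
  rewrite mulr_sumr; apply: ler_sum => j _.
  apply: (@le_trans _ _ (d j * (4 * m j * (1 + ln n)))).
    rewrite ler_wpM2l//; apply: hent_le_log.
    - exact: sol_gt0.
    - exact: (sol_le1 B0 L' g0 (iT j)).
    - by apply: (le_trans (path_double j s01)); rewrite ler_pM2l.
  rewrite [leLHS](_ : _ = 4 * (1 + ln n) * (d j * m j)); last by ring.
  rewrite [leRHS](_ : _ = 4 * (1 + ln n) * (theta * r j)); last by ring.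
  by rewrite ler_wpM2l// mulr_ge0.
apply: (le_trans h1); rewrite [leRHS]addrAC lerD2r -[leRHS]mulrDr ler_pM2l//.
by rewrite [leRHS]addrAC lerD2r.
Qed.

End Played.


Let dl j := ln (1 + S' j) - ln (1 + S j).

Let dl0 j : 0 <= dl j.
Proof.
rewrite subr_ge0 ler_ln ?posrE ?ltr_pwDl//.
by rewrite lerD2l lerDl invr_ge0 ltW.
Qed.

(** The bound [ln b - ln a >= (b - a) / b], where [b - a = (m j)^-1] is the increment of [S]. *)
Let r2_le j : r j ^+ 2 / m j <= dl j.
Proof.
have a0 : 0 < 1 + S j by rewrite ltr_pwDl.
have b0 : 0 < 1 + S' j by rewrite ltr_pwDl.
have := ln_sub_le b0 a0; rewrite /dl.
suff -> : r j ^+ 2 / m j = - ((1 + S j - (1 + S' j)) / (1 + S' j)) by lra.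
rewrite /r exprVn sqr_sqrtr ?(ltW b0)//.
rewrite (_ : 1 + S j - (1 + S' j) = - (m j)^-1); last by rewrite /S'; ring.
by rewrite mulNr opprK mulrC.
Qed.

(** AM-GM with the weight [beta * m j]: one part is a probability, charged to pulls, the other
    telescopes. The factor [y] is 1 outside [U] and a share inside, where its square keeps the sum
    over [U] bounded. *)
Lemma weighted_amgm beta y j : 0 < beta -> 
  y * r j <= beta * m j * y ^+ 2 + dl j / (4 * beta).
Proof.
move=> b0; have := r2_le j.
rewrite ler_pdivrMr// => h.
rewrite -lerBlDl ler_pdivlMr ?mulr_gt0//.
rewrite -(@ler_pM2r _ (m j))//.
have := sqr_ge0 (2 * beta * m j * y - r j).
move: h; set M := m j; set X := r j; set D := dl j; lra.
Qed.

Variables (b : 'I_K -> R) (bU : R).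
Hypotheses (b0 : forall j, 0 < b j) (bU0 : 0 < bU).

Definition stepsize j : R := if j \in U then bU else b j.

(** Coefficient of the sum of [r j]: stability through [stab_sum] and [rho_le_rate], plus the
    entropy penalty of the outside arms. *)
Definition leading : R := 65 / theta + 4 * theta * (1 + ln n).

Lemma leading_ge0 : 0 <= leading.
Proof. by rewrite addr_ge0 ?divr_ge0 ?mulr_ge0 ?addr_ge0 ?ln_ge0// ltW. Qed.

Let pV := \sum_(j | j \notin U) p j.

Let pV0 : 0 <= pV.
Proof. by apply: sumr_ge0 => j _; exact: ltW. Qed.

Lemma rate_terms_le :
  \sum_i stab B U (rate S) p i + 4 * theta * (1 + ln n) * \sum_(j | j \notin U) r j <=
  leading * (\sum_(j | j \notin U) b j * (p j + n^-1) + bU * (pV + n^-1) +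
    \sum_j dl j / (4 * stepsize j)).
Proof.
have ln0 : 0 <= 1 + ln n by rewrite addr_ge0// ln_ge0.
pose XU := \sum_(j in U) (if p j < pV then share B U (rate S) p j * r j else 0).
have y0 j : 0 <= share B U (rate S) p j by exact: (share_ge0 B2 L rate0 i0U).
have y1 j : j \in U -> share B U (rate S) p j <= 1 by exact: (share_le1 B2 L rate0 i0U).
have XU0 : 0 <= XU.
  by apply: sumr_ge0 => j _; case: ifP => // _; rewrite mulr_ge0// ltW.
have V0 : 0 <= \sum_(j | j \notin U) r j by apply: sumr_ge0 => j _; exact: ltW.
have h1 : \sum_(j | j \notin U) rho B (rate S) p j <= (\sum_(j | j \notin U) r j) / theta.
  by rewrite mulr_suml; apply: ler_sum => j _; exact: rho_le_rate.
have h2 : \sum_(j in U) (if p j < pV then share B U (rate S) p j * rho B (rate S) p j else 0)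
    <= XU / theta.
  rewrite mulr_suml; apply: ler_sum => j _; case: ifP => _; last by rewrite mul0r.
  by rewrite -mulrA ler_wpM2l// rho_le_rate.
have h3 := stab_sum B2 L rate0 i0U.
have h4 : \sum_(j | j \notin U) r j <=
    \sum_(j | j \notin U) b j * (p j + n^-1) + \sum_(j | j \notin U) dl j / (4 * b j).
  rewrite -big_split/=; apply: ler_sum => j _.
  have := weighted_amgm 1 j (b0 j); rewrite mul1r expr1n mulr1 => /le_trans; apply.
  by rewrite lerD2r ler_pM2l.
(* The restriction [p j < pV] bounds [m j] by [pV + 1/T], and squared shares sum to at most 1. So
   all arms of [U] together are charged a single copy of the outside mass. *)
have h5 : XU <= bU * (pV + n^-1) + \sum_(j in U) dl j / (4 * bU).
  apply: (@le_trans _ _ (\sum_(j in U) (bU * (pV + n^-1) * share B U (rate S) p j + dl j / (4 * bU)))).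
    apply: ler_sum => j jU.
    have P0 : 0 <= pV + n^-1 by rewrite addr_ge0// invr_ge0 ltW.
    case: ifP => [pj|_]; last first.
      apply: addr_ge0; first by rewrite mulr_ge0// mulr_ge0// ltW.
      by rewrite divr_ge0// mulr_ge0// ltW.
    apply: (le_trans (weighted_amgm _ j bU0)); rewrite lerD2r -!mulrA ler_pM2l//.
    apply: ler_pM; [exact: ltW|exact: sqr_ge0| |].
      by apply: (le_trans (mp j)); rewrite lerD2r ltW.
    by rewrite expr2 -[leRHS]mulr1 ler_wpM2l// y1.
  by rewrite big_split/= -mulr_sumr (share_sum B2 L rate0 i0U) mulr1.
have h6 : \sum_j dl j / (4 * stepsize j) =
    \sum_(j in U) dl j / (4 * bU) + \sum_(j | j \notin U) dl j / (4 * b j).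
  rewrite (bigID (mem U))/=; congr (_ + _); apply: eq_bigr => j; rewrite /stepsize.
    by move=> ->.
  by move=> /negbTE->.
have lead0 := leading_ge0.
apply: (@le_trans _ _ (leading * (\sum_(j | j \notin U) r j + XU))); last first.
  by rewrite ler_wpM2l// h6; lra.
rewrite /leading; have t0 : 0 <= theta^-1 by rewrite invr_ge0 ltW.
have XT : 0 <= XU * theta^-1 by rewrite mulr_ge0.
have XL : 0 <= theta * (1 + ln n) * XU by rewrite !mulr_ge0// ltW.
move: h1 h2 h3 XT XL; rewrite -/p -/pV; lra.
Qed.

Variable l : 'I_K -> R.
Hypothesis l01 : forall i, 0 <= l i <= 1.

(** The logarithms collect the telescoping AM-GM parts. The last term prepays the uniform mixing of
    the comparator in [gap_final_le]; in expectation it costs at most [1/T] per round, as the losses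
    of a round sum to at most [K]. *)
Definition potential (st : ('I_K -> R) * ('I_K -> R)) : R :=
  gap B U (rate st.2) st.1 + leading * \sum_j ln (1 + st.2 j) / (4 * stepsize j)
  - (\sum_j st.1 j) / (n * K%:R).

Lemma alg_stepE i : alg_step T theta 1 B (L, S) (i, l i) =
  (add_loss L i (l i / p i), S').
Proof.
have K0 : (0 < K)%N by case: i => k; case: (K).
rewrite /alg_step/= ftrl_argminE// -/p; congr (_, _).
  by apply/funext => j; rewrite /add_loss; case: eqVneq => // ->.
apply/funext => j; rewrite /S' (_ : 1 - 2 * 1 = -1); last by ring.
by rewrite powRN powRr1 ?(ltW (m0 j)).
Qed.

Lemma one_step :
  \sum_i (p i - q i) * l i <=
  \sum_i p i * potential (alg_step T theta 1 B (L, S) (i, l i)) - potential (L, S)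
  + (leading * (\sum_(j | j \notin U) b j * (p j + n^-1) + bU * (pV + n^-1)) + n^-1).
Proof.
have K0 : 0 < K%:R :> R by rewrite ltr0n; case: i0 => k; case: (K).
have sp : \sum_i p i = 1 by rewrite (sol_sumT B0 L rate0 (iT i0)).
pose Q := 4 * theta * (1 + ln n) * \sum_(j | j \notin U) r j.
pose G i := gap B U (rate S') (add_loss L i (l i / p i)).
pose H := \sum_j dl j / (4 * stepsize j).
have h i : (p i - q i) * l i <= p i * (G i - gap B U (rate S) L)
    + stab B U (rate S) p i + p i * Q.
  have [l0 l1] := andP (l01 i).
  have zp : l i / p i * p i <= 1 by rewrite divfK ?lt0r_neq0.
  have := gap_round_step (divr_ge0 l0 (ltW (p0 i))) zp.
  suff -> : (p i - q i) * l i = p i * (l i / p i * (p i - q i)) by [].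
  by field; rewrite lt0r_neq0.
apply: (le_trans (ler_sum _ (fun i _ => h i))).
have pot i : p i * potential (alg_step T theta 1 B (L, S) (i, l i)) =
    p i * (G i - gap B U (rate S) L) + p i * (potential (L, S) + leading * H)
    - l i / (n * K%:R).
  rewrite alg_stepE /potential /= -/(G i).
  have -> : \sum_j add_loss L i (l i / p i) j = \sum_j L j + l i / p i.
    rewrite big_split/=; congr (_ + _); rewrite -big_mkcond/=.
    by rewrite (big_pred1 i).
  have -> : \sum_j ln (1 + S' j) / (4 * stepsize j) =
      \sum_j ln (1 + S j) / (4 * stepsize j) + H.
    rewrite -big_split/=; apply: eq_bigr => j _; rewrite /dl; ring.
  field; rewrite !lt0r_neq0//.
under [X in _ <= X - _ + _]eq_bigr do rewrite pot.
rewrite sumrB !big_split/= -!mulr_suml sp !mul1r.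
have lsum : (\sum_i l i) / (n * K%:R) <= n^-1.
  rewrite invfM mulrCA ler_piMr ?invr_ge0 ?(ltW n0)// ler_pdivrMr// mul1r.
  rewrite -[X in _ <= X%:R](card_ord K) -sumr_const; apply: ler_sum => i _.
  by case/andP: (l01 i).
have := rate_terms_le; rewrite -/Q -/H; lra.
Qed.

End Round.

End OneStep.

(** * Boundary terms and expectation over action sequences *)

Section Boundary.
Context {R : realType} {K T : nat}.
Variables (B theta : R).
Hypotheses (B0 : 0 < B) (theta0 : 0 < theta).
Hypothesis T1 : (1 < T)%N.

Local Notation full := [set: 'I_K]%SET.
Local Notation n := (T%:R : R).
Local Notation rate := (lrate theta).

Variables (U : {set 'I_K}) (i0 : 'I_K).
Hypothesis i0U : i0 \in U.

Let iT i : i \in full. Proof. by rewrite finset.in_setT. Qed.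
Let n0 : 0 < n. Proof. by rewrite ltr0n; exact: ltnW. Qed.
Let n2 : 2 <= n. Proof. by rewrite ler_nat. Qed.
Let K0 : 0 < K%:R :> R. Proof. by rewrite ltr0n; case: i0 => k; case: (K). Qed.

(** The uniform point of the face bounds its optimal value from above; on the simplex the barrier is
    nonnegative and [hent <= 1]. *)
Lemma gap_init_ge (S : 'I_K -> R) : (forall j, S j = 0) ->
  - (B * (K%:R * ln K%:R) + theta * K%:R) <= gap B U (rate S) (fun=> 0).
Proof.
move=> S0; have rE i : rate S i = theta by rewrite /lrate S0 addr0 sqrtr1 mulr1.
have r0 i : 0 < rate S i by rewrite rE.
have K1 : 1 <= K%:R :> R by rewrite ler1n -(ltr0n R).
have cU : 0 < #|U|%:R :> R by rewrite ltr0n; apply/card_gt0P; exists i0.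
have cU1 : 1 <= #|U|%:R :> R by rewrite ler1n -(ltr0n R).
have cK : #|U|%:R <= K%:R :> R by rewrite ler_nat -[leqRHS]card_ord max_card.
set u : R := #|U|%:R^-1; have u0 : 0 < u by rewrite invr_gt0.
have u1 : u <= 1 by rewrite invf_le1.
have hU : Phi B U (rate S) (fun=> 0) <= B * (K%:R * ln K%:R).
  apply: (le_trans (@sol_min _ _ _ B0 _ _ (fun=> 0) _ r0 i0U (fun=> u) _ _)) => //.
    by rewrite sumr_const -mulr_natl divff ?gt_eqF.
  rewrite /obj; apply: (@le_trans _ _ (\sum_(i in U) B * ln #|U|%:R)).
    apply: ler_sum => i _; rewrite rE mulr0 add0r lnV ?posrE// mulrN opprK.
    by rewrite gerBl mulr_ge0 ?(ltW theta0)// hent_ge0// ltW.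
  rewrite sumr_const -[leLHS]mulr_natl [leLHS]mulrCA ler_pM2l//.
  by apply: ler_pM => //; rewrite ?ln_ge0// ler_ln ?posrE.
have hF : - (theta * K%:R) <= Phi B full (rate S) (fun=> 0).
  rewrite /Phi /obj -[X in - (_ * X%:R)]card_ord -(@cardsT 'I_K) mulrC mulr_natl -sumr_const -sumrN.
  apply: ler_sum => i _; rewrite mulr0 add0r rE.
  set x := sol _ _ _ _ _; have x0 : 0 < x by exact: sol_gt0.
  have x1 : x <= 1 by exact: (sol_le1 B0 _ r0 (iT i0)).
  have h1 := ler_wpM2l (ltW theta0) (hent_le1 x0 x1).
  have h2 : B * ln x <= 0 by rewrite mulr_ge0_le0 ?ln_le0// ltW.
  lra.
rewrite /gap; lra.
Qed.

Let hent_shrink x : 0 < x -> x <= 1 -> hent x - hent ((1 - n^-1) * x) <= 2 / n.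
Proof.
move=> x0 x1; have e0 : 0 < n^-1 by rewrite invr_gt0.
have e1 : n^-1 <= 2^-1 by rewrite lef_pV2 ?posrE.
set y := (1 - n^-1) * x; have y0 : 0 < y by rewrite mulr_gt0//; lra.
have yE : x - y = n^-1 * x by rewrite /y; ring.
have h1 : hent x - hent y <= - ln y * (x - y).
  have := ln_sub_le x0 y0; rewrite ler_pdivlMr// /hent; lra.
have h2 : - ln y <= y^-1.
  by have := @ln_le_subr1 R y^-1; rewrite invr_gt0 lnV ?posrE// => /(_ y0); lra.
apply: (le_trans h1); apply: (@le_trans _ _ (y^-1 * (x - y))).
  by rewrite ler_wpM2r// yE mulr_ge0// ltW.
have xy : x <= 2 * y by rewrite /y; nra.
by rewrite yE ler_pdivrMl//; have := ler_wpM2l (ltW e0) xy; lra.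
Qed.

(** The face optimum vanishes off [U], where the barrier is infinite, so it is mixed with weight
    [1/T] with the uniform point. The barrier then costs [ln (n * K)] per arm, and the entropy
    change of at most [2 / n] meets a rate of at most [2 * theta * n]. *)
Lemma gap_final_le (L S : 'I_K -> R) : (forall j, 0 <= L j) ->
  (forall j, 0 <= S j <= n ^+ 2) ->
  gap B U (rate S) L <=
  (\sum_j L j) / (n * K%:R) + (B * (K%:R * ln (n * K%:R)) + 4 * theta * K%:R).
Proof.
move=> L0 Sn; have S0 j : 0 <= S j by case/andP: (Sn j).
have r0 := lrate_gt0 theta0 S0.
set e := (n * K%:R)^-1; have nK : 0 < n * K%:R by rewrite mulr_gt0.
have e0 : 0 < e by rewrite invr_gt0.
have n1 : 0 < 1 - n^-1.
  have : n^-1 <= 2^-1 by rewrite lef_pV2 ?posrE.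
  lra.
pose q := sol B U (rate S) L; pose p' i := (1 - n^-1) * q i + e.
have q0 i : 0 <= q i by apply: sol_ge0.
have p'0 i : 0 < p' i by rewrite ltr_wpDl// mulr_ge0// ltW.
have p's : \sum_(i in full) p' i = 1.
  rewrite (eq_bigl xpredT); last by move=> i; rewrite finset.in_setT.
  rewrite big_split/= -mulr_sumr (sol_sumT B0 L r0 i0U) sumr_const card_ord.
  by rewrite -mulr_natl /e; field; rewrite !gt_eqF.
have p'1 i : p' i <= 1.
  rewrite -p's (bigD1 i)//= lerDl; apply: sumr_ge0 => j _; exact: ltW.
have hF := sol_min B0 L r0 (iT i0) (fun i _ => p'0 i) p's.
have rle i : rate S i <= theta * (2 * n).
  rewrite /lrate ler_pM2l// -[leRHS]ger0_norm ?mulr_ge0 ?(ltW n0)//.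
  rewrite -sqrtr_sqr ler_wsqrtr// exprMn.
  have : 1 <= n ^+ 2 by rewrite expr_ge1//; have := n2; lra.
  have := andP (Sn i); case; lra.
suff : obj B full (rate S) L p' - Phi B U (rate S) L <=
    \sum_(i < K) (L i * e + (B * ln (n * K%:R) + 4 * theta)).
  rewrite big_split/= -mulr_suml sumr_const card_ord.
  rewrite -[X in _ <= _ + X]mulr_natr => h.
  rewrite /gap; apply: (le_trans (lerB hF (lexx _))).
  by apply: (le_trans h); rewrite le_eqVlt; apply/orP; left; apply/eqP; rewrite /e; ring.
rewrite /Phi /obj [X in _ - X]big_mkcond/= (eq_bigl xpredT); last first.
  by move=> i; rewrite finset.in_setT.
rewrite -sumrB; apply: ler_sum => i _.
have lnp : - (B * ln (p' i)) <= B * ln (n * K%:R).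
  rewrite -mulrN ler_pM2l// lerNl -lnV ?posrE// ler_ln ?posrE//.
  by rewrite /p' lerDr mulr_ge0// ltW.
have eL : 0 <= L i * e by rewrite mulr_ge0// ltW.
case: ifPn => iU; last first.
  have hp : 0 <= rate S i * hent (p' i) by rewrite mulr_ge0 ?hent_ge0// ltW.
  have pe : p' i = e by rewrite /p' /q sol_out// mulr0 add0r.
  by move: lnp hp; have := theta0; rewrite pe; lra.
have qi0 : 0 < q i by exact: sol_gt0.
have qi1 : q i <= 1 by exact: (sol_le1 B0 L r0 i0U).
have lnq : B * ln (q i) <= 0 by rewrite mulr_ge0_le0 ?ln_le0// ltW.
have hq : hent (q i) - hent (p' i) <= 2 / n.
  apply: le_trans (hent_shrink qi0 qi1); rewrite lerD2l lerN2 hent_le//.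
    by rewrite mulr_gt0.
  by rewrite lerDl ltW.
have hr : rate S i * (hent (q i) - hent (p' i)) <= 4 * theta.
  apply: (@le_trans _ _ (rate S i * (2 / n))); first by rewrite ler_wpM2l// ltW.
  apply: (@le_trans _ _ (theta * (2 * n) * (2 / n))).
    by rewrite ler_wpM2r// divr_ge0// ltW.
  by rewrite le_eqVlt; apply/orP; left; apply/eqP; field; rewrite gt_eqF.
have qL : 0 <= n^-1 * q i * L i by rewrite !mulr_ge0// invr_ge0 ltW.
rewrite -/q {1}/p'; lra.
Qed.

End Boundary.

Section TupleExpectation.
Context {R : realType} {I : finType}.
Variable kern : seq I -> I -> R.
Implicit Types F G : seq I -> R.

(** Expectation over [k] successive actions, averaging out the last action first: a one-step
    inequality then plugs in directly, and [seqE_tuple] recovers the product weights. *)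
Fixpoint seqE (k : nat) F : R :=
  if k is k'.+1 then seqE k' (fun a => \sum_i kern a i * F (rcons a i))
  else F [::].

Lemma sum_tuple_rcons k (F : k.+1.-tuple I -> R) :
  \sum_(s : k.+1.-tuple I) F s =
  \sum_(s : k.-tuple I) \sum_i F [tuple of rcons s i].
Proof.
rewrite pair_big/=; pose h (u : k.-tuple I * I) := [tuple of rcons u.1 u.2].
rewrite (reindex h)//=; apply: onW_bij; apply: inj_card_bij.
  move=> [s i] [s' i'] /(congr1 val)/= /rcons_inj [ss ->].
  by congr (_, _); apply: val_inj.
by rewrite card_prod !card_tuple expnSr.
Qed.

Lemma seqE_tuple k F :
  \sum_(s : k.-tuple I) (\prod_(t < k) kern (take t s) (tnth s t)) * F s = seqE k F.
Proof.
elim: k F => [|k IH] F.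
  rewrite (big_pred1 [tuple])/=; last by move=> s; exact/esym/eqP/tuple0.
  by rewrite big_ord0 mul1r.
rewrite sum_tuple_rcons /= -IH; apply: eq_bigr => s _.
rewrite mulr_sumr; apply: eq_bigr => i _; rewrite mulrA; congr (_ * _).
rewrite big_ord_recr/=; congr (_ * _).
  apply: eq_bigr => t _.
  have ts : (t < size s)%N by rewrite size_tuple.
  rewrite !(tnth_nth i)/= nth_rcons ts; congr (kern _ _).
  by rewrite -cats1 take_cat ts.
rewrite (tnth_nth i)/= nth_rcons size_tuple ltnn eqxx.
by rewrite -cats1 take_size_cat// size_tuple.
Qed.

Lemma eq_seqE k F G : (forall a, size a = k -> F a = G a) -> seqE k F = seqE k G.
Proof.
elim: k F G => [|k IH] F G h /=; first exact: h.
by apply: IH => a ak; apply: eq_bigr => i _; rewrite h// size_rcons ak.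
Qed.

Lemma seqED k F G : seqE k (fun a => F a + G a) = seqE k F + seqE k G.
Proof.
elim: k F G => //= k IH F G; rewrite -IH; apply: eq_seqE => a _.
by rewrite -big_split/=; apply: eq_bigr => i _; rewrite mulrDr.
Qed.

Lemma seqEZ k c F : seqE k (fun a => c * F a) = c * seqE k F.
Proof.
elim: k F => //= k IH F; rewrite -IH; apply: eq_seqE => a _.
by rewrite mulr_sumr; apply: eq_bigr => i _; rewrite mulrCA.
Qed.

Lemma seqE_sum k (J : Type) (r : seq J) (P : pred J) (F : J -> seq I -> R) :
  seqE k (fun a => \sum_(j <- r | P j) F j a) = \sum_(j <- r | P j) seqE k (F j).
Proof.
elim: r => [|j r IH].
  rewrite big_nil -[RHS](mul0r (seqE k (fun=> 0))) -seqEZ.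
  by apply: eq_seqE => a _; rewrite big_nil mul0r.
rewrite big_cons -IH; case: ifP => Pj.
  by rewrite -seqED; apply: eq_seqE => a _; rewrite big_cons Pj.
by apply: eq_seqE => a _; rewrite big_cons Pj.
Qed.

Variable N : nat.
Hypothesis kern_ge0 : forall a i, (size a < N)%N -> 0 <= kern a i.
Hypothesis kern_sum : forall a, (size a < N)%N -> \sum_i kern a i = 1.

Lemma seqE_le k F G : (k <= N)%N -> (forall a, size a = k -> F a <= G a) ->
  seqE k F <= seqE k G.
Proof.
elim: k F G => [|k IH] F G kN h /=; first exact: h.
apply: IH => [|a ak]; first exact: ltnW.
apply: ler_sum => i _; apply: ler_wpM2l; first by rewrite kern_ge0 ?ak.
by rewrite h// size_rcons ak.
Qed.

Lemma seqE_cst k c : (k <= N)%N -> seqE k (fun=> c) = c.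
Proof.
elim: k => //= k IH kN; rewrite -[RHS]IH ?(ltnW kN)//; apply: eq_seqE => a ak.
by rewrite -mulr_suml kern_sum ?ak// mul1r.
Qed.

Lemma seqE_take k j F : (k <= j <= N)%N -> seqE j (fun s => F (take k s)) = seqE k F.
Proof.
elim: j => [|j IH] /andP[].
  by rewrite leqn0 => /eqP->.
rewrite leq_eqVlt => /orP[/eqP-> _|kj jN].
  by apply: eq_seqE => a aj; rewrite take_oversize ?aj.
rewrite -IH ?(ltnW jN) ?andbT//=; apply: eq_seqE => a aj.
under eq_bigr => i _ do rewrite -cats1 takel_cat ?aj//.
by rewrite -mulr_suml kern_sum ?aj// mul1r.
Qed.

Lemma seqE_potential (X Y Psi : seq I -> R) :
  (forall a, (size a < N)%N ->
    X a <= \sum_i kern a i * Psi (rcons a i) - Psi a + Y a) ->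
  \sum_(t < N) seqE t X <= seqE N Psi - Psi [::] + \sum_(t < N) seqE t Y.
Proof.
move=> h; suff H k : (k <= N)%N ->
    \sum_(t < k) seqE t X <= seqE k Psi - Psi [::] + \sum_(t < k) seqE t Y by exact: H.
elim: k => [_|k IH kN]; first by rewrite !big_ord0 subrr addr0.
rewrite !big_ord_recr /=.
have := IH (ltnW kN).
have : seqE k X <= seqE k (fun a => (\sum_i kern a i * Psi (rcons a i)) + (- 1) * Psi a + Y a).
  by apply: seqE_le => [|a ak]; [exact: ltnW|rewrite mulN1r h// ak].
rewrite !seqED seqEZ; lra.
Qed.

End TupleExpectation.

(** * Regret against a face for a fixed loss tree *)

Section Trajectory.
Context {R : realType} {K T : nat}.
Variables (B theta : R).
Hypotheses (B8 : 8 <= B) (theta0 : 0 < theta) (theta2 : theta <= 2).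
Hypothesis T1 : (1 < T)%N.

Let B0 : 0 < B. Proof. by apply: lt_le_trans B8. Qed.
Let T0 : (0 < T)%N. Proof. exact: ltnW. Qed.

Local Notation full := [set: 'I_K]%SET.
Local Notation n := (T%:R : R).
Local Notation rate := (lrate theta).

Let n0 : 0 < n. Proof. by rewrite ltr0n. Qed.
Let n2 : 2 <= n. Proof. by rewrite ler_nat. Qed.

Variable ls : nat -> seq 'I_K -> 'I_K -> R.

Definition state (a : seq 'I_K) := alg_state T theta 1 B (hist ls a).

Definition kern (a : seq 'I_K) : 'I_K -> R := alg_p T theta 1 B (hist ls a).

Definition face (U : {set 'I_K}) (a : seq 'I_K) : 'I_K -> R :=
  sol B U (rate (state a).2) (state a).1.

Lemma hist_rcons a i : hist ls (rcons a i) = rcons (hist ls a) (i, ls (size a) a i).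
Proof.
rewrite /hist; suff H pre : hist_aux ls pre (rcons a i) =
    rcons (hist_aux ls pre a) (i, ls (size (pre ++ a)) (pre ++ a) i) by exact: H.
elim: a pre => [|x a IH] pre /=; first by rewrite cats0.
by rewrite IH cat_rcons.
Qed.

Lemma state_rcons a i :
  state (rcons a i) = alg_step T theta 1 B (state a) (i, ls (size a) a i).
Proof. by rewrite /state /alg_state hist_rcons foldl_rcons. Qed.

Hypothesis ls01 : forall t a i, 0 <= ls t a i <= 1.

Lemma state_bounds a : [/\ forall j, 0 <= (state a).1 j,
  forall j, 0 <= (state a).2 j & forall j, (state a).2 j <= (size a)%:R * n].
Proof.
elim/last_ind: a => [|a i [L0 S0 Sn]].
  by split=> j; rewrite /state /alg_state/= ?mul0r.
rewrite state_rcons; case: (state a) L0 S0 Sn => [L S] L0 S0 Sn.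
have r0 := lrate_gt0 theta0 S0; have iT : i \in full by rewrite finset.in_setT.
have l01 k : 0 <= ls (size a) a k <= 1 by exact: ls01.
rewrite (@alg_stepE _ _ T _ _ B8 theta0 L S S0 (ls (size a) a) i) /=.
set p := sol _ _ _ _.
have p0 j : 0 < p j by rewrite sol_gt0// finset.in_setT.
have m0 j : 0 < Num.max (p j) n^-1 by rewrite lt_max p0.
split=> j.
- rewrite /add_loss addr_ge0//; case: ifP => // _.
  by rewrite divr_ge0 ?(ltW (p0 _))//; case/andP: (l01 i).
- by rewrite addr_ge0// invr_ge0 ltW.
- rewrite size_rcons -natr1 mulrDl mul1r lerD//.
  by rewrite invf_ple ?posrE// le_max lexx orbT.
Qed.

Lemma kernE a : (0 < K)%N -> kern a = face full a.
Proof.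
move=> K0; have [_ S0 _] := state_bounds a.
by rewrite /kern /alg_p ftrl_argminE// => i; exact: lrate_gt0.
Qed.

Lemma face_ge0 (U : {set 'I_K}) a i : 0 <= face U a i.
Proof.
by have [_ S0 _] := state_bounds a; apply: sol_ge0 => //; exact: lrate_gt0.
Qed.

Lemma face_sum (U : {set 'I_K}) i0 a : i0 \in U -> \sum_i face U a i = 1.
Proof.
move=> i0U; have [_ S0 _] := state_bounds a.
exact: (sol_sumT B0 _ (lrate_gt0 theta0 S0) i0U).
Qed.

Lemma face_out (U : {set 'I_K}) a i : i \notin U -> face U a i = 0.
Proof. by move=> iU; rewrite /face sol_out. Qed.

Lemma kern_ge0 a i : 0 <= kern a i.
Proof. by rewrite kernE ?face_ge0//; case: i => k; case: (K). Qed.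

Lemma kern_sum a : (0 < K)%N -> \sum_i kern a i = 1.
Proof.
move=> K0; rewrite kernE// (@face_sum _ (Ordinal K0))// finset.in_setT//.
Qed.

Section Comparison.
Variables (U : {set 'I_K}) (i0 : 'I_K).
Hypothesis i0U : i0 \in U.
Variables (b : 'I_K -> R) (bU : R).
Hypotheses (b0 : forall j, 0 < b j) (bU0 : 0 < bU).

Definition pulls j : R := \sum_(t < T) seqE kern t (fun a => kern a j).

(** The accumulated [1/T] prepayments, then the final and the initial bounds on the gap. *)
Definition boundary_cost : R :=
  1 + (B * (K%:R * ln (n * K%:R)) + 4 * theta * K%:R) +
  (B * (K%:R * ln K%:R) + theta * K%:R).

Lemma trajectory_bound :
  \sum_(t < T) seqE kern t (fun a => \sum_i (kern a i - face U a i) * ls t a i) <=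
  @leading R T theta * (\sum_(j | j \notin U) b j * (pulls j + 1)
    + bU * (\sum_(j | j \notin U) pulls j + 1)
    + \sum_j ln (1 + n ^+ 2) / (4 * stepsize U b bU j)) + boundary_cost.
Proof.
have K0 : (0 < K)%N by case: i0 => k; case: (K).
have kg a i : (size a < T)%N -> 0 <= kern a i by move=> _; exact: kern_ge0.
have ks a : (size a < T)%N -> \sum_i kern a i = 1 by move=> _; exact: kern_sum.
pose Psi a := @potential R K T B theta U b bU (state a).
pose Y a := @leading R T theta * (\sum_(j | j \notin U) b j * (kern a j + n^-1)
  + bU * (\sum_(j | j \notin U) kern a j + n^-1)) + n^-1.
pose X a := \sum_i (kern a i - face U a i) * ls (size a) a i.
have step a : (size a < T)%N ->
    X a <= \sum_i kern a i * Psi (rcons a i) - Psi a + Y a.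
  move=> _; have [L0 S0 _] := state_bounds a.
  have := @one_step R K T B theta B8 theta0 theta2 T0 (state a).1 (state a).2 U i0
    S0 i0U b bU b0 bU0 (ls (size a) a) (ls01 (size a) a).
  have -> : ((state a).1, (state a).2) = state a by case: (state a).
  rewrite -/(face full a) -kernE// -/(face U a).
  rewrite [X in _ <= X - _ + _](eq_bigr (fun i => kern a i * Psi (rcons a i))); last first.
    by move=> i _; rewrite /Psi state_rcons.
  by [].
have XE : \sum_(t < T) seqE kern t (fun a => \sum_i (kern a i - face U a i) * ls t a i) =
    \sum_(t < T) seqE kern t X.
  by apply: eq_bigr => t _; apply: eq_seqE => a at_; rewrite /X at_.
rewrite XE; apply: (le_trans (seqE_potential kg step)).
have lead0 : 0 <= @leading R T theta by exact: leading_ge0.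
have YE : \sum_(t < T) seqE kern t Y = @leading R T theta *
    (\sum_(j | j \notin U) b j * (pulls j + 1)
    + bU * (\sum_(j | j \notin U) pulls j + 1)) + 1.
  have tT (t : 'I_T) : (t <= T)%N by exact: ltnW.
  have YtE (t : 'I_T) : seqE kern t Y = @leading R T theta *
    (\sum_(j | j \notin U) b j * (seqE kern t (fun a => kern a j) + n^-1)
    + bU * (\sum_(j | j \notin U) seqE kern t (fun a => kern a j) + n^-1)) + n^-1.
    rewrite seqED (seqE_cst ks)// seqEZ; congr (_ * _ + _).
    rewrite seqED seqEZ seqED (seqE_cst ks)// !seqE_sum; congr (_ + _).
    by apply: eq_bigr => j _; rewrite seqEZ seqED (seqE_cst ks).
  under eq_bigr do rewrite YtE.
  have n1 : \sum_(t < T) n^-1 = 1 :> R.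
    by rewrite sumr_const card_ord -[LHS]mulr_natr mulVf ?gt_eqF.
  rewrite big_split/= n1 -mulr_sumr big_split/= -mulr_sumr big_split/= n1.
  congr (_ * (_ + _ * (_ + _)) + _).
    rewrite exchange_big/=; apply: eq_bigr => j _.
    by rewrite -mulr_sumr big_split/= n1.
  by rewrite exchange_big.
have final : seqE kern T Psi <= @leading R T theta *
    \sum_j ln (1 + n ^+ 2) / (4 * stepsize U b bU j)
    + (B * (K%:R * ln (n * K%:R)) + 4 * theta * K%:R).
  rewrite -[leRHS](seqE_cst ks _ (leqnn T)); apply: (seqE_le kg) => // a aT.
  have [L0 S0 Sn] := state_bounds a.
  have Sb j : 0 <= (state a).2 j <= n ^+ 2 by rewrite S0/= expr2; have := Sn j; rewrite aT.
  have := gap_final_le B0 theta0 T1 i0U L0 Sb.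
  suff h : @leading R T theta * \sum_j ln (1 + (state a).2 j) / (4 * stepsize U b bU j)
    <= @leading R T theta * \sum_j ln (1 + n ^+ 2) / (4 * stepsize U b bU j).
    by move: h; rewrite /Psi /potential; lra.
  rewrite ler_wpM2l//; apply: ler_sum => j _; rewrite ler_wpM2r//.
    rewrite invr_ge0 mulr_ge0// /stepsize; case: ifP => _; exact: ltW.
  have [Sj0 Sjn] := andP (Sb j).
  by rewrite ler_ln ?posrE ?ltr_pwDl// ?exprn_ge0 ?(ltW n0)// lerD2l.
have init : - Psi [::] <= B * (K%:R * ln K%:R) + theta * K%:R.
  rewrite /Psi /potential /state /alg_state/= big1; last first.
    by move=> j _; rewrite addr0 ln1 mul0r.
  rewrite mulr0 addr0 big1// mul0r subr0.
  by have := @gap_init_ge R K B theta B0 theta0 U i0 i0U (fun=> 0) (fun=> erefl); lra.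
rewrite YE /boundary_cost mulrDr; move: final init; lra.
Qed.

End Comparison.

End Trajectory.

(** * Measurability of the iterates *)

Section Measurability.
Context {R : realType} {d : measure_display} {Om : measurableType d}.

Lemma measurable_fun_gtP (f : Om -> R) :
  (forall c, measurable [set w | c < f w]) -> measurable_fun setT f.
Proof.
move=> h; apply: (measurability _ (RGenOInfty.measurableE R)) => //.
move=> /= _ [_ [c ->] <-]; rewrite setTI (_ : _ @^-1` _ = [set w | c < f w])//.
by apply/seteqP; split => w /=; rewrite in_itv/= andbT.
Qed.

Lemma measurable_lt_set (f g : Om -> R) :
  measurable_fun setT f -> measurable_fun setT g ->
  measurable [set w | f w < g w].
Proof.
move=> mf mg; have := measurable_funB mg mf measurableT (@measurable_itv R `]0, +oo[).
rewrite setTI (_ : _ @^-1` _ = [set w | f w < g w])//.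
by apply/seteqP; split=> w /=; rewrite in_itv/= andbT subr_gt0.
Qed.

Lemma measurable_funV_gt0 (f : Om -> R) : (forall w, 0 < f w) ->
  measurable_fun setT f -> measurable_fun setT (fun w => (f w)^-1).
Proof.
move=> f0 mf; apply: measurable_fun_gtP => c.
rewrite (_ : [set w | _] = [set w | c * f w < 1]).
  by apply: measurable_lt_set; [apply: measurable_funM|] => //; exact: measurable_cst.
by apply/seteqP; split=> w /=; rewrite -ltr_pdivlMr// mul1r.
Qed.

Lemma measurable_fun_sqrt (f : Om -> R) :
  measurable_fun setT f -> measurable_fun setT (fun w => Num.sqrt (f w)).
Proof.
move=> mf; apply: (@measurableT_comp _ _ _ _ _ _ (@Num.sqrt R)) => //.
by apply: continuous_measurable_fun; exact: sqrt_continuous.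
Qed.

Lemma measurable_fun_sumP (I : Type) (s : seq I) (P : pred I) (h : I -> Om -> R) :
  (forall i, measurable_fun setT (h i)) ->
  measurable_fun setT (fun w => \sum_(i <- s | P i) h i w).
Proof.
move=> mh; rewrite (_ : (fun w => _) = fun w => \sum_(i <- s) (if P i then h i w else 0)).
  by apply: measurable_sum => i; case: (P i) => //; exact: measurable_cst.
by apply/funext => w; rewrite big_mkcond.
Qed.

Section Solution.
Variable B : R.
Hypothesis B0 : 0 < B.

(** [ginv] and [lam] are choices of a root, so their measurability goes through upper level sets,
    which strict monotonicity rewrites as comparisons of explicit measurable functions. *)
Lemma measurable_ginv (g y : Om -> R) : (forall w, 0 < g w) ->
  measurable_fun setT g -> measurable_fun setT y ->
  measurable_fun setT (fun w => ginv B (g w) (y w)).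
Proof.
move=> g0 mg my; apply: measurable_fun_gtP => c.
have [c0|c0] := leP c 0.
  rewrite (_ : [set w | _] = setT)//; apply/seteqP; split=> w //= _.
  by apply: (le_lt_trans c0); exact: ginv_gt0.
rewrite (_ : [set w | _] = [set w | dpsi B (g w) c < y w]).
  apply: measurable_lt_set => //.
  apply: (@measurable_funB _ _ _ _ (fun w => g w * ln c) (cst (B / c))) => //.
  by apply: measurable_funM => //; exact: measurable_cst.
by apply/seteqP; split=> w /=;
  rewrite -(dpsi_ltE B0 (ltW (g0 w)) c0 (ginv_gt0 B0 (y w) (g0 w))) ginvK.
Qed.

Variables (I : finType) (U : {set I}) (i0 : I) (g L : Om -> I -> R).
Hypotheses (i0U : i0 \in U) (g0 : forall w i, 0 < g w i).
Hypotheses (mg : forall i, measurable_fun setT (fun w => g w i)).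
Hypotheses (mL : forall i, measurable_fun setT (fun w => L w i)).

Lemma measurable_lam : measurable_fun setT (fun w => lam B U (g w) (L w)).
Proof.
apply: measurable_fun_gtP => c.
rewrite (_ : [set w | _] = [set w | mass B U (g w) (L w) c < 1]).
  apply: measurable_lt_set; last exact: measurable_cst.
  apply: measurable_fun_sumP => i; apply: measurable_ginv => //.
  by apply: measurable_funB => //; exact: measurable_cst.
apply/seteqP; split=> w /=; rewrite -(lamP B0 (L w) (g0 w) i0U).
  exact: (mass_lt B0 (L w) (g0 w) i0U).
apply: contraTT; rewrite -!leNgt le_eqVlt => /orP[/eqP->//|/(mass_lt B0 (L w) (g0 w) i0U)].
exact: ltW.
Qed.

Lemma measurable_sol i : measurable_fun setT (fun w => sol B U (g w) (L w) i).
Proof.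
rewrite /sol; case: (i \in U); last exact: measurable_cst.
apply: measurable_ginv => //; apply: measurable_funB => //; exact: measurable_lam.
Qed.

End Solution.

Section State.
Variables (K T : nat) (B theta : R).
Hypotheses (B8 : 8 <= B) (theta0 : 0 < theta) (T1 : (1 < T)%N).

Let B0 : 0 < B. Proof. by apply: lt_le_trans B8. Qed.

Variable env : Om -> nat -> seq 'I_K -> 'I_K -> R.
Hypothesis env01 : forall w t a i, 0 <= env w t a i <= 1.

(** Only past rounds are constrained, so the same lemmas apply when [Om] carries the history
    sigma-algebra of a fixed action prefix, for which later losses may fail to be measurable. *)
Definition past_measurable (a : seq 'I_K) := forall j i, (j < size a)%N ->
  measurable_fun setT (fun w => env w j (take j a) i).

Lemma past_measurable_rcons a i : past_measurable (rcons a i) ->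
  past_measurable a /\ forall k, measurable_fun setT (fun w => env w (size a) a k).
Proof.
move=> h; split=> [j k ja|k].
  have := h j k; rewrite size_rcons -cats1 takel_cat ?(ltnW ja)//.
  by apply; exact: ltnW.
have := h (size a) k; rewrite size_rcons -cats1 take_size_cat//; exact.
Qed.

Lemma measurable_lrate (S : Om -> 'I_K -> R) :
  (forall i, measurable_fun setT (fun w => S w i)) ->
  forall i, measurable_fun setT (fun w => lrate theta (S w) i).
Proof.
move=> mS i; apply: measurable_funM; first exact: measurable_cst.
by apply: measurable_fun_sqrt; apply: measurable_funD => //; exact: measurable_cst.
Qed.

Lemma measurable_state a : past_measurable a ->
  (forall j, measurable_fun setT (fun w => (@state R K T B theta (env w) a).1 j)) /\
  (forall j, measurable_fun setT (fun w => (@state R K T B theta (env w) a).2 j)).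
Proof.
elim/last_ind: a => [_|a i IH /past_measurable_rcons[/IH [mL mS] ml]].
  by split=> j; exact: measurable_cst.
have K0 : (0 < K)%N by case: i => k; case: (K).
have iT : i \in [set: 'I_K]%SET by rewrite finset.in_setT.
have S0 w := let: And3 _ h _ := state_bounds B8 theta0 T1 (env01 w) a in h.
have mp j : measurable_fun setT (fun w => sol B [set: 'I_K]%SET
    (lrate theta (@state R K T B theta (env w) a).2) (@state R K T B theta (env w) a).1 j).
  apply: (measurable_sol B0 iT) => //.
    by move=> w k; exact: lrate_gt0.
  exact: measurable_lrate.
have p0 w j : 0 < sol B [set: 'I_K]%SET
    (lrate theta (@state R K T B theta (env w) a).2) (@state R K T B theta (env w) a).1 j.
  by apply: sol_gt0; rewrite ?finset.in_setT// => k; exact: lrate_gt0.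
have stE w := @alg_stepE R K T B theta B8 theta0 _ _ (S0 w) (env w (size a) a) i.
split=> j.
  rewrite (_ : (fun w => _) = fun w => add_loss (@state R K T B theta (env w) a).1 i
    (env w (size a) a i / sol B [set: 'I_K]%SET
    (lrate theta (@state R K T B theta (env w) a).2) (@state R K T B theta (env w) a).1 i) j).
    apply: measurable_funD => //; case: (j == i); last exact: measurable_cst.
    by apply: measurable_funM => //; exact: measurable_funV_gt0.
  apply/funext => w; rewrite state_rcons [state _ _ _ a]surjective_pairing stE//.
rewrite (_ : (fun w => _) = fun w => (@state R K T B theta (env w) a).2 j +
  (Num.max (sol B [set: 'I_K]%SET
    (lrate theta (@state R K T B theta (env w) a).2) (@state R K T B theta (env w) a).1 j) (T%:R)^-1)^-1).
  apply: measurable_funD => //; apply: measurable_funV_gt0.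
    by move=> w; rewrite lt_max p0.
  by apply: measurable_maxr => //; exact: measurable_cst.
apply/funext => w; rewrite state_rcons [state _ _ _ a]surjective_pairing stE//.
Qed.

Lemma measurable_face (U : {set 'I_K}) i0 a i : i0 \in U -> past_measurable a ->
  measurable_fun setT (fun w => @face R K T B theta (env w) U a i).
Proof.
move=> i0U /measurable_state [mL mS].
apply: (measurable_sol B0 i0U) => //.
  by move=> w k; have [_ S0 _] := state_bounds B8 theta0 T1 (env01 w) a; exact: lrate_gt0.
exact: measurable_lrate.
Qed.

Lemma measurable_kern a i : past_measurable a ->
  measurable_fun setT (fun w => @kern R K T B theta (env w) a i).
Proof.
move=> pm; have K0 : (0 < K)%N by case: i => k; case: (K).
rewrite (_ : (fun w => _) = fun w => @face R K T B theta (env w) [set: 'I_K]%SET a i).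
  by apply: (@measurable_face _ i) => //; rewrite finset.in_setT.
by apply/funext => w; rewrite kernE.
Qed.

End State.

End Measurability.

(** * Integration and conditional expectation *)

Section Integration.
Context {R : realType} {d : measure_display} {Om : measurableType d}.
Variable P : probability Om R.
Implicit Types f g : Om -> R.

Local Notation intble f := (P.-integrable setT (EFin \o f)).

Definition bounded_measurable f :=
  measurable_fun setT f /\ exists M : R, forall w, `|f w| <= M.

Lemma bmf_cst (c : R) : bounded_measurable (fun=> c).
Proof. by split; [exact: measurable_cst|exists `|c|]. Qed.

Lemma bmfM f g : bounded_measurable f -> bounded_measurable g ->
  bounded_measurable (fun w => f w * g w).
Proof.
move=> [mf [M Mf]] [mg [N Ng]]; split; first exact: measurable_funM.
by exists (M * N) => w; rewrite normrM ler_pM.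
Qed.

Lemma bmfB f g : bounded_measurable f -> bounded_measurable g ->
  bounded_measurable (fun w => f w - g w).
Proof.
move=> [mf [M Mf]] [mg [N Ng]]; split; first exact: measurable_funB.
by exists (M + N) => w; apply: (le_trans (ler_normB _ _)); rewrite lerD.
Qed.

Lemma bmf_prod (I : eqType) (s : seq I) (h : I -> Om -> R) :
  (forall i, i \in s -> bounded_measurable (h i)) ->
  bounded_measurable (fun w => \prod_(i <- s) h i w).
Proof.
elim: s => [_|x s IH hs].
  by under eq_fun do rewrite big_nil; exact: bmf_cst.
under eq_fun do rewrite big_cons; apply: bmfM.
  by apply: hs; rewrite mem_head.
by apply: IH => i si; apply: hs; rewrite inE si orbT.
Qed.

Lemma bmf_unit f : (forall w, 0 <= f w <= 1) -> measurable_fun setT f ->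
  bounded_measurable f.
Proof.
move=> f01 mf; split=> //; exists 1 => w.
by have /andP[f0 f1] := f01 w; rewrite ger0_norm.
Qed.

Lemma bmf_bounded f : bounded_measurable f -> [bounded f w | w in setT].
Proof.
move=> [_ [M Mf]]; exists M; rewrite num_real; split=> // x Mx w _ /=.
exact: le_trans (Mf w) (ltW Mx).
Qed.

Lemma bmf_intble f : bounded_measurable f -> intble f.
Proof.
move=> bf; apply: measurable_bounded_integrable => //.
- by apply: (le_lt_trans (probability_le1 P measurableT)); exact: ltry.
- by case: bf.
- exact: bmf_bounded.
Qed.

Lemma intbleM f g : bounded_measurable f -> intble g -> intble (fun w => f w * g w).
Proof.
move=> bf ig; have := integrableMr measurableT (proj1 bf) (bmf_bounded bf) ig.
by apply: eq_integrable.
Qed.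

Lemma intbleD f g : intble f -> intble g -> intble (fun w => f w + g w).
Proof. by move=> hf hg; have := integrableD measurableT hf hg; apply: eq_integrable. Qed.

Lemma intbleB f g : intble f -> intble g -> intble (fun w => f w - g w).
Proof. by move=> hf hg; have := integrableB measurableT hf hg; apply: eq_integrable. Qed.

Lemma intbleZ (c : R) f : intble f -> intble (fun w => c * f w).
Proof. by move=> hf; apply: intbleM => //; exact: bmf_cst. Qed.

Lemma intble_sum (I : Type) (s : seq I) (Q : pred I) (h : I -> Om -> R) :
  (forall i, Q i -> intble (h i)) -> intble (fun w => \sum_(i <- s | Q i) h i w).
Proof.
move=> hs; have := integrable_sum measurableT s hs.
by apply: eq_integrable => // w _ /=; rewrite sumEFin.
Qed.

Lemma Rintegral_sum (I : Type) (s : seq I) (Q : pred I) (h : I -> Om -> R) :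
  (forall i, Q i -> intble (h i)) ->
  \int[P]_w (\sum_(i <- s | Q i) h i w) = \sum_(i <- s | Q i) \int[P]_w h i w.
Proof.
move=> hs; elim: s => [|i s IH].
  under eq_Rintegral do rewrite big_nil.
  by rewrite big_nil Rintegral_cst// mul0r.
rewrite big_cons -IH; case: ifPn => Qi; last first.
  by apply: eq_Rintegral => w _; rewrite big_cons (negbTE Qi).
rewrite -RintegralD//; [|exact: hs|exact: intble_sum].
by apply: eq_Rintegral => w _; rewrite big_cons Qi.
Qed.

Lemma Rintegral_prob_cst (c : R) : \int[P]_w c = c.
Proof.
rewrite Rintegral_cst// -[RHS]mulr1; congr (_ * _).
by rewrite (_ : _ setT = 1%E)//; exact: probability_setT.
Qed.

End Integration.

Section Discretization.
Context {R : realType}.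

Lemma count_le_bounds (x : R) N : 0 <= x -> x <= N%:R ->
  x - 1 <= \sum_(1 <= k < N.+1) (k%:R <= x :> R)%R%:R <= x.
Proof.
move=> x0; suff H : (N%:R <= x -> \sum_(1 <= k < N.+1) (k%:R <= x :> R)%R%:R = N%:R :> R) /\
  (x <= N%:R -> x - 1 <= \sum_(1 <= k < N.+1) (k%:R <= x :> R)%R%:R <= x) by case: H.
elim: N => [|N [IH1 IH2]].
  rewrite big_geq//; split=> // x0'; have -> : x = 0 by lra.
  by rewrite sub0r lexx lerN10.
rewrite big_nat_recr//=; split=> [Nx|xN].
  have Nx' : N%:R <= x by apply: le_trans Nx; rewrite ler_nat.
  by rewrite IH1// Nx natr1.
have [xN'|Nx] := leP x N%:R.
  have /negbTE-> : ~~ (N.+1%:R <= x).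
    by rewrite -ltNge; apply: (le_lt_trans xN'); rewrite ltr_nat.
  by rewrite addr0; exact: IH2.
rewrite IH1 ?(ltW Nx)//; rewrite -natr1 in xN *.
by case: (leP (N%:R + 1) x) => h /=; apply/andP; split; rewrite ?mulr1n ?mulr0n; lra.
Qed.

End Discretization.

Section PullOut.
Context {R : realType} {d : measure_display} {Om : measurableType d}.
Variable P : probability Om R.

Local Notation intble f := (P.-integrable setT (EFin \o f)).

(* [Z] is approximated within [1/N] by the average of the indicators of
   [Z >= k/N], [1 <= k <= N]. *)
Lemma Rintegral_mul_eq0 (Z Y : Om -> R) :
  (forall w, 0 <= Z w <= 1) -> measurable_fun setT Z -> intble Y ->
  (forall c, \int[P]_(w in [set w | c <= Z w]) Y w = 0) ->
  \int[P]_w (Z w * Y w) = 0.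
Proof.
move=> Z01 mZ iY h.
have mA c : measurable [set w | c <= Z w].
  rewrite (_ : [set w | _] = ~` [set w | Z w < c]); last first.
    by apply/seteqP; split=> w /=; rewrite leNgt => /negP.
  by apply/measurableC/measurable_lt_set => //; exact: measurable_cst.
have iZY : intble (fun w => Z w * Y w) by apply: intbleM => //; exact: bmf_unit.
apply/eqP; rewrite -normr_le0; apply: (@le_of_le_add_div _ _ _ (\int[P]_w `|Y w|)) => N.
rewrite add0r; have N0 : 0 < N.+1%:R :> R by rewrite ltr0n.
pose ZN w : R := N.+1%:R^-1 * \sum_(1 <= k < N.+2) (k%:R <= N.+1%:R * Z w :> R)%R%:R.
have E k w : ((k%:R <= N.+1%:R * Z w :> R)%R%:R * Y w : R) =
    (Y \_ [set w | k%:R / N.+1%:R <= Z w]) w.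
  rewrite patchE; case: ifPn; rewrite ?inE/= ?notin_setE/= ler_pdivrMr// mulrC.
    by move=> ->; rewrite mul1r.
  by move=> /negP/negbTE->; rewrite mul0r.
have iE k : intble (Y \_ [set w | k%:R / N.+1%:R <= Z w]).
  have := (integrable_mkcond (EFin \o Y) (mA (k%:R / N.+1%:R))).1.
  rewrite restrict_EFin; apply; apply: integrableS iY => //.
have ZNY w : ZN w * Y w = N.+1%:R^-1 * \sum_(1 <= k < N.+2) (Y \_ [set w | k%:R / N.+1%:R <= Z w]) w.
  by rewrite /ZN -mulrA mulr_suml; congr (_ * _); apply: eq_bigr => k _; exact: E.
have iS : intble (fun w => \sum_(1 <= k < N.+2) (Y \_ [set w | k%:R / N.+1%:R <= Z w]) w).
  by apply: intble_sum.
have iZN : intble (fun w => ZN w * Y w).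
  by under eq_fun do rewrite ZNY; exact: intbleZ.
have ZN0 : \int[P]_w (ZN w * Y w) = 0.
  under eq_Rintegral do rewrite ZNY.
  rewrite RintegralZl// Rintegral_sum// big1 ?mulr0// => k _.
  by rewrite -Rintegral_mkcond h.
rewrite -[X in `|X|]subr0 -ZN0 -RintegralB//.
have iB := intbleB iZY iZN.
apply: (le_trans (le_normr_Rintegral measurableT iB)).
rewrite mulrC -RintegralZl//; last exact: integrable_norm.
apply: le_Rintegral => //; first exact: integrable_norm.
  by apply: intbleZ; exact: integrable_norm.
move=> w _; rewrite -mulrBl normrM ler_wpM2r//.
have [Z0 Z1] := andP (Z01 w).
have /andP[c1 c2] : N.+1%:R * Z w - 1 <= \sum_(1 <= k < N.+2) (k%:R <= N.+1%:R * Z w :> R)%R%:R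
    <= N.+1%:R * Z w.
  by apply: count_le_bounds; rewrite ?mulr_ge0 ?ler_piMr// ltW.
rewrite /ZN -(@ler_pM2l _ N.+1%:R)// mulfV ?gt_eqF// -[X in X * `|_|]gtr0_norm// -normrM.
rewrite mulrBr mulrA mulfV ?gt_eqF// mul1r ler_norml; lra.
Qed.

End PullOut.

(** * Averaging over the environment *)

Section Environment.
Context {R : realType} {d : measure_display} {Om : measurableType d}.
Variable P : probability Om R.
Variables (K T : nat) (B theta : R).
Hypotheses (B8 : 8 <= B) (theta0 : 0 < theta) (theta2 : theta <= 2) (T1 : (1 < T)%N).
Variable env : Om -> nat -> seq 'I_K -> 'I_K -> R.
Hypothesis env01 : forall w t a i, 0 <= env w t a i <= 1.
Hypothesis menv : forall t a i, measurable_fun setT (fun w => env w t a i).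
Variable i0 : 'I_K.

Local Notation intble f := (P.-integrable setT (EFin \o f)).
Local Notation kernw w := (@kern R K T B theta (env w)).
Local Notation facew w := (@face R K T B theta (env w)).
Local Notation full := [set: 'I_K]%SET.

Let K0 : (0 < K)%N. Proof. by case: i0 => k; case: (K). Qed.
Let iT i : i \in full. Proof. by rewrite finset.in_setT. Qed.

Let kern_pos w a i : (size a < T)%N -> 0 <= kernw w a i.
Proof. by move=> _; exact: kern_ge0. Qed.

Let kern_tot w a : (size a < T)%N -> \sum_i kernw w a i = 1.
Proof. by move=> _; exact: kern_sum. Qed.

Lemma face_le1 w (U : {set 'I_K}) j a i : j \in U -> facew w U a i <= 1.
Proof.
move=> jU; rewrite -(face_sum B8 theta0 T1 (env01 w) a jU) (bigD1 i)//= lerDl.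
by apply: sumr_ge0 => k _; exact: face_ge0.
Qed.

Lemma face_unit w (U : {set 'I_K}) j a i : j \in U -> 0 <= facew w U a i <= 1.
Proof. by move=> jU; rewrite face_ge0//= (face_le1 _ _ _ jU). Qed.

Lemma kern_unit w a i : 0 <= kernw w a i <= 1.
Proof. by rewrite kernE// (face_unit _ _ _ (iT i)). Qed.

Lemma bmf_face (U : {set 'I_K}) j a i : j \in U ->
  bounded_measurable (fun w => facew w U a i).
Proof.
move=> jU; apply: bmf_unit => [w|]; first exact: face_unit jU.
by apply: (measurable_face B8 theta0 T1 env01 _ jU) => k l _; exact: menv.
Qed.

Lemma bmf_kern a i : bounded_measurable (fun w => kernw w a i).
Proof.
apply: bmf_unit => [w|]; first exact: kern_unit.
by apply: measurable_kern => // k l _; exact: menv.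
Qed.

Lemma bmf_env t a i : bounded_measurable (fun w => env w t a i).
Proof. by apply: bmf_unit. Qed.

Definition weight w k (s : k.-tuple 'I_K) : R :=
  \prod_(t < k) kernw w (take t s) (tnth s t).

Lemma weight_unit w k (s : k.-tuple 'I_K) : 0 <= weight w s <= 1.
Proof.
rewrite prodr_ge0 /=; last by move=> t _; case/andP: (kern_unit w (take t s) (tnth s t)).
by apply: prodr_ile1 => t _; exact: kern_unit.
Qed.

Lemma bmf_weight k (s : k.-tuple 'I_K) : bounded_measurable (fun w => weight w s).
Proof. by apply: bmf_prod => t _; exact: bmf_kern. Qed.

Lemma intble_seqE k (H : Om -> seq 'I_K -> R) :
  (forall a, size a = k -> intble (fun w => H w a)) ->
  intble (fun w => seqE (kernw w) k (H w)).
Proof.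
move=> iH; under eq_fun do rewrite -seqE_tuple.
apply: intble_sum => s _; apply: intbleM; first exact: bmf_weight.
by apply: iH; rewrite size_tuple.
Qed.

Lemma Rintegral_seqE k (H : Om -> seq 'I_K -> R) :
  (forall a, size a = k -> intble (fun w => H w a)) ->
  \int[P]_w seqE (kernw w) k (H w) =
  \sum_(s : k.-tuple 'I_K) \int[P]_w (weight w s * H w s).
Proof.
move=> iH; under eq_Rintegral do rewrite -seqE_tuple.
apply: Rintegral_sum => s _; apply: intbleM; first exact: bmf_weight.
by apply: iH; rewrite size_tuple.
Qed.

Definition expected_rounds (H : Om -> nat -> seq 'I_K -> R) : R :=
  \int[P]_w \sum_(t < T) seqE (kernw w) t (H w t).

Local Notation ER := expected_rounds.

Definition round_intble (H : Om -> nat -> seq 'I_K -> R) :=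
  forall t a, (t < T)%N -> size a = t -> intble (fun w => H w t a).

Lemma intble_rounds H : round_intble H ->
  intble (fun w => \sum_(t < T) seqE (kernw w) t (H w t)).
Proof. by move=> iH; apply: intble_sum => t _; apply: intble_seqE => a /iH; exact. Qed.

Lemma ER_le H1 H2 : round_intble H1 -> round_intble H2 ->
  (forall w t a, (t < T)%N -> size a = t -> H1 w t a <= H2 w t a) -> ER H1 <= ER H2.
Proof.
move=> i1 i2 h; apply: le_Rintegral => //; [exact: intble_rounds|exact: intble_rounds|].
move=> w _; apply: ler_sum => t _; apply: (seqE_le (@kern_pos w)); first exact: ltnW.
by move=> a at_; exact: h.
Qed.

Lemma eq_ER H1 H2 :
  (forall w t a, (t < T)%N -> size a = t -> H1 w t a = H2 w t a) -> ER H1 = ER H2.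
Proof.
move=> h; apply: eq_Rintegral => w _; apply: eq_bigr => t _.
by apply: eq_seqE => a at_; exact: h.
Qed.

Lemma ERD H1 H2 : round_intble H1 -> round_intble H2 ->
  ER (fun w t a => H1 w t a + H2 w t a) = ER H1 + ER H2.
Proof.
move=> i1 i2; rewrite /ER -RintegralD//; [|exact: intble_rounds|exact: intble_rounds].
apply: eq_Rintegral => w _; rewrite -big_split/=; apply: eq_bigr => t _.
exact: seqED.
Qed.

Lemma ERZ c H : round_intble H -> ER (fun w t a => c * H w t a) = c * ER H.
Proof.
move=> iH; rewrite /ER -RintegralZl//; last exact: intble_rounds.
apply: eq_Rintegral => w _; rewrite mulr_sumr; apply: eq_bigr => t _.
exact: seqEZ.
Qed.

Lemma ER_sum (J : finType) (Q : pred J) (H : J -> Om -> nat -> seq 'I_K -> R) :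
  (forall j, round_intble (H j)) ->
  ER (fun w t a => \sum_(j | Q j) H j w t a) = \sum_(j | Q j) ER (H j).
Proof.
move=> iH; rewrite /ER -Rintegral_sum => [|j _]; last exact: intble_rounds.
apply: eq_Rintegral => w _; rewrite exchange_big/=; apply: eq_bigr => t _.
exact: seqE_sum.
Qed.

Lemma round_intble_bmf H : (forall t a, bounded_measurable (fun w => H w t a)) ->
  round_intble H.
Proof. by move=> bH t a _ _; exact: bmf_intble. Qed.

Lemma EalgE (H : Om -> nat -> seq 'I_K -> R) :
  Ealg P theta 1 B env (fun w (s : T.-tuple 'I_K) => \sum_(t < T) H w t (take t s)) = ER H.
Proof.
apply: eq_Rintegral => w _.
rewrite [LHS](_ : _ = seqE (kernw w) T (fun s => \sum_(t < T) H w t (take t s))); last first.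
  by rewrite -seqE_tuple.
rewrite seqE_sum; apply: eq_bigr => t _.
by rewrite (seqE_take (@kern_tot w) (H w t))// leqnn ltnW.
Qed.

Lemma Ealg_playedE (H : Om -> nat -> seq 'I_K -> 'I_K -> R) :
  Ealg P theta 1 B env
    (fun w (s : T.-tuple 'I_K) => \sum_(t < T) H w t (take t s) (tnth s t)) =
  ER (fun w t a => \sum_i kernw w a i * H w t a i).
Proof.
apply: eq_Rintegral => w _.
(* The default [i0] is never reached: [t] is below the length of every sequence concerned. *)
pose G t c := H w t (take t c) (nth i0 c t).
rewrite [LHS](_ : _ = seqE (kernw w) T (fun s => \sum_(t < T) G t s)); last first.
  rewrite -seqE_tuple; apply: eq_bigr => s _; congr (_ * _).
  by apply: eq_bigr => t _; rewrite /G (tnth_nth i0).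
rewrite seqE_sum; apply: eq_bigr => t _.
transitivity (seqE (kernw w) T (fun s => G t (take t.+1 s))).
  by apply: eq_seqE => a aT; rewrite /G nth_take// take_takel.
transitivity (seqE (kernw w) t.+1 (G t)).
  by rewrite (@seqE_take _ _ _ T (@kern_tot w) t.+1 T (G t))// leqnn andbT.
rewrite /=; apply: eq_seqE => a at_; apply: eq_bigr => i _; congr (_ * _).
by rewrite /G nth_rcons at_ ltnn eqxx -cats1 take_size_cat.
Qed.

Definition expected_pulls j : R := ER (fun w t a => kernw w a j).

Local Notation EP := expected_pulls.

Lemma EP_ge0 j : 0 <= EP j.
Proof.
apply: Rintegral_ge0 => w _; apply: sumr_ge0 => t _.
rewrite -seqE_tuple; apply: sumr_ge0 => s _; rewrite mulr_ge0//.
  by case/andP: (weight_unit w s).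
by case/andP: (kern_unit w s j).
Qed.

Lemma EP_sum : \sum_j EP j = T%:R.
Proof.
rewrite -ER_sum => [|j]; last by apply: round_intble_bmf => t a; exact: bmf_kern.
rewrite /ER -[RHS](Rintegral_prob_cst P); apply: eq_Rintegral => w _.
rewrite (eq_bigr (fun=> 1)) => [|t _]; first by rewrite sumr_const card_ord.
rewrite -(seqE_cst (@kern_tot w) 1 (ltnW (ltn_ord t))).
by apply: eq_seqE => a at_; rewrite kern_tot ?at_.
Qed.

Lemma gap_termE (D : 'I_K -> R) :
  @gap_term R K T d Om P theta 1 B env D = \sum_j D j * EP j.
Proof.
rewrite /gap_term (EalgE (fun w t a => \sum_i kernw w a i * D i)).
have ik j : round_intble (fun w t a => kernw w a j).
  by apply: round_intble_bmf => t a; exact: bmf_kern.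
rewrite ER_sum => [|j]; last first.
  by apply: round_intble_bmf => t a; apply: bmfM; [exact: bmf_kern|exact: bmf_cst].
apply: eq_bigr => j _; rewrite -ERZ//.
by apply: eq_ER => w t a _ _; rewrite mulrC.
Qed.

Definition face_regret (U : {set 'I_K}) istar : R :=
  ER (fun w t a => \sum_i facew w U a i * (env w t a i - env w t a istar)).

Lemma regret_split (U : {set 'I_K}) j istar : j \in U ->
  @pseudo_regret R K T d Om P theta 1 B env istar =
  ER (fun w t a => \sum_i (kernw w a i - facew w U a i) * env w t a i)
  + face_regret U istar.
Proof.
move=> jU; rewrite /pseudo_regret /loss_alg /loss_arm.
rewrite (Ealg_playedE (fun w t a i => env w t a i)) (EalgE (fun w t a => env w t a istar)).
have i1 : round_intble (fun w t a => \sum_i kernw w a i * env w t a i).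
  move=> t a _ _; apply: intble_sum => i _; apply/bmf_intble/bmfM.
    exact: bmf_kern.
  exact: bmf_env.
have i2 : round_intble (fun w t a => env w t a istar).
  by apply: round_intble_bmf => t a; exact: bmf_env.
have i3 : round_intble (fun w t a => \sum_i (kernw w a i - facew w U a i) * env w t a i).
  move=> t a _ _; apply: intble_sum => i _; apply/bmf_intble/bmfM; last exact: bmf_env.
  by apply: bmfB; [exact: bmf_kern|exact: bmf_face jU].
have i4 : round_intble
    (fun w t a => \sum_i facew w U a i * (env w t a i - env w t a istar)).
  move=> t a _ _; apply: intble_sum => i _; apply/bmf_intble/bmfM.
    exact: bmf_face jU.
  by apply: bmfB; exact: bmf_env.
rewrite -mulN1r -ERZ// -ERD//; last first.
  by move=> t a tT at_; apply: intbleZ; exact: i2.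
rewrite /face_regret -ERD//; apply: eq_ER => w t a _ _.
rewrite -big_split/= mulN1r.
rewrite [RHS](eq_bigr (fun i => kernw w a i * env w t a i - facew w U a i * env w t a istar)).
  by rewrite sumrB -mulr_suml (face_sum B8 theta0 T1 (env01 w) a jU) mul1r.
by move=> i _; ring.
Qed.

Section Comparison.
Variables (U : {set 'I_K}) (j0 : 'I_K).
Hypothesis j0U : j0 \in U.
Variables (b : 'I_K -> R) (bU : R).
Hypotheses (b0 : forall j, 0 < b j) (bU0 : 0 < bU).

Lemma regret_bound istar :
  @pseudo_regret R K T d Om P theta 1 B env istar <=
  @leading R T theta * (\sum_(j | j \notin U) b j * (EP j + 1)
    + bU * (\sum_(j | j \notin U) EP j + 1)
    + \sum_j ln (1 + T%:R ^+ 2) / (4 * stepsize U b bU j))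
  + @boundary_cost R K T B theta + face_regret U istar.
Proof.
rewrite (regret_split _ j0U) lerD2r.
pose pw w j := @pulls R K T B theta (env w) j.
have ipw j : intble (fun w => pw w j).
  apply: (@intble_rounds (fun w t a => kernw w a j)).
  by apply: round_intble_bmf => t a; exact: bmf_kern.
have icst c : intble (fun=> c) by apply/bmf_intble/bmf_cst.
have EPE j : EP j = \int[P]_w pw w j by [].
have ib : intble (fun w => \sum_(j | j \notin U) b j * (pw w j + 1)).
  by apply: intble_sum => j _; apply: intbleZ; apply: intbleD.
have ibU : intble (fun w => bU * (\sum_(j | j \notin U) pw w j + 1)).
  by apply: intbleZ; apply: intbleD => //; apply: intble_sum.
set c1 := \sum_j ln (1 + T%:R ^+ 2) / (4 * stepsize U b bU j).
have E1 : \int[P]_w (\sum_(j | j \notin U) b j * (pw w j + 1)) =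
    \sum_(j | j \notin U) b j * (EP j + 1).
  rewrite Rintegral_sum => [|j _]; last by apply: intbleZ; apply: intbleD.
  apply: eq_bigr => j _; rewrite RintegralZl//; last by apply: intbleD.
  by rewrite RintegralD// Rintegral_prob_cst.
have E2 : \int[P]_w (bU * (\sum_(j | j \notin U) pw w j + 1)) =
    bU * (\sum_(j | j \notin U) EP j + 1).
  have is_ : intble (fun w => \sum_(j | j \notin U) pw w j) by apply: intble_sum.
  rewrite RintegralZl//; last by apply: intbleD.
  by rewrite RintegralD// Rintegral_prob_cst Rintegral_sum.
have i12 := intbleD ib ibU; have i123 := intbleD i12 (icst c1).
have i1234 := intbleZ (@leading R T theta) i123.
rewrite -E1 -E2 -[X in _ * (_ + X)](Rintegral_prob_cst P).
rewrite -(RintegralD _ ib ibU)// -(RintegralD _ i12 (icst c1))// -RintegralZl//.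
rewrite -[X in _ <= _ + X](Rintegral_prob_cst P) -RintegralD//.
apply: le_Rintegral => //.
- apply: (@intble_rounds (fun w t a => \sum_i (kernw w a i - facew w U a i) * env w t a i)).
  move=> t a _ _; apply: intble_sum => i _.
  apply/bmf_intble/bmfM; last exact: bmf_env.
  by apply: bmfB; [exact: bmf_kern|exact: bmf_face j0U].
- by apply: intbleD.
move=> w _; exact: (trajectory_bound B8 theta0 theta2 T1 (env01 w) j0U b0 bU0).
Qed.

End Comparison.

End Environment.

(** * Conditional expectations and the regret of the face iterate *)

Section ConditionalExpectation.
Context {R : realType} {d : measure_display} {Om : measurableType d}.
Variable P : probability Om R.

Local Notation intble f := (P.-integrable setT (EFin \o f)).

Lemma intble_max (f g : Om -> R) : intble f -> intble g ->
  intble (fun w => Num.max (f w) (g w)).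
Proof.
move=> jf jg; have jn := integrable_norm (intbleB jf jg).
have := intbleZ (2^-1 : R) (intbleD (intbleD jf jg) jn).
by apply: eq_integrable => // w _ /=; rewrite maxr_absE mulrC.
Qed.

Lemma intble_bigmax (I : Type) (s : seq I) (Q : pred I) (x0 : Om -> R) (h : I -> Om -> R) :
  intble x0 -> (forall i, Q i -> intble (h i)) ->
  intble (fun w => \big[Num.max/x0 w]_(i <- s | Q i) h i w).
Proof.
move=> j0 jh; elim: s => [|i s IH].
  by under eq_fun do rewrite big_nil.
under eq_fun do rewrite big_cons.
case Qi: (Q i) => //; by apply: intble_max => //; exact: jh.
Qed.

(** The defining identity is invoked on the level sets [c <= Z] only: there [X - g] integrates to
    zero, and [Rintegral_mul_eq0] passes from level sets to [Z]. *)
Lemma cond_exp_pull_out (G : set (set Om)) (X g Z : Om -> R) :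
  G `<=` measurable -> (forall c, G [set w | c <= Z w]) ->
  measurable_fun setT Z -> (forall w, 0 <= Z w <= 1) ->
  intble X -> is_cond_exp P G X g ->
  \int[P]_w (Z w * X w) = \int[P]_w (Z w * g w).
Proof.
move=> GM GZ mZ Z01 jX [_ jg Gg]; have bZ := bmf_unit Z01 mZ.
apply/eqP; rewrite -subr_eq0 -RintegralB//; [|exact: intbleM|exact: intbleM].
under eq_Rintegral do rewrite -mulrBr.
apply/eqP; apply: (@Rintegral_mul_eq0 _ _ _ P Z (fun w => X w - g w)) => //.
  exact: intbleB.
move=> c; have mA := GM _ (GZ c).
rewrite RintegralB//; [|exact: integrableS jX|exact: integrableS jg].
by rewrite /Rintegral (Gg _ (GZ c)) subrr.
Qed.

Variables (K T : nat) (B theta : R).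
Hypotheses (B8 : 8 <= B) (theta0 : 0 < theta) (theta2 : theta <= 2) (T1 : (1 < T)%N).
Variable env : Om -> nat -> seq 'I_K -> 'I_K -> R.
Hypothesis env01 : forall w t a i, 0 <= env w t a i <= 1.
Hypothesis menv : forall t a i, measurable_fun setT (fun w => env w t a i).
Variable i0 : 'I_K.

Local Notation ER := (@expected_rounds R d Om P K T B theta env).
Local Notation facew w := (@face R K T B theta (env w)).

Lemma hist_sigma_sub t a : hist_sigma env t a `<=` measurable.
Proof.
apply: smallest_sub; first exact: sigma_algebra_measurable.
move=> A [j [i [C [_ [mC ->]]]]].
by rewrite -[X in measurable X]setTI; exact: menv.
Qed.

Lemma hist_past_measurable t (a : seq 'I_K) k : size a = t ->
  past_measurable (Om := g_sigma_algebraType (hist_sets env t a)) env (take k a).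
Proof.
move=> at_ j i; rewrite size_take_min => jk mT Y mY; rewrite setTI.
have [jk' jt] : (j < k)%N /\ (j < t)%N by move: jk; rewrite leq_min at_ => /andP.
rewrite take_takel ?(ltnW jk')//.
by apply: sub_sigma_algebra; exists j, i, Y.
Qed.

Lemma hist_sigma_ge t (a : seq 'I_K) (Z : Om -> R) c :
  measurable_fun (T := g_sigma_algebraType (hist_sets env t a)) setT Z ->
  hist_sigma env t a [set w | c <= Z w].
Proof.
move=> mZ; have := mZ measurableT _ (@measurable_itv R `[c, +oo[).
rewrite setTI (_ : _ @^-1` _ = [set w | c <= Z w])//.
by apply/seteqP; split=> w /=; rewrite in_itv/= andbT.
Qed.

Section Regret.
Variables (istar : 'I_K) (g : nat -> seq 'I_K -> 'I_K -> Om -> R).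
Hypothesis gP : forall (t : nat) (a : seq 'I_K) (i : 'I_K), (t < T)%N -> size a = t ->
  is_cond_exp P (hist_sigma env t a) (fun w => env w t a i - env w t a istar) (g t a i).

Lemma intble_cond t a i : (t < T)%N -> size a = t -> intble (g t a i).
Proof. by move=> tT at_; case: (gP i tT at_). Qed.

(** Done for one action prefix at a time: the probability of the prefix depends on the environment
    too, but only through past losses, so its product with [q] is history-measurable and can be
    pulled out. *)
Lemma ER_cond_exp (q : Om -> seq 'I_K -> R) i :
  (forall w a, 0 <= q w a <= 1) ->
  (forall a, measurable_fun setT (fun w => q w a)) ->
  (forall t a, size a = t ->
    measurable_fun (T := g_sigma_algebraType (hist_sets env t a)) setT (fun w => q w a)) ->
  ER (fun w t a => q w a * (env w t a i - env w t a istar)) =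
  ER (fun w t a => q w a * g t a i w).
Proof.
move=> q01 mq hq.
have bq a : bounded_measurable (fun w => q w a) by apply: bmf_unit.
have bX t a : bounded_measurable (fun w => env w t a i - env w t a istar).
  by apply: bmfB; exact: bmf_env.
have jX t a : intble (fun w => env w t a i - env w t a istar) by exact: bmf_intble.
rewrite /expected_rounds Rintegral_sum => [|t _]; last first.
  by apply: (intble_seqE B8 theta0 T1 env01 menv i0) => a _; exact: intbleM.
rewrite Rintegral_sum => [|t _]; last first.
  apply: (intble_seqE B8 theta0 T1 env01 menv i0) => a at_; apply: intbleM => //.
  exact: intble_cond.
apply: eq_bigr => t _.
rewrite !(Rintegral_seqE B8 theta0 T1 env01 menv i0); first last.
- by move=> a _; exact: intbleM.
- by move=> a at_; apply: intbleM => //; exact: intble_cond.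
apply: eq_bigr => s _.
under eq_Rintegral do rewrite mulrA.
under [in RHS]eq_Rintegral do rewrite mulrA.
have st := size_tuple s.
have bW := bmf_weight B8 theta0 T1 env01 menv i0 s.
apply: (@cond_exp_pull_out (hist_sigma env t s)).
- exact: hist_sigma_sub.
- move=> c; apply: hist_sigma_ge; apply: measurable_funM; last exact: hq.
  apply: measurable_prod => k _.
  apply: (@measurable_kern R _ (g_sigma_algebraType (hist_sets env t s)) K T B theta) => //.
  exact: hist_past_measurable.
- by apply: measurable_funM => //; case: bW.
- move=> w; have /andP[W0 W1] := weight_unit B8 theta0 T1 env01 i0 w s.
  by have /andP[q0 q1] := q01 w s; rewrite mulr_ge0//= mulr_ile1.
- exact: jX.
- exact: gP.
Qed.

Variable Delta : 'I_K -> R.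

Local Notation U := [set i | Delta i == 0]%SET.

Lemma maxU_ge (x : 'I_K -> R) i : Delta i = 0 -> x i <= maxU Delta x.
Proof.
move=> Di; rewrite /maxU; case: pickP => [j _|/(_ i)]; last by rewrite Di eqxx.
by apply: (le_bigmax_cond (x j) (fun k => x k)); rewrite Di.
Qed.

Lemma intble_maxU (h : 'I_K -> Om -> R) : (forall i, intble (h i)) ->
  intble (fun w => maxU Delta (fun i => h i w)).
Proof.
move=> jh; rewrite /maxU; case: pickP => [j _|_]; last exact/bmf_intble/bmf_cst.
exact: intble_bigmax.
Qed.

Let max_regret : R := ER (fun w t a => maxU Delta (fun i => g t a i w)).

Let round_maxU : round_intble P T (fun w t a => maxU Delta (fun i => g t a i w)).
Proof. by move=> t a tT at_; apply: intble_maxU => i; exact: intble_cond. Qed.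

Let round_face j k : j \in U ->
  round_intble P T (fun w t a => facew w U a k * g t a k w).
Proof.
move=> jU t a tT at_; apply: intbleM; last exact: intble_cond.
exact: (bmf_face B8 theta0 T1 env01 menv a k jU).
Qed.

(** After pull-out each round is an average of conditional excess losses over arms of [U], hence at
    most their maximum. *)
Lemma face_regret_le j : j \in U ->
  @face_regret R d Om P K T B theta env U istar <= max_regret.
Proof.
move=> jU; rewrite /face_regret (ER_sum B8 theta0 T1 env01 menv i0); last first.
  move=> k t a _ _; apply/bmf_intble/bmfM.
    exact: (bmf_face B8 theta0 T1 env01 menv a k jU).
  by apply: bmfB; exact: bmf_env.
rewrite (eq_bigr (fun k => ER (fun w t a => facew w U a k * g t a k w))); last first.
  move=> k _; apply: (ER_cond_exp (q := fun w a => facew w U a k)).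
  - by move=> w a; exact: (face_unit B8 theta0 T1 env01 w a k jU).
  - by move=> a; case: (bmf_face B8 theta0 T1 env01 menv a k jU).
  - move=> t a at_.
    apply: (@measurable_face R _ (g_sigma_algebraType (hist_sets env t a)) K T B theta
      B8 theta0 T1 env env01 U j a k jU).
    by rewrite -[X in past_measurable _ X](@take_oversize _ t) ?at_//; exact: hist_past_measurable.
rewrite -(ER_sum B8 theta0 T1 env01 menv i0); last by move=> k; exact: round_face jU.
apply: (ER_le B8 theta0 T1 env01 menv i0) => //.
  by move=> t a tT at_; apply: intble_sum => k _; exact: (round_face k jU).
move=> w t a _ _.
rewrite -[leRHS]mul1r -(face_sum B8 theta0 T1 (env01 w) a jU) mulr_suml.
apply: ler_sum => k _; have [kU|kU] := boolP (k \in U).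
  rewrite ler_wpM2l ?face_ge0//.
  by apply: (maxU_ge (fun i => g t a i w)); move: kU; rewrite inE => /eqP.
by rewrite face_out// !mul0r.
Qed.

(** Optimality of [istar] makes the excess loss of arm [j] nonnegative, and the maximum dominates
    it. This yields [0 <= D]. *)
Lemma max_regret_ge0 j : j \in U ->
  (forall i, loss_arm T P theta 1 B env istar <= loss_arm T P theta 1 B env i) ->
  0 <= max_regret.
Proof.
move=> jU /(_ j); rewrite -subr_ge0 => /le_trans; apply.
have jE i : round_intble P T (fun w t a => env w t a i).
  by apply: round_intble_bmf => t a; exact: bmf_env.
rewrite /loss_arm (EalgE P B8 theta0 T1 env01 i0 (fun w t a => env w t a j)).
rewrite (EalgE P B8 theta0 T1 env01 i0 (fun w t a => env w t a istar)).
rewrite -mulN1r -(ERZ B8 theta0 T1 env01 menv i0)// -(ERD B8 theta0 T1 env01 menv i0)//; last by move=> t a tT at_; apply: intbleZ; exact: jE.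
have -> : ER (fun w t a => env w t a j + -1 * env w t a istar) =
    ER (fun w t a => 1 * (env w t a j - env w t a istar)).
  by apply: eq_ER => w t a _ _; rewrite mulN1r mul1r.
rewrite (ER_cond_exp (q := fun _ _ => 1))//; last first.
- by move=> w _; rewrite ler01 lexx.
apply: (ER_le B8 theta0 T1 env01 menv i0) => //.
  by move=> t a tT at_; under eq_fun do rewrite mul1r; exact: intble_cond.
move=> w t a _ _; rewrite mul1r; apply: (maxU_ge (fun i => g t a i w)).
by move: jU; rewrite inE => /eqP.
Qed.

End Regret.

End ConditionalExpectation.

(** * Tuning *)

Section Tuning.
Context {R : realType} {d : measure_display} {Om : measurableType d}.
Variable P : probability Om R.
Variables (K T : nat).
Hypotheses (K2 : (2 <= K)%N) (KT : (K <= T)%N).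

Local Notation n := (T%:R : R).
Local Notation lnT := (ln n).
Local Notation lnK := (ln K%:R : R).
Let theta : R := Num.sqrt (1 / lnT).
Let B : R := 162 * lnK.
Let s : R := Num.sqrt lnT.

Let T1 : (1 < T)%N. Proof. exact: leq_trans K2 KT. Qed.
Let n0 : 0 < n. Proof. by rewrite ltr0n ltnW. Qed.
Let kn : K%:R <= n. Proof. by rewrite ler_nat. Qed.
Let k2 : 2 <= K%:R :> R. Proof. by rewrite ler_nat. Qed.
Let n2 : 2 <= n. Proof. exact: le_trans kn. Qed.

Let ln_ge_half (x : R) : 2 <= x -> 2^-1 <= ln x.
Proof.
move=> x2; have x0 : 0 < x by lra.
have := @ln_le_subr1 R x^-1; rewrite invr_gt0 lnV ?posrE// => /(_ x0).
have : x^-1 <= 2^-1 by rewrite lef_pV2 ?posrE.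
lra.
Qed.

Let lnK2 : 2^-1 <= lnK. Proof. exact: ln_ge_half. Qed.
Let lnT2 : 2^-1 <= lnT. Proof. exact: ln_ge_half. Qed.
Let lnKT : lnK <= lnT. Proof. by rewrite ler_ln ?posrE//; have := k2; lra. Qed.
Let lnT0 : 0 < lnT. Proof. have := lnT2; lra. Qed.
Let s0 : 0 < s. Proof. by rewrite sqrtr_gt0. Qed.
Let ss : s ^+ 2 = lnT. Proof. by rewrite sqr_sqrtr// ltW. Qed.
Let s2 : 2^-1 <= s.
Proof.
rewrite -(@ler_pXn2r _ 2) ?nnegrE ?(ltW s0)// ss expr2.
have := lnT2; lra.
Qed.
Let thetaE : theta = s^-1. Proof. by rewrite /theta div1r sqrtrV// ltW. Qed.
Lemma tuned_rate_gt0 : 0 < theta. Proof. by rewrite thetaE invr_gt0. Qed.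
Let theta2 : theta <= 2.
Proof. by rewrite thetaE invf_ple ?posrE. Qed.
Lemma tuned_barrier_ge : 8 <= B. Proof. by rewrite /B; have := lnK2; lra. Qed.
Let theta0 : 0 < theta. Proof. exact: tuned_rate_gt0. Qed.
Let B8 : 8 <= B. Proof. exact: tuned_barrier_ge. Qed.

Let lnk_le : lnK <= K%:R.
Proof. by have := @ln_le_subr1 R K%:R; rewrite ltr0n ltnW// => /(_ isT); lra. Qed.

(** With [theta = 1 / s] the coefficient is [65 * s + 4 / s + 4 * s], and [1 / s <= 2 * s] because
    [ln T >= 1/2]. *)
Let leading_le : @leading R T theta <= 77 * s.
Proof.
have sV : s^-1 <= 2 * s.
  rewrite -[leLHS]mul1r ler_pdivrMr// -mulrA -expr2 ss.
  by have := lnT2; lra.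
rewrite /leading thetaE invrK -ss.
have -> : 4 * s^-1 * (1 + s ^+ 2) = 4 * s^-1 + 4 * s by field; rewrite gt_eqF.
lra.
Qed.

Let ln_sq_le : ln (1 + n ^+ 2) <= 3 * lnT.
Proof.
have p1 : 0 < 1 + n ^+ 2 by rewrite ltr_pwDl// exprn_ge0// ltW.
have p2 : 0 < n ^+ 3 by rewrite exprn_gt0.
rewrite mulr_natl -lnXn// ler_ln ?posrE//.
have : 1 <= n ^+ 2 by rewrite expr_ge1//; have := n2; lra.
by rewrite [n ^+ 3]exprS; have := n2; nra.
Qed.

(** The two barrier terms give 324 and 162. As both logarithms are at least 1/2, the [theta] terms,
    at most [10 * K], give 40, and the constant 1, at most [K / 2], gives 2. *)
Let boundary_le : @boundary_cost R K T B theta <= 528 * (K%:R * lnK * lnT).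
Proof.
have k0 : 0 < K%:R :> R by rewrite ltr0n ltnW.
have h1 : ln (n * K%:R) <= 2 * lnT.
  by rewrite lnM ?posrE//; have := lnKT; lra.
have a : 2^-1 * 2^-1 <= lnK * lnT by rewrite ler_pM// invr_ge0.
have X1 : K%:R / 4 <= K%:R * (lnK * lnT) by rewrite ler_pM2l//; lra.
have X2 : B * (K%:R * ln (n * K%:R)) <= 324 * (K%:R * (lnK * lnT)).
  rewrite /B [leRHS](_ : _ = 162 * lnK * (K%:R * (2 * lnT))); last by ring.
  rewrite ler_wpM2l ?mulr_ge0//; last by rewrite ler_pM2l.
  by have := lnK2; lra.
have X3 : B * (K%:R * lnK) <= 162 * (K%:R * (lnK * lnT)).
  rewrite /B [leRHS](_ : _ = 162 * lnK * (K%:R * lnT)); last by ring.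
  rewrite ler_wpM2l ?mulr_ge0//; last by rewrite ler_pM2l.
  by have := lnK2; lra.
have X4 : theta * K%:R <= 2 * K%:R by rewrite ler_pM2r.
have := k2; rewrite /boundary_cost -[X in _ <= _ * X]mulrA; lra.
Qed.

Variable env : Om -> nat -> seq 'I_K -> 'I_K -> R.
Hypothesis env01 : forall w t a i, 0 <= env w t a i <= 1.
Hypothesis menv : forall t a i, measurable_fun setT (fun w => env w t a i).
Variable istar : 'I_K.

Local Notation Reg := (@pseudo_regret R K T d Om P theta 1 B env istar).
Local Notation EP := (@expected_pulls R d Om P K T B theta env).
Local Notation FR U := (@face_regret R d Om P K T B theta env U istar).

Lemma tuned_regret_bound (U : {set 'I_K}) j0 (b : 'I_K -> R) bU : j0 \in U ->
  (forall j, 0 < b j) -> 0 < bU ->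
  Reg <= 77 * s * (\sum_(j | j \notin U) b j * (EP j + 1)
    + bU * (\sum_(j | j \notin U) EP j + 1)
    + lnT * (#|U|%:R / bU + \sum_(j | j \notin U) 1 / b j))
  + 528 * (K%:R * lnK * lnT) + FR U.
Proof.
move=> j0U b0 bU0.
have EP0 j : 0 <= EP j by exact: (EP_ge0 P B8 theta0 T1 env01 istar).
apply: (le_trans (regret_bound P B8 theta0 theta2 T1 env01 menv istar j0U b0 bU0 istar)).
rewrite lerD2r lerD//.
have w0 j : 0 < stepsize U b bU j by rewrite /stepsize; case: ifP.
have ln1 : 0 <= ln (1 + n ^+ 2) by rewrite ln_ge0// lerDl exprn_ge0// ltW.
have S0 : 0 <= \sum_j ln (1 + n ^+ 2) / (4 * stepsize U b bU j).
  by apply: sumr_ge0 => j _; rewrite divr_ge0// mulr_ge0// ltW.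
have V0 : 0 <= \sum_(j | j \notin U) b j * (EP j + 1).
  by apply: sumr_ge0 => j _; rewrite mulr_ge0 ?addr_ge0// ltW.
have U0 : 0 <= bU * (\sum_(j | j \notin U) EP j + 1).
  by rewrite mulr_ge0 ?addr_ge0 ?sumr_ge0// ltW.
apply: ler_pM => //.
- exact: (leading_ge0 theta0 (ltnW T1)).
- by rewrite !addr_ge0.
rewrite lerD2l; apply: (@le_trans _ _ (\sum_j lnT / stepsize U b bU j)).
  apply: ler_sum => j _; rewrite invfM mulrA ler_wpM2r ?invr_ge0 ?(ltW (w0 j))//.
  by have := ln_sq_le; have := lnT0; lra.
rewrite -mulr_sumr ler_wpM2l ?(ltW lnT0)// (bigID (mem U))/=.
rewrite le_eqVlt; apply/orP; left; apply/eqP; congr (_ + _).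
  rewrite (eq_bigr (fun=> bU^-1)) => [|j]; last by rewrite /stepsize => ->.
  by rewrite sumr_const -[LHS]mulr_natl.
by apply: eq_bigr => j /negbTE jU; rewrite /stepsize jU div1r.
Qed.

Lemma face_regret_set1 : FR [set istar]%SET = 0.
Proof.
rewrite /face_regret.
rewrite (_ : (fun w t a => _) = fun _ _ _ => 0 * 1); last first.
  apply/funext => w; apply/funext => t; apply/funext => a; rewrite mul0r big1// => i _.
  have [->|ii] := eqVneq i istar; first by rewrite subrr mulr0.
  by rewrite face_out ?mul0r// inE.
rewrite (ERZ B8 theta0 T1 env01 menv istar 0 (H := fun _ _ _ => 1)) ?mul0r//.
by apply: round_intble_bmf => t a; exact: bmf_cst.
Qed.

Lemma regret_le_horizon : Reg <= n.
Proof.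
rewrite /pseudo_regret /loss_alg /loss_arm.
rewrite (Ealg_playedE P B8 theta0 T1 env01 istar (fun w t a i => env w t a i)).
rewrite (EalgE P B8 theta0 T1 env01 istar (fun w t a => env w t a istar)).
rewrite -(EP_sum P B8 theta0 T1 env01 menv istar) -(ER_sum B8 theta0 T1 env01 menv istar); last first.
  by move=> j; apply: round_intble_bmf => t a; exact: (bmf_kern B8 theta0 T1 env01 menv).
rewrite lerBlDr -[leLHS]addr0; apply: lerD.
  apply: (ER_le B8 theta0 T1 env01 menv istar).
  - move=> t a _ _; apply: intble_sum => i _; apply/bmf_intble/bmfM.
      exact: (bmf_kern B8 theta0 T1 env01 menv).
    exact: bmf_env.
  - move=> t a _ _; apply: intble_sum => i _; apply/bmf_intble.
    exact: (bmf_kern B8 theta0 T1 env01 menv).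
  - move=> w t a _ _; apply: ler_sum => i _.
    have /andP[k0 _] := kern_unit B8 theta0 T1 env01 istar w a i.
    have /andP[_ e1] := env01 w t a i.
    by rewrite -[leRHS]mulr1 ler_wpM2l.
rewrite -(_ : expected_rounds P T B theta env (fun _ _ _ => 0 * 1) = 0); last first.
  rewrite (ERZ B8 theta0 T1 env01 menv istar 0 (H := fun _ _ _ => 1)) ?mul0r//.
  by apply: round_intble_bmf => t a; exact: bmf_cst.
apply: (ER_le B8 theta0 T1 env01 menv istar).
- by apply: round_intble_bmf => t a; exact: bmf_cst.
- by apply: round_intble_bmf => t a; exact: bmf_env.
by move=> w t a _ _; rewrite mul0r; case/andP: (env01 w t a istar).
Qed.

(** If [r * ln T] already exceeds the horizon the bound is trivial; otherwise [r * lnK <= n], that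
    is [K * lnK <= r], and the barrier cost fits into the target. *)
Lemma adversarial_regret : Reg <= 1000 * (Num.sqrt (K%:R * n) * lnT).
Proof.
have k0 : 0 < K%:R :> R by rewrite ltr0n ltnW.
have kn0 : 0 < K%:R * n by rewrite mulr_gt0.
set r := Num.sqrt _; have r0 : 0 < r by rewrite sqrtr_gt0.
have rr : r ^+ 2 = K%:R * n by rewrite sqr_sqrtr// ltW.
have lnK0 : 0 < lnK by have := lnK2; lra.
have rl0 : 0 <= r * lnT by rewrite mulr_ge0 ?ltW.
have [TK|KTl] := leP n (r * lnT).
  by apply: (le_trans regret_le_horizon); lra.
have Kr : K%:R * lnK <= r.
  have : r * lnK <= n.
    by apply: (le_trans _ (ltW KTl)); rewrite ler_pM2l.
  move=> h; rewrite -(@ler_pM2l _ r)// -expr2 rr.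
  by rewrite mulrCA ler_pM2l.
(* Balances the pulls [beta * n] with the logarithmic part [K * lnT / beta]: both equal [s * r]. *)
pose beta := s * r / n; have b0 : 0 < beta by rewrite divr_gt0// mulr_gt0.
have := @tuned_regret_bound [set istar]%SET istar (fun=> beta) beta.
rewrite inE eqxx face_regret_set1 addr0 cards1 => /(_ isT (fun=> b0) b0) h.
apply: (le_trans h).
have EP0 j : 0 <= EP j by exact: (EP_ge0 P B8 theta0 T1 env01 istar).
have hE : \sum_(j | j \notin [set istar]%SET) EP j <= n.
  rewrite -(EP_sum P B8 theta0 T1 env01 menv istar) [leRHS](bigID (mem [set istar]%SET))/=.
  by rewrite lerDr sumr_ge0.
have h1 : \sum_(j | j \notin [set istar]%SET) (1 : R) <= K%:R.
  rewrite -[X in _ <= X%:R](card_ord K) -sumr_const [leRHS](bigID (mem [set istar]%SET))/=.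
  by rewrite lerDr sumr_ge0.
have h2 : 1 + \sum_(j | j \notin [set istar]%SET) (1 : R) <= K%:R.
  rewrite -[X in _ <= X%:R](card_ord K) -sumr_const [leRHS](bigID (mem [set istar]%SET))/=.
  by rewrite lerD2r sumr_const cards1.
rewrite -mulr_sumr big_split/=.
rewrite [\sum_(j | _) 1 / beta](_ : _ = (\sum_(j | j \notin [set istar]%SET) 1) / beta); last first.
  by rewrite mulr_suml.
rewrite -mulrDl.
set E := \sum_(j | _) EP j in hE *; set N1 := \sum_(j | _) 1 in h1 h2 *.
have bn : beta * n = s * r by rewrite /beta divfK// gt_eqF.
have Kb : K%:R / beta * lnT = s * r.
  rewrite /beta -ss; apply: (mulIf (lt0r_neq0 b0)); rewrite /beta.
  transitivity (K%:R * n * s ^+ 2 / n).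
    by field; rewrite !gt_eqF.
  by rewrite -rr; field; rewrite gt_eqF.
have q1 : beta * (E + N1) <= 2 * (s * r).
  rewrite -bn mulrCA ler_pM2l//; have := kn; lra.
have q2 : beta * (E + 1) <= 2 * (s * r).
  rewrite -bn mulrCA ler_pM2l//; have := n2; lra.
have q3 : lnT * ((1 + N1) / beta) <= s * r.
  by rewrite -Kb mulrC ler_pM2r// ler_pM2r ?invr_gt0.
have q4 : 77 * s * (beta * (E + N1) + beta * (E + 1) + lnT * ((1 + N1) / beta)) <=
    77 * s * (5 * (s * r)).
  by rewrite ler_pM2l ?mulr_gt0//; lra.
have q5 : 77 * s * (5 * (s * r)) = 385 * (r * lnT) by rewrite -ss; ring.
have q6 : K%:R * lnK * lnT <= r * lnT by rewrite ler_pM2r.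
lra.
Qed.

(** Stated with a free [U] and with [2 * G] so as to cover both the face of zero-gap arms and, if
    there are none, the face of [istar] alone. *)
Lemma stochastic_regret (U : {set 'I_K}) j0 (Delta : 'I_K -> R) (dl C G D : R) :
  j0 \in U -> (forall i, 0 <= Delta i <= 1) -> 0 < dl -> dl <= 1 ->
  (forall j, j \notin U -> dl <= Delta j) ->
  0 < G -> #|U|%:R / dl + \sum_(j | j \notin U) 1 / Delta j <= 2 * G ->
  0 <= C -> 0 <= D -> FR U <= D ->
  @self_bounding R K T d Om P theta 1 B env istar Delta C ->
  Reg <= 400 ^+ 2 * (G * lnT ^+ 2 + Num.sqrt (C * G * lnT ^+ 2)
    + K%:R ^+ 2 * lnT `^ (3 / 2) + D).
Proof.
move=> j0U D01 dl0 dl1 dlD G0 GD C0 D0 fD.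
rewrite /self_bounding (gap_termE P B8 theta0 T1 env01 menv istar Delta).
set Gam := \sum_j _ => sb.
have EP0 j : 0 <= EP j by exact: (EP_ge0 P B8 theta0 T1 env01 istar).
have k0 : 0 < K%:R :> R by rewrite ltr0n ltnW.
have -> : lnT `^ (3 / 2) = s ^+ 3.
  rewrite (_ : 3 / 2 = 2^-1 + 1); last by field.
  rewrite powRD; last by apply/implyP => _; rewrite gt_eqF.
  by rewrite powR12_sqrt ?(ltW lnT0)// powRr1 ?(ltW lnT0)// -/s exprS ss.
set Lam := G * lnT ^+ 2.
have Lam0 : 0 < Lam by rewrite mulr_gt0 ?exprn_gt0.
rewrite -[C * G * _]mulrA -/Lam sqrtrM//.
set x := Num.sqrt Lam; set y := Num.sqrt C.
have x0 : 0 < x by rewrite sqrtr_gt0.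
have y0 : 0 <= y by rewrite sqrtr_ge0.
have xx : x ^+ 2 = Lam by rewrite sqr_sqrtr// ltW.
have yy : y ^+ 2 = C by rewrite sqr_sqrtr.
have p308 : 0 < 308 :> R by rewrite ltr0n.
have D308 : 0 < 308 * x + y by apply: ltr_pwDl y0; exact: mulr_gt0.
(* The pulls cost [154 * eta * Gam], so [308 * eta <= 1] lets half of the regret absorb them after
   self-bounding. Under this cap [eta] balances [eta * C] with [Lam / eta], up to constants. *)
pose eta := x / (308 * x + y); have eta0 : 0 < eta by rewrite divr_gt0.
have eta1 : 308 * eta <= 1 by rewrite /eta mulrA ler_pdivrMr// mul1r lerDl.
have etaC : eta * C <= y * x.
  rewrite /eta -yy mulrAC ler_pdivrMr//.
  have := mulr_ge0 (mulr_ge0 y0 (ltW x0)) (mulr_ge0 (ltW p308) (ltW x0)).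
  nra.
have etaL : Lam / eta = 308 * Lam + y * x.
  by rewrite -xx /eta; field; rewrite !gt_eqF.
(* The division by [s] cancels the leading factor [77 * s]. Weights proportional to the gaps, with
   [dl] for the common weight [bU], bound both pull terms by multiples of [Gam]. *)
pose b j := if j \in U then 1 else eta * Delta j / s.
pose bU := eta * dl / s.
have b0 j : 0 < b j.
  rewrite /b; case: ifPn => // /dlD h.
  by rewrite divr_gt0// mulr_gt0//; lra.
have bU0 : 0 < bU by rewrite divr_gt0// mulr_gt0.
have := tuned_regret_bound j0U b0 bU0.
have e1 : \sum_(j | j \notin U) b j * (EP j + 1) <= eta / s * (Gam + K%:R).
  have : \sum_(j | j \notin U) Delta j * (EP j + 1) <= Gam + K%:R.
    rewrite -[X in _ <= _ + X%:R](card_ord K) -sumr_const /Gam -big_split/=.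
    rewrite [leRHS](bigID (mem U))/= -[leLHS]add0r; apply: lerD.
      apply: sumr_ge0 => j _; have /andP[h _] := D01 j.
      by rewrite addr_ge0// mulr_ge0.
    apply: ler_sum => j _; have /andP[_ h] := D01 j; rewrite mulrDr mulr1 lerD2l//.
  rewrite -(@ler_pM2l _ (eta / s)) ?divr_gt0//; apply: le_trans.
  rewrite mulr_sumr le_eqVlt; apply/orP; left; apply/eqP; apply: eq_bigr => j jU.
  by rewrite /b (negbTE jU); ring.
have e2 : bU * (\sum_(j | j \notin U) EP j + 1) <= eta / s * (Gam + 1).
  rewrite [leLHS](_ : _ = eta / s * (dl * (\sum_(j | j \notin U) EP j + 1))); last first.
    by rewrite /bU; ring.
  rewrite ler_pM2l ?divr_gt0// mulrDr mulr1 lerD// mulr_sumr.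
  rewrite /Gam [leRHS](bigID (mem U))/= -[leLHS]add0r; apply: lerD.
    apply: sumr_ge0 => j _; have /andP[h _] := D01 j; exact: mulr_ge0.
  by apply: ler_sum => j jU; rewrite ler_wpM2r// dlD.
have e3 : #|U|%:R / bU + \sum_(j | j \notin U) 1 / b j <= s / eta * (2 * G).
  apply: le_trans (ler_wpM2l _ GD); last by rewrite divr_ge0 ?ltW.
  rewrite mulrDr mulr_sumr le_eqVlt; apply/orP; left; apply/eqP; congr (_ + _).
    by rewrite /bU; field; rewrite !gt_eqF.
  apply: eq_bigr => j jU; rewrite /b (negbTE jU); field.
  by rewrite !gt_eqF//; have := dlD _ jU; lra.
have f1 : 77 * s * (\sum_(j | j \notin U) b j * (EP j + 1)
    + bU * (\sum_(j | j \notin U) EP j + 1)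
    + lnT * (#|U|%:R / bU + \sum_(j | j \notin U) 1 / b j)) <=
    77 * s * (eta / s * (Gam + K%:R) + eta / s * (Gam + 1) + lnT * (s / eta * (2 * G))).
  rewrite ler_pM2l ?mulr_gt0// !lerD// ler_pM2l//.
have f2 : 77 * s * (eta / s * (Gam + K%:R) + eta / s * (Gam + 1) + lnT * (s / eta * (2 * G))) =
    77 * (eta * (2 * Gam + K%:R + 1)) + 154 * (Lam / eta).
  by rewrite /Lam -ss; field; rewrite !gt_eqF.
rewrite f2 etaL in f1.
have Y1 : K%:R * lnK * lnT <= 2 * (K%:R ^+ 2 * s ^+ 3).
  rewrite expr2 -ss [s ^+ 3]exprS [leRHS](_ : _ = K%:R * K%:R * (2 * s * s ^+ 2)); last by ring.
  apply: ler_pM.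
  - by rewrite mulr_ge0 ?(ltW k0)//; have := lnK2; lra.
  - exact: sqr_ge0.
  - by rewrite ler_pM2l.
  - by rewrite ler_peMl ?sqr_ge0//; have := s2; lra.
have s38 : 8^-1 <= s ^+ 3.
  have -> : 8^-1 = 2^-1 ^+ 3 :> R by field.
  by rewrite lerXn2r ?nnegrE ?(ltW s0)// invr_ge0.
have Y2 : K%:R + 1 <= 16 * (K%:R ^+ 2 * s ^+ 3).
  have : K%:R ^+ 2 * 8^-1 <= K%:R ^+ 2 * s ^+ 3 by rewrite ler_wpM2l ?sqr_ge0.
  have := k2; rewrite expr2; nra.
have Y0 : 0 <= K%:R ^+ 2 * s ^+ 3 by rewrite mulr_ge0 ?sqr_ge0// exprn_ge0// ltW.
have yx0 : 0 <= y * x by rewrite mulr_ge0// ltW.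
move: f1 Y1 Y2 Y0 fD; set Y := K%:R ^+ 2 * s ^+ 3; set f := FR U; set X := K%:R * lnK * lnT.
set bracket := 77 * s * _ => f1 Y1 Y2 Y0 fD hReg.
have g1 : eta * Gam <= eta * Reg + y * x.
  by have := ler_wpM2l (ltW eta0) sb; lra.
have g2 : eta * (K%:R + 1) <= 16 * Y.
  apply: le_trans Y2; rewrite ler_piMl ?addr_ge0 ?(ltW k0)//; lra.
(* Replacing [308 * eta * Reg] by [Reg] requires a nonnegative regret; a negative one is settled by
   the sign of the right-hand side, where [0 <= D] enters. *)
have [Reg0|Reg0] := leP Reg 0.
  apply: (le_trans Reg0); apply: mulr_ge0; first exact: sqr_ge0.
  by apply: addr_ge0 => //; apply: addr_ge0 => //; apply: addr_ge0 => //; exact: ltW.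
have g3 : 308 * (eta * Reg) <= Reg.
  by rewrite mulrA -[leRHS]mul1r ler_wpM2r// ltW.
lra.
Qed.

End Tuning.

Section GapQuantities.
Context {R : realType} {K : nat}.
Variable Delta : 'I_K -> R.
Hypothesis D01 : forall i, 0 <= Delta i <= 1.

Lemma Delta_gt0 i : Delta i != 0 -> 0 < Delta i.
Proof. by move=> Di; rewrite lt_def Di; case/andP: (D01 i). Qed.

Lemma Delta_min_le i : Delta i != 0 -> Delta_min Delta <= Delta i.
Proof. by move=> Di; apply: (bigmin_le_cond 1 (fun i => Delta i)). Qed.

Lemma Delta_min_le1 : Delta_min Delta <= 1.
Proof. exact: bigmin_le_id. Qed.

Lemma Delta_min_gt0 : 0 < Delta_min Delta.
Proof.
by rewrite /Delta_min; elim/big_ind: _ => // [x y x0 y0|i]; [rewrite lt_min x0|exact: Delta_gt0].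
Qed.

(** The definition counts a classical set; here the count is that of a finite set, to match the
    faces. *)
Lemma bigGE : bigG Delta =
  #|[set i | Delta i == 0]%SET|%:R / Delta_min Delta + \sum_(i | Delta i != 0) 1 / Delta i.
Proof.
rewrite /bigG; congr (_%:R / _ + _); apply: eq_card => i.
by rewrite inE; apply/idP/idP => [/set_mem|/mem_set].
Qed.

Lemma bigG_gt0 i : Delta i != 0 -> 0 < bigG Delta.
Proof.
move=> Di; rewrite bigGE ltr_wpDl ?divr_ge0 ?(ltW Delta_min_gt0)//.
rewrite (bigD1 i)//= ltr_pwDl ?divr_gt0 ?Delta_gt0// sumr_ge0// => j /andP[Dj _].
by rewrite divr_ge0// ltW// Delta_gt0.
Qed.

(** The minimum is either a gap, whose inverse is one of the summands, or the initial value 1, and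
    then [Delta i <= 1] makes the sum at least 1. *)
Lemma Delta_minV_le i : Delta i != 0 ->
  1 / Delta_min Delta <= \sum_(i | Delta i != 0) 1 / Delta i.
Proof.
move=> Di; set x := \sum_(_ | _) _.
have xge j : Delta j != 0 -> 1 / Delta j <= x.
  move=> Dj; rewrite /x (bigD1 j)//= lerDl sumr_ge0// => k /andP[Dk _].
  by rewrite divr_ge0// ltW// Delta_gt0.
have inv1 j : Delta j != 0 -> 1 <= 1 / Delta j.
  move=> Dj; rewrite ler_pdivlMr ?Delta_gt0// mul1r.
  by case/andP: (D01 j).
have x1 : 1 <= x by apply: (le_trans (inv1 _ Di)); exact: xge.
have x0 : 0 < x by lra.
rewrite ler_pdivrMr ?Delta_min_gt0// mulrC -ler_pdivrMr//.
apply: le_bigmin => [|j Dj]; first by rewrite ler_pdivrMr// mul1r.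
by rewrite ler_pdivrMr// mulrC -ler_pdivrMr ?Delta_gt0// xge.
Qed.

End GapQuantities.

Unset Implicit Arguments.

Theorem theorem2 :
  forall R : realType, exists c : R, 0 < c /\
  forall (K T : nat), (2 <= K)%N -> (K <= T)%N ->
  forall (d : measure_display) (Omega : measurableType d) (P : probability Omega R)
         (env : Omega -> nat -> seq 'I_K -> 'I_K -> R),
  (forall w t a i, 0 <= env w t a i <= 1) ->
  (forall t a i, measurable_fun setT (fun w => env w t a i)) ->
  let lnT := ln (T%:R : R) in
  let theta := Num.sqrt (1 / lnT) in
  let alpha := 1 : R in
  let Clog := 162 * ln (K%:R : R) in
  forall istar : 'I_K,
  (forall i, loss_arm T P theta alpha Clog env istar <= loss_arm T P theta alpha Clog env i) ->
  let Reg := pseudo_regret T P theta alpha Clog env istar in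
  Reg <= c * (Num.sqrt (K%:R * T%:R) * lnT) /\
  (forall (Delta : 'I_K -> R) (C : R),
     (forall i, 0 <= Delta i <= 1) -> 0 <= C ->
     self_bounding T P theta alpha Clog env istar Delta C ->
     (exists i, Delta i != 0) ->
     forall D : R,
     (exists g : nat -> seq 'I_K -> 'I_K -> Omega -> R,
        (forall (t : nat) (a : seq 'I_K) (i : 'I_K), (t < T)%N -> size a = t ->
           is_cond_exp P (hist_sigma env t a)
             (fun w => env w t a i - env w t a istar) (g t a i)) /\
        Ealg P theta alpha Clog env
          (fun w (s : T.-tuple 'I_K) => \sum_(t < T) maxU Delta (fun i => g t (take t s) i w)) <= D) ->
     Reg <= c * (bigG Delta * lnT ^+ 2
                 + Num.sqrt (C * bigG Delta * lnT ^+ 2)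
                 + K%:R ^+ 2 * lnT `^ (3 / 2)
                 + D)).
Proof.
(* The largest coefficient is that of [G * lnT ^+ 2]: [2 * 154 * 308 = 94864], the factor 2 coming
   from absorbing half of the regret. *)
move=> R; exists (400 ^+ 2); split; first by rewrite exprn_gt0 ?ltr0n.
move=> K T K2 KT d Om P env env01 menv lnT theta alpha Clog istar best Reg.
have T1 : (1 < T)%N by exact: leq_trans K2 KT.
have lnT0 : 0 < lnT by rewrite ln_gt0// ltr1n.
split.
  apply: (le_trans (adversarial_regret P K2 KT env01 menv istar)).
  apply: ler_wpM2r; first by rewrite mulr_ge0 ?sqrtr_ge0 ?(ltW lnT0).
  by rewrite expr2; lra.
move=> Delta C D01 C0 sb [v Dv] D [g [gP gD]].
pose U := [set i | Delta i == 0]%SET.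
have B8 : 8 <= Clog by apply: tuned_barrier_ge.
have theta0 : 0 < theta by apply: tuned_rate_gt0 K2 KT.
rewrite (EalgE P B8 theta0 T1 env01 istar
  (fun w t a => maxU Delta (fun i => g t a i w))) in gD.
have dG := bigG_gt0 D01 Dv.
have UV j : (j \notin U) = (Delta j != 0) by rewrite inE.
have sumV : \sum_(j | j \notin U) 1 / Delta j = \sum_(j | Delta j != 0) 1 / Delta j.
  by apply: eq_bigl => j; exact: UV.
have V0 : 0 <= \sum_(j | Delta j != 0) 1 / Delta j.
  by apply: sumr_ge0 => j Dj; rewrite divr_ge0// ltW// Delta_gt0.
(* Without zero-gap arms the face is [[set istar]], of zero face regret, and [maxU] is 0 by
   convention, so [0 <= D]. The extra [1 / Delta_min] of this one-arm face is absorbed by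
   [Delta_minV_le], which doubles [bigG]. *)
have [U0|[j0 j0U]] := set_0Vmem U.
  have Dn0 j : Delta j != 0 by rewrite -UV U0 inE.
  apply: (stochastic_regret K2 KT env01 menv (U := [set istar]%SET) (j0 := istar)
    (Delta := Delta) (dl := Delta_min Delta)) => //.
  - by rewrite inE.
  - exact: Delta_min_gt0.
  - exact: Delta_min_le1.
  - by move=> j _; exact: Delta_min_le.
  - have -> : bigG Delta = \sum_(j | Delta j != 0) 1 / Delta j.
      by rewrite bigGE -/U U0 cards0 mul0r add0r.
    rewrite [leRHS]mulr_natl mulr2n cards1.
    apply: lerD; first exact: (Delta_minV_le D01 Dv).
    rewrite [leRHS](bigID (mem [set istar]%SET))/=.
    rewrite [X in _ <= _ + X](eq_bigl (fun j => j \notin [set istar]%SET)) => [|j]; last by rewrite Dn0.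
    rewrite lerDr; apply: sumr_ge0 => j _; rewrite divr_ge0// ltW// Delta_gt0//.
  - apply: le_trans gD; apply: Rintegral_ge0 => w _; apply: sumr_ge0 => t _.
    rewrite (@eq_seqE _ _ _ _ _ (fun=> 0 * 1)); first by rewrite seqEZ mul0r.
    move=> a _; rewrite mul0r /maxU; case: pickP => // j.
    by rewrite (negbTE (Dn0 j)).
  - rewrite face_regret_set1//; apply: le_trans gD.
    apply: Rintegral_ge0 => w _; apply: sumr_ge0 => t _.
    rewrite (@eq_seqE _ _ _ _ _ (fun=> 0 * 1)); first by rewrite seqEZ mul0r.
    move=> a _; rewrite mul0r /maxU; case: pickP => // j.
    by rewrite (negbTE (Dn0 j)).
apply: (stochastic_regret K2 KT env01 menv (U := U) (j0 := j0)
    (Delta := Delta) (dl := Delta_min Delta)) => //.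
- exact: Delta_min_gt0.
- exact: Delta_min_le1.
- by move=> j; rewrite UV; exact: Delta_min_le.
- by rewrite sumV -bigGE [leRHS]mulr_natl mulr2n lerDl ltW.
- apply: le_trans gD; exact: (max_regret_ge0 B8 theta0 T1 env01 menv istar gP j0U best).
- apply: le_trans gD; exact: (face_regret_le B8 theta0 T1 env01 menv istar gP j0U).
Qed.
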